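(* Let $\{\mathcal{T}_1,\mathcal{T}_2,(\mathcal{E}^{\infty}_{h_2})_{0\le h_2\le \iota_2-1},(S^{\infty}_{d_{h_2}})_{0\le h_2\le \iota_2-1}\}$ be an admissible set, where the good covering $(\mathcal{E}^{\infty}_{h_2})_{0\le h_2\le\iota_2-1}$ satisfies the additional condition described in the context, and let $\mu_2,\chi_2^\infty,\theta_{h_2},\mathcal{T}_{2,\epsilon,\mu_2}$ be as in the context. For every $0\le h_2\le \iota_2-1$ and $\epsilon\in\mathcal{E}^{\infty}_{h_2}$, the function $(t_1,t_2,z)\mapsto u_{d_{h_2}}(t_1,t_2,z,\epsilon)$ given by $$u_{d_{h_2}}(t_1,t_2,z,\epsilon)=\frac{1}{(2\pi)^{1/2}}\int_{-\infty}^{\infty}\int_{L_{\xi_{h_2}}}\omega_{d_{h_2}}(u,m,\epsilon)\exp\left(-\left(\frac{u}{\epsilon^{\lambda_1}t_1}\right)^{k_1}-\left(\frac{u}{\epsilon^{\lambda_2}t_2}\right)^{k_2}\right)e^{izm}\frac{du}{u}dm$$ defines a bounded holomorphic function on $\mathcal{T}_1\times\mathcal{T}_{2,\epsilon,\mu_2}\times H_{\beta'}$ for all $0<\beta'<\beta$, which is an actual solution of (E) (called an inner solution). Moreover, for every $0\le h_2\le\iota_2-1$ there exist $\tilde{C},\tilde{D}>0$ such that for every $\epsilon\in\mathcal{E}^{\infty}_{h_2}\cap\mathcal{E}^{\infty}_{h_2+1}$, $$\sup_{t_1\in\mathcal{T}_1,\,x_2\in\chi_2^\infty,\,z\in H_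{\beta'}}\left|u_{d_{h_2+1}}\left(t_1,x_2\epsilon^{-\mu_2}e^{\theta_{h_2}\sqrt{-1}},z,\epsilon\right)-u_{d_{h_2}}\left(t_1,x_2\epsilon^{-\mu_2}e^{\theta_{h_2}\sqrt{-1}},z,\epsilon\right)\right|\le\tilde{C}\exp\left(-\frac{\tilde{D}}{|\epsilon|^{\lambda_1k_1}}\right).$$
   Context: Notation: $D(0,r)$, $\overline{D}(0,r)$ are the open and closed discs in $\mathbb{C}$; $H_\beta=\{z\in\mathbb{C}:|\mathrm{Im}(z)|<\beta\}$. For $\beta,\mu\in\mathbb{R}$, $E_{(\beta,\mu)}$ is the Banach space of continuous $h:\mathbb{R}\to\mathbb{C}$ with $\|h\|_{(\beta,\mu)}=\sup_{m\in\mathbb{R}}(1+|m|)^{\mu}e^{\beta|m|}|h(m)|<\infty$. $\mathcal{F}^{-1}(f)(z)=(2\pi)^{-1/2}\int_{-\infty}^{\infty}f(m)e^{izm}dm$. $L_\gamma=[0,\infty)e^{\gamma\sqrt{-1}}$. Data. Let $1\le k_1<k_2$, $D_1,D_2\ge2$, $\lambda_1,\lambda_2\ge 1$ be integers, and $\delta_{\ell_1},\delta_{\ell_2},\Delta_{\ell_1\ell_2}$ ($1\le\ell_1\le D_1$, $1\le\ell_2\le D_2$) non-negative integers such that $\Delta_{D_1D_2}=\lambda_1k_1\delta_{D_1}+\lambda_2k_2\delta_{D_2}$, $\lambda_2k_2>\lambda_1k_1$, and, for $1\le\ell_1\le D_1-1$, $1\le\ell_2\le D_2-1$, $\Delta_{\ell_1\ell_2}>\lambda_1k_1\delta_{\ell_1}+\lambda_2k_2\delta_{\ell_2}$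 and $k_1\delta_{D_1}+k_2\delta_{D_2}\ge k_1\delta_{\ell_1}+k_2\delta_{\ell_2}$. (The families $\delta_{\ell_1}$ and $\delta_{\ell_2}$ are two separate families, attached to $t_1$ and $t_2$ respectively.) Let $Q,R_{D_1D_2},R_{\ell_1\ell_2}\in\mathbb{C}[X]$ with $\deg R_{\ell_1\ell_2}\le\deg R_{D_1D_2}$, $R_{D_1D_2}(im)\ne0$ for $m\in\mathbb{R}$, and $Q(im)/R_{D_1D_2}(im)\in A:=\{z: r^1\le|z|\le r^2,\ \arg z\in(\alpha,\alpha')\}$ for all $m\in\mathbb{R}$, for some $0<r^1<r^2$, $\alpha<\alpha'$. Let $\beta,\nu>0$, $\mu>1+\deg R_{\ell_1\ell_2}$ for all $1\le\ell_j\le D_j-1$, with $\mu>1$, and let $k'$ be an integer with $k_1<k'<k_2$. Let $\epsilon_0>0$. For $1\le\ell_j\le D_j-1$ let $C_{\ell_1\ell_2}(m,\epsilon)$ be such that $C_{\ell_1\ell_2}(\cdot,\epsilon)\in E_{(\beta,\mu)}$ with $\sup_{\epsilon\in D(0,\epsilon_0)}\|C_{\ell_1\ell_2}(\cdot,\epsilon)\|_{(\beta,\mu)}\le\mathcal{C}_{\ell_1\ell_2}<\infty$, and $c_{\ell_1\ell_2}(z,\epsilon)=\mathcal{F}^{-1}(m\mapsto C_{\ell_1\ell_2}(m,\epsilon))(z)$ holomorphic on $H_\beta\times D(0,\epsilon_0)$. Let $\psi:\mathbb{C}\times\mathbb{R}\times D(0,\epsilon_0)\to\mathbb{C}$ be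 entire in the first variable, continuous in the second, holomorphic in the third, with $|\psi(\tau,m,\epsilon)|\le C_\psi(1+|m|)^{-\mu}e^{-\beta|m|}e^{\nu|\tau|^{k'}}|\tau|$, $C_\psi>0$. Set $F(T_1,T_2,m,\epsilon)=\int_{L_\gamma}\psi(u,m,\epsilon)\exp(-(u/T_1)^{k_1}-(u/T_2)^{k_2})\frac{du}{u}$, where the direction $\gamma$ may be rotated with $(T_1,T_2)$ (analytic continuation), and $f(t_1,t_2,z,\epsilon)=\mathcal{F}^{-1}(m\mapsto F(\epsilon^{\lambda_1}t_1,\epsilon^{\lambda_2}t_2,m,\epsilon))(z)$. Main problem (E): $$Q(\partial_z)u=\epsilon^{\Delta_{D_1D_2}}(t_1^{k_1+1}\partial_{t_1})^{\delta_{D_1}}(t_2^{k_2+1}\partial_{t_2})^{\delta_{D_2}}R_{D_1D_2}(\partial_z)u+\sum_{1\le\ell_1\le D_1-1,\,1\le\ell_2\le D_2-1}\epsilon^{\Delta_{\ell_1\ell_2}}(t_1^{k_1+1}\partial_{t_1})^{\delta_{\ell_1}}(t_2^{k_2+1}\partial_{t_2})^{\delta_{\ell_2}}c_{\ell_1\ell_2}(z,\epsilon)R_{\ell_1\ell_2}(\partial_z)u+f,$$ $u=u(t_1,t_2,z,\epsilon)$, with initial data $u(0,t_2,z,\epsilon)\equiv u(t_1,0,z,\epsilon)\equiv0$. The function $\omega_d$. Let $P_m(\tau)=Q(im)-k_1^{\delta_{D_1}}k_2^{\delta_{D_2}}\tau^{k_1\delta_{D_1}+k_2\delta_{D_2}}R_{D_1D_2}(im)$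 with roots $q_l(m)$, $0\le l\le k_1\delta_{D_1}+k_2\delta_{D_2}-1$. The aperture of $A$ is taken small enough so that the roots $q_l(m)$ stay in a union $\mathcal{U}$ of unbounded sectors with vertex 0 not covering a full neighborhood of $0$ in $\mathbb{C}^\star$; $\rho>0$ is such that $|q_l(m)|\ge2\rho$ for all $l,m$. A sector $S_d$ (open, unbounded, vertex $0$, bisecting direction $d\in\mathbb{R}$) is called suitable if $S_d\cap\mathcal{U}=\emptyset$ and there is $\mathfrak{m}>0$ with $|\tau-q_l(m)|\ge\mathfrak{m}(1+|\tau|)$ for all $l$, $m\in\mathbb{R}$, $\tau\in S_d\cup D(0,\rho)$. $\mathrm{Exp}^d_{(\nu,\beta,\mu,k')}$ is the Banach space of continuous $h:(S_d\cup\overline{D}(0,\rho))\times\mathbb{R}\to\mathbb{C}$, holomorphic in $\tau$ on $S_d\cup D(0,\rho)$, with finite norm $\|h\|=\sup_{\tau,m}(1+|m|)^\mu e^{\beta|m|}e^{-\nu|\tau|^{k'}}|\tau|^{-1}|h(\tau,m)|$. Fix $\varpi>0$; $\epsilon_0$ and $C_\psi$ are assumed small enough so that for each suitable sector considered and every $\epsilon\in D(0,\epsilon_0)$ the map $$\mathcal{H}_\epsilon(\omega)=\frac{1}{P_m(\tau)}\Big(\sum_{\ell_1,\ell_2}\epsilon^{\Delta_{\ell_1\ell_2}-\lambda_1k_1\delta_{\ell_1}-\lambda_2k_2\delta_{\ell_2}}(k_1\tau^{k_1})^{\delta_{\ell_1}}(k_2\tau^{k_2})^{\delta_{\ell_2}}\frac{1}{(2\pi)^{1/2}}\int_{-\infty}^\infty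 C_{\ell_1\ell_2}(m-m_1,\epsilon)R_{\ell_1\ell_2}(im_1)\omega(\tau,m_1)dm_1+\psi(\tau,m,\epsilon)\Big)$$ (sum over $1\le\ell_j\le D_j-1$) is a $\tfrac12$-contraction of the closed ball of radius $\varpi$ of $\mathrm{Exp}^d_{(\nu,\beta,\mu,k')}$ into itself; $\omega_d(\tau,m,\epsilon)$ denotes its fixed point. Good covering. $(\mathcal{E}^\infty_{h_2})_{0\le h_2\le\iota_2-1}$, $\iota_2\ge2$, is a good covering in $\mathbb{C}^\star$: open sectors with vertex $0$ contained in $D(0,\epsilon_0)$, with $\mathcal{E}^\infty_{h_2}\cap\mathcal{E}^\infty_{h_2+1}\neq\emptyset$ for all $h_2$ (indices cyclic, $\mathcal{E}^\infty_{\iota_2}:=\mathcal{E}^\infty_0$), the intersection of any three different elements is empty, and the union covers a punctured disc centered at $0$. Admissible set. $\mathcal{T}_1$ is a bounded sector and $\mathcal{T}_2$ an unbounded sector, both with vertex $0$; $S^\infty_{d_{h_2}}$ is a suitable infinite sector of bisecting direction $d_{h_2}$. $\{\mathcal{T}_1,\mathcal{T}_2,(\mathcal{E}^\infty_{h_2}),(S^\infty_{d_{h_2}})\}$ is admissible if there is $\delta>0$ such that for all $h_2$, all $t_j\in\mathcal{T}_j$ ($j=1,2$) and $\epsilon\in\mathcal{E}^\infty_{h_2}$ there is $\xi_{h_2}\in\mathbb{R}$ (possibly depending on $t_1,t_2,\epsilon$) with $e^{\sqrt{-1}\xi_{h_2}}\in S^\infty_{d_{h_2}}$ and $k_j\xi_{h_2}-k_j\arg(\epsilon^{\lambda_j}t_j)\in(-\frac{\pi}{2}+\delta,\frac{\pi}{2}-\delta)$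 for $j=1,2$. This $\xi_{h_2}$ is the direction used in the integral defining $u_{d_{h_2}}$. Inner domains. $\mu_2>\lambda_2$ is an integer with $\lambda_1k_1>(\mu_2-\lambda_2)\left(\frac{1}{k'}-\frac{1}{k_2}\right)^{-1}$; $\chi_2^\infty=\{x_2\in\mathbb{C}^\star:r_{2,\infty}<|x_2|<R_{2,\infty},\ \arg(x_2)\in(\alpha_{2,\infty},\beta_{2,\infty})\}$ for some $0<r_{2,\infty}<R_{2,\infty}$, $\alpha_{2,\infty}<\beta_{2,\infty}$. Additional condition on the covering: for all $0\le h_2\le\iota_2-1$ one can choose $\theta_{h_2}\in\mathbb{R}$ (depending on $\mathcal{E}^\infty_{h_2}$) such that $\frac{x_2}{\epsilon^{\mu_2}}e^{\theta_{h_2}\sqrt{-1}}\in\mathcal{T}_2$ for all $x_2\in\chi_2^\infty$, $\epsilon\in\mathcal{E}^\infty_{h_2}$. Then $\mathcal{T}_{2,\epsilon,\mu_2}:=\{\frac{x_2}{\epsilon^{\mu_2}}e^{\theta_{h_2}\sqrt{-1}}:x_2\in\chi_2^\infty\}$.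
   Formalization: The suitable sectors S_{d_h} are assumed to have aperture at most 2π − π/k_2; this is automatic if P_m has two or more roots, and with one root a nearly full sector lets ξ_{h_2} lie on either side of the root, so that u_{d_{h_2}} is ill-defined. *)

(* Defs.v *)
From HB Require Import structures.
From mathcomp Require Import all_boot all_order all_algebra.
From mathcomp Require Import all_classical all_reals all_analysis.
From mathcomp Require Import complex.

Set Implicit Arguments.
Unset Strict Implicit.
Unset Printing Implicit Defensive.

Import Order.TTheory GRing.Theory Num.Theory.
Import numFieldNormedType.Exports.
Import Normc.

Local Open Scope classical_set_scope.
Local Open Scope ring_scope.
Local Open Scope complex_scope.

Local Notation Re := (@complex.Re _).
Local Notation Im := (@complex.Im _).

(* R[i] as a normed space over itself, so that derivatives and differentials of
   functions on R[i] are complex ones. *)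
HB.instance Definition _ (R : realType) := NormedModule.copy R[i] R[i]^o.

Section ComplexAnalysis.
Variable R : realType.
Local Notation C := R[i].

Definition cexp (z : C) : C :=
  (expR (Re z) * cos (Im z)) +i* (expR (Re z) * sin (Im z)).

Definition expi (a : R) : C := cos a +i* sin a.

(* [holomorphic_on D f] is used for open [D] only; for V = C * C or C * C * C
   it is joint complex (Frechet) differentiability. *)
Definition holomorphic_on (V : normedModType C) (D : set V) (f : V -> C) :=
  forall x, D x -> differentiable f x.

Definition cintegrable (D : set R) (f : R -> C) : Prop :=
  (@lebesgue_measure R).-integrable D (fun x => (Re (f x))%:E) /\
  (@lebesgue_measure R).-integrable D (fun x => (Im (f x))%:E).

Definition cint (D : set R) (f : R -> C) : C :=
  (\int[@lebesgue_measure R]_(x in D) Re (f x)) +i*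
  (\int[@lebesgue_measure R]_(x in D) Im (f x)).

(* L_xi = [0, +oo[ e^{i xi} is parametrized by r |-> r e^{i xi}. *)
Definition ray_integrand (xi : R) (g : C -> C) (r : R) : C :=
  g (r%:C * expi xi) * expi xi.
Definition ray_integrable (xi : R) (g : C -> C) : Prop :=
  cintegrable `[0, +oo[ (ray_integrand xi g).
Definition ray_int (xi : R) (g : C -> C) : C :=
  cint `[0, +oo[ (ray_integrand xi g).

Definition inv_fourier (h : R -> C) (z : C) : C :=
  ((Num.sqrt (2 * pi))^-1)%:C * cint setT (fun m => h m * cexp ((0 +i* 1) * z * m%:C)).

Definition disc (r : R) : set C := [set z | normc z < r].
Definition cdisc (r : R) : set C := [set z | normc z <= r].
Definition strip (b : R) : set C := [set z | `|Im z| < b].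

Definition sector (a b : R) : set C :=
  [set z | exists r t, [/\ 0 < r, a < t, t < b & z = r%:C * expi t]].

(* A sector of the plane has aperture at most 2 pi. *)
Definition unbounded_sector (T : set C) : Prop :=
  exists a b, [/\ a < b, b <= a + 2 * pi & T = sector a b].
Definition bounded_sector (T : set C) : Prop :=
  exists a b r, [/\ a < b, b <= a + 2 * pi, 0 < r & T = sector a b `&` disc r].

Definition norm_E (beta mu : R) (h : R -> C) : \bar R :=
  ereal_sup [set ((1 + `|m|) `^ mu * expR (beta * `|m|) * normc (h m))%:E
            | m in [set: R]].
Definition space_E (beta mu : R) (h : R -> C) : Prop :=
  continuous h /\ (norm_E beta mu h < +oo)%E.

(* As 0^-1 = 0, the point tau = 0 does not contribute to the supremum; the
   functions in [space_Exp] are continuous in tau, so those of finite norm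
   vanish there. *)
Definition norm_Exp (S : set C) (rho nu beta mu : R) (k' : nat)
    (h : C -> R -> C) : \bar R :=
  ereal_sup [set ((1 + `|p.2|) `^ mu * expR (beta * `|p.2|)
                  * expR (- (nu * normc p.1 ^+ k')) * (normc p.1)^-1
                  * normc (h p.1 p.2))%:E
            | p in (S `|` cdisc rho) `*` [set: R]].
Definition space_Exp (S : set C) (rho nu beta mu : R) (k' : nat)
    (h : C -> R -> C) : Prop :=
  [/\ {within (S `|` cdisc rho) `*` [set: R],
        continuous (fun p : C * R => h p.1 p.2)},
      (forall m, holomorphic_on (S `|` disc rho) (fun tau => h tau m)) &
      (norm_Exp S rho nu beta mu k' h < +oo)%E].

(* T = |T| e^{i a} for some determination a of arg T such that
   k xi - k a lies in ]- pi / 2 + delta, pi / 2 - delta[. *)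
Definition good_direction (delta : R) (k : nat) (xi : R) (T : C) : Prop :=
  T != 0 /\ exists a : R, [/\ T = (normc T)%:C * expi a,
    - (pi / 2) + delta < k%:R * xi - k%:R * a &
    k%:R * xi - k%:R * a < pi / 2 - delta].

End ComplexAnalysis.

(* The functions of the single index l_1 (resp. l_2) are [del1] (resp. [del2]);
   the families are only used for 1 <= l_1 <= D1 and 1 <= l_2 <= D2. *)
Record equation_data (R : realType) := EquationData {
  k1 : nat; k2 : nat; D1 : nat; D2 : nat; lam1 : nat; lam2 : nat;
  del1 : nat -> nat; del2 : nat -> nat; Del : nat -> nat -> nat;
  Q : {poly R[i]}; Rp : nat -> nat -> {poly R[i]};
  kp : nat; beta : R; nu : R; mu : R; eps0 : R;
  coefC : nat -> nat -> R -> R[i] -> R[i];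
  psi : R[i] -> R -> R[i] -> R[i]
}.

Section Equation.
Variables (R : realType) (P : equation_data R).
Local Notation C := R[i].

Definition coefc (l1 l2 : nat) (z eps : C) : C :=
  inv_fourier (fun m => P.(coefC) l1 l2 m eps) z.

Record equation_hyp : Prop := EquationHyp {
  hyp_k : (1 <= P.(k1) < P.(k2))%N;
  hyp_D : (2 <= P.(D1))%N /\ (2 <= P.(D2))%N;
  hyp_lam : (1 <= P.(lam1))%N /\ (1 <= P.(lam2))%N;
  hyp_Del_top : P.(Del) P.(D1) P.(D2) =
    (P.(lam1) * P.(k1) * P.(del1) P.(D1)
     + P.(lam2) * P.(k2) * P.(del2) P.(D2))%N;
  hyp_lam_k : (P.(lam1) * P.(k1) < P.(lam2) * P.(k2))%N;
  hyp_Del : forall l1 l2, (1 <= l1 < P.(D1))%N -> (1 <= l2 < P.(D2))%N ->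
    (P.(lam1) * P.(k1) * P.(del1) l1 + P.(lam2) * P.(k2) * P.(del2) l2
      < P.(Del) l1 l2)%N;
  hyp_del : forall l1 l2, (1 <= l1 < P.(D1))%N -> (1 <= l2 < P.(D2))%N ->
    (P.(k1) * P.(del1) l1 + P.(k2) * P.(del2) l2
      <= P.(k1) * P.(del1) P.(D1) + P.(k2) * P.(del2) P.(D2))%N;
  hyp_deg : forall l1 l2, (1 <= l1 < P.(D1))%N -> (1 <= l2 < P.(D2))%N ->
    (size (P.(Rp) l1 l2) <= size (P.(Rp) P.(D1) P.(D2)))%N;
  hyp_Rtop : forall m : R, (P.(Rp) P.(D1) P.(D2)).[0 +i* m] != 0;
  hyp_quot : exists r1 r2 al al' : R, [/\ 0 < r1, r1 < r2, al < al' &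
    forall m : R, exists r t : R,
      [/\ r1 <= r, r <= r2, al < t, t < al' &
        P.(Q).[0 +i* m] / (P.(Rp) P.(D1) P.(D2)).[0 +i* m] = r%:C * expi t]];
  hyp_beta : 0 < P.(beta);
  hyp_nu : 0 < P.(nu);
  hyp_mu : 1 < P.(mu);
  (* (size p).-1 is 0 for p = 0, where the condition is [hyp_mu] again *)
  hyp_mu_deg : forall l1 l2, (1 <= l1 < P.(D1))%N -> (1 <= l2 < P.(D2))%N ->
    1 + ((size (P.(Rp) l1 l2)).-1)%:R < P.(mu);
  hyp_kp : (P.(k1) < P.(kp) < P.(k2))%N;
  hyp_eps0 : 0 < P.(eps0);
  hyp_coefC : forall l1 l2, (1 <= l1 < P.(D1))%N -> (1 <= l2 < P.(D2))%N ->
    (forall eps, disc P.(eps0) eps ->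
      space_E P.(beta) P.(mu) (fun m => P.(coefC) l1 l2 m eps)) /\
    exists K : R, forall eps, disc P.(eps0) eps ->
      (norm_E P.(beta) P.(mu) (fun m => P.(coefC) l1 l2 m eps) <= K%:E)%E;
  hyp_coefc : forall l1 l2, (1 <= l1 < P.(D1))%N -> (1 <= l2 < P.(D2))%N ->
    holomorphic_on (strip P.(beta) `*` disc P.(eps0))
      (fun p : C * C => coefc l1 l2 p.1 p.2);
  hyp_psi_tau : forall m eps, disc P.(eps0) eps ->
    holomorphic_on [set: C] (fun tau => P.(psi) tau m eps);
  hyp_psi_m : forall tau eps, disc P.(eps0) eps ->
    continuous (fun m => P.(psi) tau m eps);
  hyp_psi_eps : forall tau m,
    holomorphic_on (disc P.(eps0)) (fun eps => P.(psi) tau m eps);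
  hyp_psi : exists2 Cpsi : R, 0 < Cpsi &
    forall tau m eps, disc P.(eps0) eps ->
      normc (P.(psi) tau m eps) <=
        Cpsi * (1 + `|m|) `^ (- P.(mu)) * expR (- (P.(beta) * `|m|))
        * expR (P.(nu) * normc tau ^+ P.(kp)) * normc tau
}.

Definition borel_laplace_integrand (w : C -> C) (T1 T2 u : C) : C :=
  w u * cexp (- (u / T1) ^+ P.(k1) - (u / T2) ^+ P.(k2)) / u.

(* A choice [gam] of integration directions for F; it is constrained at each
   (T1, T2) for which F is defined, and F does not depend on it there. *)
Definition forcing_direction (gam : C -> C -> R) : Prop :=
  forall T1 T2 : C,
    (exists g, good_direction 0 P.(k1) g T1 /\ good_direction 0 P.(k2) g T2) ->
    good_direction 0 P.(k1) (gam T1 T2) T1 /\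
    good_direction 0 P.(k2) (gam T1 T2) T2.

Definition forcingF (gam : C -> C -> R) (T1 T2 : C) (m : R) (eps : C) : C :=
  ray_int (gam T1 T2)
    (borel_laplace_integrand (fun u => P.(psi) u m eps) T1 T2).
Definition forcing (gam : C -> C -> R) (t1 t2 z eps : C) : C :=
  inv_fourier (fun m =>
    forcingF gam (eps ^+ P.(lam1) * t1) (eps ^+ P.(lam2) * t2) m eps) z.

Definition irreg1 (k : nat) (v : C -> C -> C -> C) : C -> C -> C -> C :=
  fun t1 t2 z => t1 ^+ k.+1 * derive1 (fun s => v s t2 z) t1.
Definition irreg2 (k : nat) (v : C -> C -> C -> C) : C -> C -> C -> C :=
  fun t1 t2 z => t2 ^+ k.+1 * derive1 (fun s => v t1 s z) t2.
Definition poly_dz (p : {poly C}) (v : C -> C -> C -> C) : C -> C -> C -> C :=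
  fun t1 t2 z => \sum_(i < size p) p`_i * derive1n i (v t1 t2) z.

Definition main_equation (eps : C) (v f : C -> C -> C -> C) (t1 t2 z : C) :
    Prop :=
  poly_dz P.(Q) v t1 t2 z =
    eps ^+ P.(Del) P.(D1) P.(D2)
    * iter (P.(del1) P.(D1)) (irreg1 P.(k1))
        (iter (P.(del2) P.(D2)) (irreg2 P.(k2))
          (poly_dz (P.(Rp) P.(D1) P.(D2)) v)) t1 t2 z
    + \sum_(1 <= l1 < P.(D1)) \sum_(1 <= l2 < P.(D2))
        eps ^+ P.(Del) l1 l2
        * iter (P.(del1) l1) (irreg1 P.(k1))
            (iter (P.(del2) l2) (irreg2 P.(k2))
              (fun s1 s2 y =>
                coefc l1 l2 y eps * poly_dz (P.(Rp) l1 l2) v s1 s2 y)) t1 t2 z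
    + f t1 t2 z.

Definition Pm (m : R) : {poly C} :=
  (P.(Q).[0 +i* m])%:P
  - ((P.(k1)%:R ^+ P.(del1) P.(D1)) * (P.(k2)%:R ^+ P.(del2) P.(D2))
      * (P.(Rp) P.(D1) P.(D2)).[0 +i* m])
    *: 'X^(P.(k1) * P.(del1) P.(D1) + P.(k2) * P.(del2) P.(D2)).

(* Roots are quantified as a set rather than enumerated as q_l(m); if Pm m were
   the zero polynomial every point would be a root, which [U] excludes. *)
Definition root_domain (U : set C) (rho : R) : Prop :=
  [/\ (exists2 I : set (R * R), (forall p, I p -> p.1 < p.2) &
        U = \bigcup_(p in I) sector p.1 p.2),
      (~ exists2 r : R, 0 < r & disc r `\ 0 `<=` U),
      0 < rho &
      forall m q, root (Pm m) q -> U q /\ 2 * rho <= normc q].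

Definition suitable (U : set C) (rho : R) (S : set C) : Prop :=
  S `&` U = set0 /\
  exists2 M : R, 0 < M &
    forall m q tau, root (Pm m) q -> (S `|` disc rho) tau ->
      M * (1 + normc tau) <= normc (tau - q).

Definition mapH (eps : C) (w : C -> R -> C) (tau : C) (m : R) : C :=
  (Pm m).[tau]^-1 *
  (\sum_(1 <= l1 < P.(D1)) \sum_(1 <= l2 < P.(D2))
      eps ^+ (P.(Del) l1 l2 - P.(lam1) * P.(k1) * P.(del1) l1
              - P.(lam2) * P.(k2) * P.(del2) l2)
      * (P.(k1)%:R * tau ^+ P.(k1)) ^+ P.(del1) l1
      * (P.(k2)%:R * tau ^+ P.(k2)) ^+ P.(del2) l2
      * ((Num.sqrt (2 * pi))^-1)%:C
      * cint setT (fun m1 => P.(coefC) l1 l2 (m - m1) eps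
                             * (P.(Rp) l1 l2).[0 +i* m1] * w tau m1)
   + P.(psi) tau m eps).

Definition exp_norm (S : set C) (rho : R) :=
  norm_Exp S rho P.(nu) P.(beta) P.(mu) P.(kp).
Definition exp_ball (S : set C) (rho varpi : R) (w : C -> R -> C) : Prop :=
  space_Exp S rho P.(nu) P.(beta) P.(mu) P.(kp) w /\
  (exp_norm S rho w <= varpi%:E)%E.

Definition half_contraction (S : set C) (rho varpi : R)
    (H : (C -> R -> C) -> (C -> R -> C)) : Prop :=
  (forall w, exp_ball S rho varpi w -> exp_ball S rho varpi (H w)) /\
  (forall w1 w2, exp_ball S rho varpi w1 -> exp_ball S rho varpi w2 ->
    (exp_norm S rho (fun tau m => (H w1 tau m - H w2 tau m)%R)
      <= (2^-1)%:E * exp_norm S rho (fun tau m => (w1 tau m - w2 tau m)%R))%E).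

(* Elements of the function space are functions on (S `|` cdisc rho) * R;
   values elsewhere are irrelevant. *)
Definition fixed_point (S : set C) (rho varpi : R)
    (H : (C -> R -> C) -> (C -> R -> C)) (w : C -> R -> C) : Prop :=
  exp_ball S rho varpi w /\
  forall tau m, (S `|` cdisc rho) tau -> H w tau m = w tau m.

Definition sol_ray_integrand (w : C -> R -> C -> C) (t1 t2 z eps : C) (m : R)
    (u : C) : C :=
  w u m eps
  * cexp (- (u / (eps ^+ P.(lam1) * t1)) ^+ P.(k1)
          - (u / (eps ^+ P.(lam2) * t2)) ^+ P.(k2))
  * cexp ((0 +i* 1) * z * m%:C) / u.

Definition sol (w : C -> R -> C -> C) (xi : R) (t1 t2 z eps : C) : C :=
  ((Num.sqrt (2 * pi))^-1)%:C
  * cint setT (fun m => ray_int xi (sol_ray_integrand w t1 t2 z eps m)).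

Definition sol_converges (w : C -> R -> C -> C) (xi : R) (t1 t2 z eps : C) :
    Prop :=
  (forall m, ray_integrable xi (sol_ray_integrand w t1 t2 z eps m)) /\
  cintegrable setT (fun m => ray_int xi (sol_ray_integrand w t1 t2 z eps m)).

Definition good_covering (iota : nat) (E : 'I_iota -> set C) : Prop :=
  [/\ (2 <= iota)%N,
      (forall h, bounded_sector (E h) /\ E h `<=` disc P.(eps0)),
      (forall h, E h `&` E (ordS h) !=set0),
      (forall h h' h'', h != h' -> h != h'' -> h' != h'' ->
        E h `&` E h' `&` E h'' = set0) &
      exists2 r : R, 0 < r & disc r `\ 0 `<=` \bigcup_h E h].

(* The existential over directions is skolemized: xi h t1 t2 eps is the direction
   along which [sol] is integrated. *)
Definition admissible (iota : nat) (U : set C) (rho : R) (T1 T2 : set C)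
    (E S : 'I_iota -> set C) (delta : R)
    (xi : 'I_iota -> C -> C -> C -> R) : Prop :=
  [/\ bounded_sector T1, unbounded_sector T2,
      (forall h, suitable U rho (S h)),
      0 < delta &
      forall h t1 t2 eps, T1 t1 -> T2 t2 -> E h eps ->
        [/\ S h (expi (xi h t1 t2 eps)),
            good_direction delta P.(k1) (xi h t1 t2 eps)
              (eps ^+ P.(lam1) * t1) &
            good_direction delta P.(k2) (xi h t1 t2 eps)
              (eps ^+ P.(lam2) * t2)]].

Definition annular_sector (r r' a b : R) : set C :=
  [set z | exists s t,
    [/\ r < s < r', a < t < b & z = s%:C * expi t]].
Definition inner_point (mu2 : nat) (theta : R) (eps x2 : C) : C :=
  x2 / eps ^+ mu2 * expi theta.
Definition inner_domain (chi : set C) (mu2 : nat) (theta : R) (eps : C) :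
    set C :=
  inner_point mu2 theta eps @` chi.

End Equation.

(* Main.v *)
Require Import Defs.
From mathcomp Require Import all_boot all_order all_algebra.
From mathcomp Require Import all_classical all_reals all_analysis.
From mathcomp Require Import measurable_realfun.
From mathcomp Require Import complex.
From mathcomp Require Import ring lra zify.

Set Implicit Arguments.
Unset Strict Implicit.
Unset Printing Implicit Defensive.

Import Order.TTheory GRing.Theory Num.Theory.
Import numFieldNormedType.Exports.
Import Normc.

Local Open Scope classical_set_scope.
Local Open Scope ring_scope.
Local Open Scope complex_scope.

Local Notation Re := (@complex.Re _).
Local Notation Im := (@complex.Im _).

(* As k' < k2, the factor exp(-(u/T2)^k2) makes the Laplace integral of omega
   converge along every direction xi with Re (e^{i xi}/T2)^k2 > 0, and by
   Cauchy's theorem the integral does not depend on xi as long as the ray stays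
   in the sector.  Hence xi may be frozen near a given (t1, t2), and the integral
   is a Laplace-Fourier integral, holomorphic in (e^{i xi}/T1)^k1,
   (e^{i xi}/T2)^k2 and z.  The operators t^{k+1} d/dt and d/dz multiply omega by
   k tau^k (up to a power of epsilon) and by i m, and multiplication by c(z) is a
   convolution in m: the fixed point equation of omega becomes the main equation.

   The map H_epsilon acts in each fibre over tau separately, so the contraction
   property forces the fixed points attached to two sectors to agree on the disc
   of radius rho.  The difference of two consecutive solutions is thus an arc of
   radius rho/2 and two tails.  There exp(-(u/T1)^k1) contributes a factor
   exp(-2D/|eps|^{lam1 k1}), whereas the growth exp(nu |u|^k') against
   exp(-(u/T2)^k2), with |T2| of size |eps|^{lam2-mu2}, costs
   exp(C |eps|^{-(mu2-lam2) k' k2/(k2-k')}), of smaller order by the condition on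
   mu2. *)

(** * The complex exponential *)

(** The direction [xi] is an arbitrary function of (t1, t2, epsilon), so nothing can be
    differentiated before it is frozen. Freezing requires any two good directions of a sector to be
    joined by good directions inside it; this is the origin of the bound 2 pi - pi / k2 on the
    aperture. During a rotation only (u/T2)^k2 keeps a controlled sign; the term in k1, of lower
    order, is bounded by its modulus. All derivatives come from one estimate. In the coordinates a =
    (e^{i xi}/T1)^k1 and b = (e^{i xi}/T2)^k2 the exponent is linear in (a, b, z), and the quadratic
    remainder of the exponential, integrated against omega, gives the partial derivatives and joint
    differentiability at once. Two consecutive fixed points belong to spaces over different sectors,
    and no contraction is given on a space over the disc alone. Their difference in one fibre must
    therefore be extended to an element of a ball over a whole sector, large enough in that fibre to
    contradict the factor 1/2. *)

Section ComplexBasics.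
Variable R : realType.
Local Notation C := R[i].
Implicit Types (z w : C) (a b x y : R).

(** The norm of [R[i]] takes its values in [R[i]]; estimates are made with the real number
    [normc z], and this is the passage between the two. *)
Lemma normcE_norm z : `|z| = (normc z)%:C.
Proof. by []. Qed.

Lemma normc_ge0 z : 0 <= normc z.
Proof. by rewrite -ler0c -normcE_norm. Qed.

Lemma normcD z w : normc (z + w) <= normc z + normc w.
Proof. exact: le_normcD. Qed.

Lemma normcB z w : normc (z - w) <= normc z + normc w.
Proof. by rewrite (le_trans (normcD _ _))// normcN. Qed.

Lemma normc_distC z w : normc (z - w) = normc (w - z).
Proof. by rewrite -normcN opprB. Qed.

Lemma normc_real a : normc a%:C = `|a|.
Proof. by rewrite /= expr0n addr0 sqrtr_sqr. Qed.

Lemma normcX z n : normc (z ^+ n) = normc z ^+ n.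
Proof.
by elim: n => [|n IH]; rewrite ?expr0 ?normc1// !exprS normcM IH.
Qed.

Lemma normc_eq0 z : (normc z == 0) = (z == 0).
Proof. by apply/eqP/eqP => [/eq0_normc//|->]; rewrite normc0. Qed.

Lemma normc_gt0 z : (0 < normc z) = (z != 0).
Proof. by rewrite lt_def normc_ge0 normc_eq0 andbT. Qed.

Lemma ReIm_normc z : Re z ^+ 2 + Im z ^+ 2 = normc z ^+ 2.
Proof. by case: z => x y /=; rewrite sqr_sqrtr// addr_ge0// sqr_ge0. Qed.

Lemma normc_ge_absRe z : `|Re z| <= normc z.
Proof.
rewrite -(@ler_pXn2r _ 2)// ?nnegrE ?normc_ge0//.
by rewrite -ReIm_normc real_normK ?num_real// lerDl sqr_ge0.
Qed.

Lemma normc_ge_absIm z : `|Im z| <= normc z.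
Proof.
rewrite -(@ler_pXn2r _ 2)// ?nnegrE ?normc_ge0//.
by rewrite -ReIm_normc real_normK ?num_real// lerDr sqr_ge0.
Qed.

Lemma normc_le_ReIm z : normc z <= `|Re z| + `|Im z|.
Proof.
rewrite -(@ler_pXn2r _ 2)// ?nnegrE ?normc_ge0 ?addr_ge0//.
rewrite -ReIm_normc sqrrD !real_normK ?num_real//.
by rewrite -subr_ge0 [X in _ <= X](_ : _ = `|Re z| * `|Im z| *+ 2)
  ?mulrn_wge0 ?mulr_ge0//; ring.
Qed.

Lemma normc_i : normc (0 +i* 1 : C) = 1.
Proof. by rewrite /= expr0n expr1n add0r sqrtr1. Qed.

Lemma complexRe_real a z : Re (a%:C * z) = a * Re z.
Proof. by case: z => x y /=; rewrite mul0r subr0. Qed.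

Lemma complexIm_real a z : Im (a%:C * z) = a * Im z.
Proof. by case: z => x y /=; rewrite mul0r addr0. Qed.

Lemma cReD z w : Re (z + w) = Re z + Re w. Proof. by case: z w => ? ? [? ?]. Qed.
Lemma cImD z w : Im (z + w) = Im z + Im w. Proof. by case: z w => ? ? [? ?]. Qed.
Lemma cReN z : Re (- z) = - Re z. Proof. by case: z. Qed.
Lemma cImN z : Im (- z) = - Im z. Proof. by case: z. Qed.
Lemma cReM z w : Re (z * w) = Re z * Re w - Im z * Im w.
Proof. by case: z w => ? ? [? ?]. Qed.
Lemma cImM z w : Im (z * w) = Re z * Im w + Im z * Re w.
Proof. by case: z w => ? ? [? ?]. Qed.
Lemma complex_ext z w : Re z = Re w -> Im z = Im w -> z = w.
Proof. by case: z w => ? ? [? ?] /= -> ->. Qed.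

Lemma cexpD z w : cexp (z + w) = cexp z * cexp w.
Proof.
apply: complex_ext; rewrite /cexp ?cReM ?cImM/= cReD cImD expRD ?cosD ?sinD; ring.
Qed.

Lemma cexp0 : cexp (0 : C) = 1.
Proof. by apply: complex_ext; rewrite /= expR0 ?cos0 ?sin0 mul1r. Qed.

Lemma normc_cexp z : normc (cexp z) = expR (Re z).
Proof.
rewrite /= !exprMn -mulrDr cos2Dsin2 mulr1 sqrtr_sqr.
by rewrite ger0_norm ?expR_ge0.
Qed.

Lemma cexp_neq0 z : cexp z != 0.
Proof. by rewrite -normc_gt0 normc_cexp expR_gt0. Qed.

Lemma cexpN z : cexp (- z) = (cexp z)^-1.
Proof.
apply: (mulIf (cexp_neq0 z)).
by rewrite -cexpD addNr cexp0 mulVf// cexp_neq0.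
Qed.

Lemma expi_cexp a : expi a = cexp (0 +i* a).
Proof. by rewrite /expi /cexp/= expR0 !mul1r. Qed.

Lemma expiD a b : expi (a + b) = expi a * expi b.
Proof.
by rewrite !expi_cexp -cexpD; congr cexp; apply: complex_ext; rewrite /= ?addr0.
Qed.

Lemma expi0 : expi (0 : R) = 1.
Proof. by rewrite /expi cos0 sin0. Qed.

Lemma normc_expi a : normc (expi a) = 1.
Proof. by rewrite expi_cexp normc_cexp/= expR0. Qed.

Lemma expi_neq0 a : expi a != 0.
Proof. by rewrite -normc_gt0 normc_expi. Qed.

Lemma expiN a : expi (- a) = (expi a)^-1.
Proof.
by rewrite !expi_cexp -cexpN; congr cexp; apply: complex_ext; rewrite /= ?oppr0.
Qed.

Lemma expiX a n : expi a ^+ n = expi (n%:R * a).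
Proof.
elim: n => [|n IH]; first by rewrite expr0 mul0r expi0.
by rewrite exprS IH -expiD -natr1 mulrDl mul1r addrC.
Qed.

Lemma expi2pi n : expi (n%:R * (2 * pi)) = 1 :> C.
Proof.
rewrite -expiX (_ : 2 * pi = pi *+ 2) ?mulr2n; last by ring.
by rewrite -mulr2n /expi cos2pi sin2pi expr1n.
Qed.

Lemma expi2piz (n : int) : expi (n%:~R * (2 * pi)) = 1 :> C.
Proof.
case: n => n; first exact: expi2pi.
by rewrite NegzE mulrNz mulNr expiN (expi2pi n.+1) invr1.
Qed.

(** Removing whole turns leaves b in [0, 2 pi[ with cos b = 1, hence sin (b / 2) = 0 with b / 2 in
    [0, pi[, and the sine is positive inside that interval. *)
Lemma expi_eq1 a : expi a = 1 -> exists n : int, a = n%:~R * (2 * pi).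
Proof.
move=> ea.
have pi2 : 0 < 2 * pi :> R by rewrite mulr_gt0// pi_gt0.
pose n := Num.floor (a / (2 * pi)); exists n.
pose b := a - n%:~R * (2 * pi).
have eb : expi b = 1 by rewrite /b expiD expiN expi2piz ea invr1 mulr1.
have [b0 b2] : 0 <= b /\ b < 2 * pi.
  split; first by rewrite subr_ge0 -ler_pdivlMr// ge_floor.
  by rewrite ltrBlDl -{2}[2 * pi]mul1r -mulrDl -ltr_pdivrMr// -intrD1 floorD1_gt.
have [cb sb] : cos b = 1 /\ sin b = 0 by move: eb; rewrite /expi => -[].
suff b00 : b = 0 by apply/eqP; rewrite -subr_eq0 -/b b00.
apply/eqP/contraT => bn0.
have bgt : 0 < b by rewrite lt_def bn0 b0.
have : sin (b / 2) = 0.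
  have : cos ((b / 2) *+ 2) = 1 by rewrite -mulr_natr divfK.
  rewrite cos_mulr2n cos2sin2 => h; apply/eqP; rewrite -sqrf_eq0; apply/eqP; lra.
move/eqP; apply: contraLR => _; rewrite gt_eqF// sin_gt0_pi//; apply/andP; split; lra.
Qed.

Lemma polarE z : exists a, z = (normc z)%:C * expi a.
Proof.
have [->|z0] := eqVneq z 0; first by exists 0; rewrite normc0 mul0r.
have nz : 0 < normc z by rewrite normc_gt0.
pose c := Re z / normc z; pose s := Im z / normc z.
have cs : c ^+ 2 + s ^+ 2 = 1.
  by rewrite !expr_div_n -mulrDl ReIm_normc divff// expf_neq0// gt_eqF.
have c1 : -1 <= c <= 1.
  by rewrite -ler_norml normrM normfV (ger0_norm (ltW nz)) ler_pdivrMr// mul1r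
    normc_ge_absRe.
have zE a : cos a = c -> sin a = s -> z = (normc z)%:C * expi a.
  move=> ca sa; apply: complex_ext; rewrite ?complexRe_real ?complexIm_real/=.
    by rewrite ca mulrC divfK// gt_eqF.
  by rewrite sa mulrC divfK// gt_eqF.
have s2 : Num.sqrt (1 - c ^+ 2) = `|s| by rewrite -cs addrC addKr sqrtr_sqr.
(* The arccosine determines the angle up to its sign, which is that of the imaginary part. *)
have [s0|s0] := leP 0 s.
  by exists (acos c); apply: zE; rewrite ?acosK// sin_acos// s2 ger0_norm.
exists (- acos c); apply: zE; rewrite ?cosN ?acosK//.
by rewrite sinN sin_acos// s2 ltr0_norm// opprK.
Qed.

Lemma polar_inj (r r' a b : R) : 0 < r -> 0 < r' -> r%:C * expi a = r'%:C * expi b ->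
  r = r' /\ exists n : int, a = b + n%:~R * (2 * pi).
Proof.
move=> r0 r0' h.
have rr : r = r'.
  by move: (congr1 (@normc R) h); rewrite !normcM !normc_expi !mulr1 !normc_real !gtr0_norm.
split=> //.
have /expi_eq1[n hn] : expi (a - b) = 1 :> C.
  rewrite expiD expiN.
  have /mulfI rI : r%:C != 0 :> C by rewrite -normc_gt0 normc_real normr_gt0 gt_eqF.
  have -> : expi a = (expi b * 1) :> C by rewrite mulr1; apply: rI; rewrite h rr.
  by rewrite mulr1 divff// expi_neq0.
by exists n; rewrite -hn addrC subrK.
Qed.

(** This bound and [expR_sub1x_le] rest on the single inequality 1 + y <= exp y, taken at x and at
    -x. *)
Lemma expR_sub1_le x : `|expR x - 1| <= `|x| * expR `|x|.
Proof.
have e1 := expR_ge1Dx x; have e2 := expR_ge1Dx (- x).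
have ep := expR_gt0 x.
have [x0|x0] := leP 0 x.
  rewrite !ger0_norm//; last by lra.
  have : expR x * (1 - x) <= 1.
    by rewrite -ler_pdivlMl// mulr1 -expRN.
  lra.
rewrite !ltr0_norm//; last by rewrite subr_lt0 expR_lt1.
have : 1 <= expR (- x) by rewrite -expR0 ler_expR; lra.
move=> h; apply: (@le_trans _ _ (- x)); first by lra.
by rewrite ler_peMr//; lra.
Qed.

Lemma expR_sub1x_le x : `|expR x - 1 - x| <= x ^+ 2 * expR `|x|.
Proof.
have e1 := expR_ge1Dx x; have e2 := expR_ge1Dx (- x).
have ep := expR_gt0 x.
rewrite ger0_norm; last by lra.
apply: (@le_trans _ _ (x * (expR x - 1))).
  have : expR x * (1 - x) <= 1.
    by rewrite -ler_pdivlMl// mulr1 -expRN.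
  lra.
rewrite (le_trans (ler_norm _))// normrM -[x ^+ 2]real_normK ?num_real//.
by rewrite expr2 -mulrA ler_wpM2l// expR_sub1_le.
Qed.

Lemma sin_norm_le x : `|sin x| <= `|x|.
Proof.
wlog x0 : x / 0 <= x.
  move=> h; have [/h//|x0] := leP 0 x.
  by rewrite -[X in `|sin X|]opprK sinN normrN -[leRHS]normrN h// oppr_ge0 ltW.
have [->|xn0] := eqVneq x 0; first by rewrite sin0.
have xp : 0 < x by rewrite lt_def xn0.
have [c _] : exists2 c, c \in `]0, x[ & sin x - sin 0 = cos c * (x - 0).
  by apply: MVT => //; apply: continuous_subspaceT; exact: continuous_sin.
rewrite sin0 !subr0 => ->.
by rewrite normrM ler_piMl// cos_max.
Qed.

Lemma cos_sub1_le x : `|cos x - 1| <= `|x| ^+ 2.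
Proof.
have -> : cos x - 1 = - (sin (x / 2) ^+ 2 *+ 2).
  rewrite [in LHS](_ : x = (x / 2) *+ 2); last by rewrite -mulr_natr divfK.
  by rewrite cos_mulr2n cos2sin2; ring.
rewrite normrN normrMn normrX.
apply: (@le_trans _ _ (`|x / 2| ^+ 2 *+ 2)).
  by rewrite lerMn2r lerXn2r ?nnegrE ?sin_norm_le.
rewrite normrM normfV normr_nat exprMn -mulrnAr ler_piMr ?exprn_ge0// exprVn.
by rewrite -mulr_natr; lra.
Qed.

(** The linear bound complements the quadratic one: it gives [sin_subx_le] through the mean value
    theorem, and a global Lipschitz constant for [expi]. *)
Lemma cos_sub1_le1 x : `|cos x - 1| <= `|x|.
Proof.
have -> : cos x - 1 = - (sin (x / 2) ^+ 2 *+ 2).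
  rewrite [in LHS](_ : x = (x / 2) *+ 2); last by rewrite -mulr_natr divfK.
  by rewrite cos_mulr2n cos2sin2; ring.
rewrite normrN normrMn expr2 normrM.
apply: (@le_trans _ _ (`|x / 2| * 1 *+ 2)).
  by rewrite lerMn2r/= ler_pM// ?sin_norm_le ?sin_max.
by rewrite mulr1 normrM normfV normr_nat -mulr_natr divfK.
Qed.

Lemma sin_subx_le x : `|sin x - x| <= `|x| ^+ 2.
Proof.
wlog x0 : x / 0 <= x.
  move=> h; have [/h//|x0] := leP 0 x.
  rewrite (_ : sin x - x = - (sin (- x) - (- x))); last by rewrite sinN; ring.
  rewrite normrN -[`|x|]normrN.
  by apply: h; rewrite oppr_ge0 ltW.
have [->|xn0] := eqVneq x 0; first by rewrite sin0 subrr normr0.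
have xp : 0 < x by rewrite lt_def xn0.
have [c] : exists2 c, c \in `]0, x[ & sin x - sin 0 = cos c * (x - 0).
  by apply: MVT => //; apply: continuous_subspaceT; exact: continuous_sin.
rewrite in_itv/= => /andP[c0 cx]; rewrite sin0 !subr0 => ->.
rewrite -[X in _ - X]mul1r -mulrBl normrM expr2 ler_wpM2r//.
by rewrite (le_trans (cos_sub1_le1 _))// !gtr0_norm// ltW.
Qed.

(** Real and imaginary parts each split into two terms, and each of the four is at most |z|^2 exp
    |z|; hence the 4. Every complex derivative of an integral below goes back to this remainder. *)
Lemma cexp_sub1x_le z : normc (cexp z - 1 - z) <= 4 * normc z ^+ 2 * expR (normc z).
Proof.
have [aRe aIm] := (normc_ge_absRe z, normc_ge_absIm z).
have n0 := normc_ge0 z.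
rewrite (le_trans (normc_le_ReIm _))// !cReD !cImD !cReN !cImN /=.
move: (Re z) (Im z) (normc z) aRe aIm n0 => x y n aRe aIm n0.
have e1 : 1 <= expR n by rewrite -[leLHS]expR0 ler_expR.
have exn : expR `|x| <= expR n by rewrite ler_expR.
have ex : expR x <= expR n by rewrite ler_expR (le_trans (ler_norm _)).
have x2 : `|x| ^+ 2 <= n ^+ 2 by rewrite lerXn2r ?nnegrE.
have y2 : `|y| ^+ 2 <= n ^+ 2 by rewrite lerXn2r ?nnegrE.
have n20 : 0 <= n ^+ 2 by rewrite sqr_ge0.
have -> : expR x * cos y - 1 - x = (expR x - 1 - x) + expR x * (cos y - 1) by ring.
have -> : expR x * sin y - 0 - y = (expR x - 1) * sin y + (sin y - y) by ring.
have h1 : `|expR x - 1 - x| <= n ^+ 2 * expR n.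
  rewrite (le_trans (expR_sub1x_le _))// -[x ^+ 2]real_normK ?num_real//.
  by rewrite ler_pM// ?exprn_ge0// expR_ge0.
have h2 : `|expR x * (cos y - 1)| <= n ^+ 2 * expR n.
  rewrite normrM (ger0_norm (expR_ge0 _)) mulrC ler_pM ?expR_ge0//.
  by rewrite (le_trans (cos_sub1_le _)).
have h3 : `|(expR x - 1) * sin y| <= n ^+ 2 * expR n.
  rewrite normrM; apply: (@le_trans _ _ (`|x| * expR `|x| * `|y|)).
    by rewrite ler_pM// ?expR_sub1_le ?sin_norm_le.
  by rewrite mulrAC expr2 !ler_pM ?mulr_ge0 ?expR_ge0.
have h4 : `|sin y - y| <= n ^+ 2 * expR n.
  by rewrite (le_trans (sin_subx_le _))// (le_trans y2)// ler_peMr.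
rewrite (le_trans (lerD (ler_normD _ _) (ler_normD _ _)))//.
by rewrite [leRHS](_ : _ = n ^+ 2 * expR n + n ^+ 2 * expR n
  + (n ^+ 2 * expR n + n ^+ 2 * expR n)) ?lerD//; ring.
Qed.

End ComplexBasics.

(** * Topology and complex differentiability in [R[i]] *)

Section ComplexTopology.
Variable R : realType.
Local Notation C := R[i].

Lemma ltC_real (e : C) : 0 < e -> exists2 r : R, 0 < r & e = r%:C.
Proof.
by move=> e0; exists (Re e); [move: e0; rewrite ltcE => /andP[_]|rewrite RRe_real// gtr0_real].
Qed.

Lemma nbhs_normcP (z : C) (A : set C) :
  nbhs z A <-> exists2 e : R, 0 < e & forall w, normc (w - z) < e -> A w.
Proof.
split.
  move=> /nbhs_ballP[e /= /ltC_real[r r0 ->] h]; exists r => // w wz; apply: h.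
  by rewrite /ball/= normcE_norm ltcR normc_distC.
case=> e e0 h; apply/nbhs_ballP; exists e%:C; first by rewrite /= ltcR.
by move=> w; rewrite /ball/= normcE_norm ltcR normc_distC => /h.
Qed.

Lemma cvgC_normP T (F : set_system T) (FF : Filter F) (f : T -> C) (l : C) :
  f @ F --> l <-> forall e : R, 0 < e -> \forall t \near F, normc (f t - l) < e.
Proof.
split => [fl e e0|h].
  apply: (fl [set w | normc (w - l) < e]).
  by apply/nbhs_normcP; exists e.
apply/cvgrPdist_lt => _ /ltC_real[e e0 ->]; have := h _ e0; apply: filterS => t.
by rewrite normcE_norm ltcR normc_distC.
Qed.

Lemma lipschitz_continuousC (f : C -> R) :
  (forall z w, `|f z - f w| <= normc (w - z)) -> continuous f.
Proof.
move=> hf z; apply: (iffRL (@cvgrPdist_lt _ _ _ _ (nbhs_filter z) _ _)) => e e0.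
by apply/nbhs_normcP; exists e => // w wz; rewrite (le_lt_trans (hf _ _)).
Qed.

Lemma continuous_Re : continuous (fun z : C => Re z).
Proof.
apply: lipschitz_continuousC => z w.
by rewrite -cReN -cReD (le_trans (normc_ge_absRe _))// normc_distC.
Qed.

Lemma continuous_Im : continuous (fun z : C => Im z).
Proof.
apply: lipschitz_continuousC => z w.
by rewrite -cImN -cImD (le_trans (normc_ge_absIm _))// normc_distC.
Qed.

Lemma continuous_normc : continuous (fun z : C => normc z).
Proof.
apply: lipschitz_continuousC => z w; rewrite ler_norml; apply/andP; split.
  rewrite lerBrDl; have := normcD (w - z) z; rewrite subrK; lra.
have := normcD (z - w) w; rewrite subrK normc_distC; lra.
Qed.

Lemma cvgC_ReIm T (F : set_system T) (FF : Filter F) (f : T -> C) (l : C) :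
  (fun t => Re (f t)) @ F --> Re l -> (fun t => Im (f t)) @ F --> Im l ->
  f @ F --> l.
Proof.
move=> fR fI; apply/cvgC_normP => e e0.
have e2 : 0 < e / 2 by rewrite divr_gt0.
have /cvgrPdist_lt/(_ _ e2) := fR.
have /cvgrPdist_lt/(_ _ e2) := fI.
apply: filterS2 => t h1 h2; rewrite (le_lt_trans (normc_le_ReIm _))//.
by rewrite cReD cImD cReN cImN distrC [X in _ + X]distrC [e]splitr ltrD.
Qed.

Lemma continuous_realC : continuous (fun x : R => x%:C).
Proof.
by move=> x; apply: cvgC_ReIm => /=; [exact: cvg_id|exact: cvg_cst].
Qed.

Lemma continuous_expi : continuous (@expi R).
Proof. by move=> x; apply: cvgC_ReIm => /=; [exact: continuous_cos|exact: continuous_sin]. Qed.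

Lemma cexp_quadratic (z h : C) :
  normc (cexp (z + h) - cexp z - h * cexp z) <=
  4 * expR (Re z) * expR (normc h) * normc h ^+ 2.
Proof.
rewrite cexpD (_ : _ - _ - _ = cexp z * (cexp h - 1 - h)); last by ring.
rewrite normcM normc_cexp.
rewrite [leRHS](_ : _ = expR (Re z) * (4 * normc h ^+ 2 * expR (normc h))); last by ring.
by rewrite ler_wpM2l ?expR_ge0// cexp_sub1x_le.
Qed.

(** A quadratic bound at h = 0 forces f x = 0, and then says that f is little-o of h, so its
    differential is 0. With [quadratic_differentiable2] this reduces joint differentiability to a
    second-order remainder estimate. *)
Lemma quadratic_differentiable (V : normedModType C) (f : V -> C) (x : V)
    (K e : R) : 0 < e ->
  (forall h : V, `|h| < e%:C -> `|f (h + x)| <= K%:C * `|h| ^+ 2) ->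
  differentiable f x.
Proof.
move=> e0 hf.
have f0 : f x = 0.
  have := hf 0; rewrite normr0 ltcR e0 add0r expr0n mulr0 => /(_ isT).
  by rewrite normr_le0 => /eqP.
have hd : f \o shift x = cst (f x) + (0 : V -> C) +o_ 0 id.
  apply/eqaddoP => _ /ltC_real[d d0 ->].
  pose K1 := `|K| + 1.
  have K10 : 0 < K1 by rewrite /K1 ltr_pwDr.
  near=> k.
  have ke : `|k| < (Num.min e (d / K1))%:C.
    near: k; apply/nbhs0_lt; rewrite ltcR lt_min e0/= divr_gt0//.
  (* The norm of [V] is an element of [R[i]]; it is replaced by the real number it comes from, so
     that the order of the reals applies. *)
  have [r kr] : exists r : R, `|k| = r%:C.
    by exists (Re `|k|); rewrite RRe_real// normr_real.
  have r0 : 0 <= r by rewrite -ler0c -kr.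
  have {}ke : r < Num.min e (d / K1) by rewrite -ltcR -kr.
  have [re rd] : r < e /\ r < d / K1 by move: ke; rewrite lt_min => /andP.
  rewrite !fctE f0 addr0 subr0 /= (le_trans (hf _ _))// kr ?ltcR//.
  rewrite -rmorphXn -!rmorphM/= lecR expr2 mulrA ler_wpM2r//.
  rewrite (le_trans (ler_norm _))// normrM (ger0_norm r0).
  rewrite ltr_pdivlMr// in rd; apply: le_trans (ltW rd).
  by rewrite mulrC ler_wpM2l// /K1 lerDl.
have dd : 'd f x = \0 :> (V -> C).
  by apply: (@diff_unique _ V C f \0) => // ?; exact: cvg_cst.
by apply/diff_locallyP; rewrite dd; split => // ?; exact: cvg_cst.
Unshelve. all: by end_near. Qed.

Lemma quadratic_differentiable2 (V : normedModType C) (f g : V -> C) (x : V)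
    (K e : R) : differentiable g x -> 0 < e ->
  (forall h : V, `|h| < e%:C -> `|f (h + x) - g (h + x)| <= K%:C * `|h| ^+ 2) ->
  differentiable f x.
Proof.
move=> gx e0 hf.
have fgx : differentiable (f - g) x.
  exact: (@quadratic_differentiable V (f - g) x K e e0 hf).
rewrite (_ : f = (f - g) + g); last by rewrite subrK.
exact: (@differentiableD _ V C (f - g) g x fgx gx).
Qed.

Lemma quadratic_is_derive (f : C -> C) (x l : C) (K e : R) : 0 < e ->
  (forall h : C, normc h < e -> normc (f (x + h) - f x - h * l) <= K * normc h ^+ 2) ->
  is_derive x 1 f l.
Proof.
move=> e0 hf.
suff h : (fun h => h^-1 *: ((f \o shift x) (h *: 1) - f x)) @ (0 : C)^' --> l.
  by split; [apply/cvg_ex; exists l|exact: cvg_lim].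
apply/cvgC_normP => d d0.
pose K1 := `|K| + 1.
have K10 : 0 < K1 by rewrite /K1 ltr_pwDr.
near=> h.
have h0 : h != 0 by near: h; exact: nbhs_dnbhs_neq.
have {}he : normc h < Num.min e (d / K1).
  rewrite -ltcR -normcE_norm; near: h; apply: dnbhs0_lt.
  by rewrite ltcR lt_min e0/= divr_gt0.
have [re rd] : normc h < e /\ normc h < d / K1 by move: he; rewrite lt_min => /andP.
rewrite [h *: _]mulr1 /= /shift/= [h + x]addrC.
have -> : h^-1 *: (f (x + h) - f x) - l = h^-1 * (f (x + h) - f x - h * l).
  by rewrite mulrBr mulrA mulVf// mul1r.
have hp : 0 < normc h by rewrite normc_gt0.
rewrite normcM normcV mulrC ltr_pdivrMr// (le_lt_trans (hf _ _))//.
rewrite expr2 mulrA ltr_pM2r// (le_lt_trans (ler_norm _))// normrM (gtr0_norm hp).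
rewrite ltr_pdivlMr// in rd; apply: le_lt_trans rd.
by rewrite mulrC ler_wpM2l ?normc_ge0// /K1 lerDl.
Unshelve. all: by end_near. Qed.

Lemma is_derive_cexp (z : C) : is_derive z 1 (@cexp R) (cexp z).
Proof.
apply: (@quadratic_is_derive _ _ _ (4 * expR (Re z) * expR 1) 1) => // h h1.
rewrite (le_trans (cexp_quadratic _ _))// ler_wpM2r ?sqr_ge0//.
by rewrite ler_wpM2l ?mulr_ge0 ?expR_ge0// ler_expR ltW.
Qed.

Lemma differentiable_cexp (z : C) : differentiable (@cexp R) z.
Proof. by apply/derivable1_diffP; have [] := is_derive_cexp z. Qed.

Lemma continuous_cexp : continuous (@cexp R).
Proof. by move=> z; exact/differentiable_continuous/differentiable_cexp. Qed.

(** The epsilon-delta form, with the real modulus, in which Goursat's argument uses the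
    derivative. *)
Lemma differentiable_normcP (f : C -> C) (x : C) : differentiable f x ->
  exists l : C, forall e : R, 0 < e -> exists2 d : R, 0 < d &
  forall y, normc (y - x) < d ->
    normc (f y - f x - (y - x) * l) <= e * normc (y - x).
Proof.
move=> /derivable1_diffP /cvg_ex[/= l fx]; exists l => e e0.
have /cvgC_normP/(_ _ e0) := fx.
rewrite near_withinE => /nbhs_normcP[d d0 h]; exists d => // y yd.
have [->|yx] := eqVneq y x; first by rewrite !subrr mul0r !subrr normc0 mulr0.
have := h (y - x); rewrite subr0 => /(_ yd); rewrite subr_eq0 => /(_ yx).
rewrite [_ *: 1]mulr1 /= /shift/= subrK.
have -> : (y - x)^-1 *: (f y - f x) - l = (y - x)^-1 * (f y - f x - (y - x) * l).
  by rewrite mulrBr mulrA mulVf ?subr_eq0// mul1r.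
rewrite normcM normcV mulrC ltr_pdivrMr ?normc_gt0 ?subr_eq0//.
by move=> /ltW.
Qed.

End ComplexTopology.

(** * Measurability of complex-valued functions *)

Section CMeasurable.
Context d (T : measurableType d) (R : realType).
Local Notation C := R[i].

Definition cmeasurable (D : set T) (f : T -> C) : Prop :=
  measurable_fun D (fun x => Re (f x)) /\ measurable_fun D (fun x => Im (f x)).

Lemma cmeasurable_cst D (c : C) : cmeasurable D (fun _ => c).
Proof. by split; exact: measurable_cst. Qed.

Lemma cmeasurableD D f g : cmeasurable D f -> cmeasurable D g ->
  cmeasurable D (fun x => f x + g x).
Proof.
move=> [f1 f2] [g1 g2]; split.
  by under eq_fun do rewrite cReD; exact: measurable_funD.
by under eq_fun do rewrite cImD; exact: measurable_funD.
Qed.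

Lemma cmeasurableM D f g : cmeasurable D f -> cmeasurable D g ->
  cmeasurable D (fun x => f x * g x).
Proof.
move=> [f1 f2] [g1 g2]; split.
  by under eq_fun do rewrite cReM; apply: measurable_funB; exact: measurable_funM.
by under eq_fun do rewrite cImM; apply: measurable_funD; exact: measurable_funM.
Qed.

Lemma cmeasurableX D f n : cmeasurable D f -> cmeasurable D (fun x => f x ^+ n).
Proof.
move=> mf; elim: n => [|n IH]; first by under eq_fun do rewrite expr0; exact: cmeasurable_cst.
by under eq_fun do rewrite exprS; exact: cmeasurableM.
Qed.

Lemma cmeasurable_real D (f : T -> R) : measurable_fun D f ->
  cmeasurable D (fun x => (f x)%:C).
Proof. by move=> mf; split => //=; exact: measurable_cst. Qed.

Lemma cmeasurable_cexp (D : set T) f : measurable D -> cmeasurable D f ->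
  cmeasurable D (fun x => cexp (f x)).
Proof.
move=> mD [f1 f2]; split => /=; apply: measurable_funM.
- exact: measurableT_comp.
- by apply: measurableT_comp => //; apply: continuous_measurable_fun; exact: continuous_cos.
- exact: measurableT_comp.
- by apply: measurableT_comp => //; apply: continuous_measurable_fun; exact: continuous_sin.
Qed.

End CMeasurable.

Lemma cmeasurable_comp d1 d2 (T1 : measurableType d1) (T2 : measurableType d2)
    (R : realType) (f : T2 -> R[i]) (g : T1 -> T2) :
  cmeasurable setT f -> measurable_fun setT g ->
  cmeasurable setT (fun x => f (g x)).
Proof. by move=> [f1 f2] mg; split; [exact: (measurableT_comp f1 mg)|exact: (measurableT_comp f2 mg)]. Qed.

(** * Integrals of complex-valued functions *)

Section CIntegral.
Variable R : realType.
Local Notation C := R[i].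
Local Notation mu := (@lebesgue_measure R).
Implicit Types (D : set R) (f g : R -> C).

Lemma cintegrable_cmeasurable D f : cintegrable D f -> cmeasurable D f.
Proof.
by move=> [/(measurable_int mu)/measurable_EFinP ? /(measurable_int mu)/measurable_EFinP ?].
Qed.

Lemma cintegrable_dom D f (g : R -> R) : measurable D -> cmeasurable D f ->
  mu.-integrable D (EFin \o g) -> (forall x, D x -> normc (f x) <= g x) ->
  cintegrable D f.
Proof.
move=> mD [m1 m2] ig fg; split; apply: le_integrable ig => //.
- exact/measurable_EFinP.
- move=> x Dx /=; rewrite lee_fin (le_trans (normc_ge_absRe _))//.
  by rewrite (le_trans (fg _ Dx))// ler_norm.
- exact/measurable_EFinP.
- move=> x Dx /=; rewrite lee_fin (le_trans (normc_ge_absIm _))//.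
  by rewrite (le_trans (fg _ Dx))// ler_norm.
Qed.

(** The factor 2 is the price of treating real and imaginary parts separately; later constants only
    have to be uniform, not sharp. *)
Lemma normc_cint_le D f (g : R -> R) : measurable D -> cintegrable D f ->
  mu.-integrable D (EFin \o g) -> (forall x, D x -> normc (f x) <= g x) ->
  normc (cint D f) <= 2 * \int[mu]_(x in D) g x.
Proof.
move=> mD [i1 i2] ig fg; rewrite (le_trans (normc_le_ReIm _))//= mulr_natl mulr2n.
rewrite lerD//.
  rewrite (le_trans (le_normr_Rintegral _ i1))//.
  apply: le_Rintegral => //; first exact: integrable_norm.
  by move=> x Dx; rewrite (le_trans _ (fg _ Dx))// normc_ge_absRe.
rewrite (le_trans (le_normr_Rintegral _ i2))//.
apply: le_Rintegral => //; first exact: integrable_norm.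
by move=> x Dx; rewrite (le_trans _ (fg _ Dx))// normc_ge_absIm.
Qed.

Lemma eq_cint D f g : (forall x, D x -> f x = g x) -> cint D f = cint D g.
Proof.
move=> fg; rewrite /cint; congr (_ +i* _); apply: eq_Rintegral => x;
by rewrite inE => /fg ->.
Qed.

Lemma eq_cintegrable D f g : measurable D -> (forall x, D x -> f x = g x) ->
  cintegrable D f -> cintegrable D g.
Proof.
move=> mD fg [i1 i2]; split; [apply: eq_integrable i1|apply: eq_integrable i2] => // x;
by rewrite inE => /fg ->.
Qed.

Lemma cintegrable0 D : measurable D -> cintegrable D (fun _ => 0 : C).
Proof. by move=> mD; split; exact: integrable0. Qed.

Lemma cint0 D : cint D (fun _ => 0 : C) = 0.
Proof. by apply: complex_ext => /=; rewrite /Rintegral integral0. Qed.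

Lemma cintegrableD D f g : measurable D -> cintegrable D f -> cintegrable D g ->
  cintegrable D (fun x => f x + g x).
Proof.
move=> mD [f1 f2] [g1 g2]; split.
  by under eq_fun do rewrite cReD EFinD; exact: integrableD.
by under eq_fun do rewrite cImD EFinD; exact: integrableD.
Qed.

Lemma cintD D f g : measurable D -> cintegrable D f -> cintegrable D g ->
  cint D (fun x => f x + g x) = cint D f + cint D g.
Proof.
move=> mD [f1 f2] [g1 g2]; apply: complex_ext; rewrite ?cReD ?cImD /=.
  by under eq_Rintegral do rewrite cReD; exact: RintegralD.
by under eq_Rintegral do rewrite cImD; exact: RintegralD.
Qed.

Lemma cintegrableZ D f (c : C) : measurable D -> cintegrable D f ->
  cintegrable D (fun x => c * f x).
Proof.
move=> mD [f1 f2]; split.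
  under eq_fun do rewrite cReM EFinB !EFinM; apply: integrableB => //; exact: integrableZl.
by under eq_fun do rewrite cImM EFinD !EFinM; apply: integrableD => //; exact: integrableZl.
Qed.

Lemma cintZ D f (c : C) : measurable D -> cintegrable D f ->
  cint D (fun x => c * f x) = c * cint D f.
Proof.
move=> mD [f1 f2].
have Z1 (k : R) : mu.-integrable D (fun x => (k * Re (f x))%:E).
  by under eq_fun do rewrite EFinM; exact: integrableZl.
have Z2 (k : R) : mu.-integrable D (fun x => (k * Im (f x))%:E).
  by under eq_fun do rewrite EFinM; exact: integrableZl.
apply: complex_ext; rewrite ?cReM ?cImM /=.
  under eq_Rintegral do rewrite cReM.
  rewrite RintegralB//; [|exact: Z1|exact: Z2].
  by congr (_ - _); exact: RintegralZl.
under eq_Rintegral do rewrite cImM.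
rewrite RintegralD//; [|exact: Z2|exact: Z1].
by congr (_ + _); exact: RintegralZl.
Qed.

Lemma cintegrableN D f : measurable D -> cintegrable D f ->
  cintegrable D (fun x => - f x).
Proof.
by move=> mD /(cintegrableZ (-1) mD); under eq_fun do rewrite mulN1r.
Qed.

Lemma cintN D f : measurable D -> cintegrable D f ->
  cint D (fun x => - f x) = - cint D f.
Proof.
by move=> mD /(cintZ (-1) mD); under [in LHS]eq_cint do rewrite mulN1r; rewrite mulN1r.
Qed.

Lemma cintegrableB D f g : measurable D -> cintegrable D f -> cintegrable D g ->
  cintegrable D (fun x => f x - g x).
Proof. by move=> mD If Ig; apply: cintegrableD => //; exact: cintegrableN. Qed.

Lemma cintB D f g : measurable D -> cintegrable D f -> cintegrable D g ->
  cint D (fun x => f x - g x) = cint D f - cint D g.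
Proof.
by move=> mD If Ig; rewrite cintD//; [rewrite cintN|exact: cintegrableN].
Qed.

Lemma cintegrable_sum D (I : eqType) (r : seq I) (F : I -> R -> C) : measurable D ->
  (forall i, i \in r -> cintegrable D (F i)) ->
  cintegrable D (fun x => \sum_(i <- r) F i x).
Proof.
move=> mD; elim: r => [|i r IH] iF.
  by under eq_fun do rewrite big_nil; exact: cintegrable0.
under eq_fun do rewrite big_cons.
apply: cintegrableD => //; first by apply: iF; rewrite mem_head.
by apply: IH => j jr; apply: iF; rewrite in_cons jr orbT.
Qed.

Lemma cint_sum D (I : eqType) (r : seq I) (F : I -> R -> C) : measurable D ->
  (forall i, i \in r -> cintegrable D (F i)) ->
  cint D (fun x => \sum_(i <- r) F i x) = \sum_(i <- r) cint D (F i).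
Proof.
move=> mD; elim: r => [|i r IH] iF.
  by under eq_cint do rewrite big_nil; rewrite cint0 big_nil.
under eq_cint do rewrite big_cons; rewrite big_cons.
have iFr j : j \in r -> cintegrable D (F j).
  by move=> jr; apply: iF; rewrite in_cons jr orbT.
rewrite cintD ?IH//; first by apply: iF; rewrite mem_head.
exact: cintegrable_sum.
Qed.

(** Extension by 0 turns integrals over a half-line into integrals over the whole line, the only
    domain on which Fubini's theorem is stated below. *)
Lemma cint_mkcond D f : cint D f = cint setT (f \_ D).
Proof.
rewrite /cint; congr (_ +i* _); rewrite Rintegral_mkcond; apply: eq_Rintegral => x _;
by rewrite /patch; case: ifP.
Qed.

Lemma cintegrable_mkcond D f : measurable D ->
  cintegrable D f <-> cintegrable setT (f \_ D).
Proof.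
move=> mD.
have E1 : (fun x => (Re (f x))%:E) \_ D = (fun x => (Re ((f \_ D) x))%:E).
  by apply/funext => x; rewrite /patch; case: ifP.
have E2 : (fun x => (Im (f x))%:E) \_ D = (fun x => (Im ((f \_ D) x))%:E).
  by apply/funext => x; rewrite /patch; case: ifP.
have I (h : R -> \bar R) := @integrable_mkcond _ _ R mu D h mD.
rewrite /cintegrable -E1 -E2; split=> -[h1 h2]; split.
- exact: (I _).1.
- exact: (I _).1.
- exact: (I _).2.
- exact: (I _).2.
Qed.

Lemma cintegrableS D E f : measurable D -> measurable E -> E `<=` D ->
  cintegrable D f -> cintegrable E f.
Proof. by move=> mD mE ED [i1 i2]; split; [apply: integrableS i1|apply: integrableS i2]. Qed.

Lemma cint_setU D E f : measurable D -> measurable E ->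
  cintegrable (D `|` E) f -> [disjoint D & E] ->
  cint (D `|` E) f = cint D f + cint E f.
Proof.
move=> mD mE [i1 i2] DE; apply: complex_ext; rewrite ?cReD ?cImD/=.
  exact: Rintegral_setU.
exact: Rintegral_setU.
Qed.

(** The function is even, and on the half-line it is c^-1 times the density of the exponential
    law. *)
Lemma integrable_expN (c : R) : 0 < c ->
  mu.-integrable setT (EFin \o (fun x => expR (- (c * `|x|)))).
Proof.
move=> c0.
have cont : continuous (fun x : R => expR (- (c * `|x|))).
  move=> x; apply: continuous_comp; last exact: continuous_expR.
  apply: continuousN; apply: continuousM; first exact: cvg_cst.
  exact: norm_continuous.
apply/integrableP; split.
  by apply/measurable_EFinP; exact: continuous_measurable_fun.
under eq_integral do rewrite /= ger0_norm ?expR_ge0//.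
rewrite ge0_symfun_integralT//; last by move=> x /=; rewrite normrN.
rewrite lte_mul_pinfty// -set_itvcy.
have : mu.-integrable `[0, +oo[ (EFin \o (fun x => expR (- (c * `|x|)))).
  have i1 : mu.-integrable `[0, +oo[ (EFin \o exponential_pdf c).
    have ip := integrable_exponential_pdf c0.
    apply: (@integrableS _ _ R mu setT _ _ _ _ _ ip) => //.
  apply: eq_integrable (integrableZl _ c^-1 i1) => //= x.
  rewrite inE/= in_itv/= andbT => x0.
  rewrite exponential_pdfE//= -EFinM mulrA mulVf ?gt_eqF// mul1r.
  by rewrite ger0_norm// mulNr.
move=> /integrableP[_].
by under eq_integral do rewrite /= ger0_norm ?expR_ge0//.
Qed.

End CIntegral.

(** * Measurability on the plane, Fubini's theorem under product domination, and translations *)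

Section ProductMeasurable.
Variable R : realType.
Local Notation C := R[i].
Local Notation mu := (@lebesgue_measure R).
Local Notation mR := (measurableTypeR R).

Lemma rat_ball (x e : R) : 0 < e -> exists q : rat * rat,
  (ratr q.1 < x < ratr q.2) /\ (forall y, ratr q.1 < y < ratr q.2 -> `|x - y| < e).
Proof.
move=> e0.
have [q1] := @rat_in_itvoo R (x - e) x ltac:(lra).
have [q2] := @rat_in_itvoo R x (x + e) ltac:(lra).
rewrite !in_itv/= => /andP[h1 h2] /andP[h3 h4]; exists (q1, q2) => /=.
split; first by rewrite h4 h1.
move=> y /andP[h5 h6]; rewrite ltr_norml; apply/andP; split; lra.
Qed.

(** Boxes with rational endpoints form a countable base of the plane. In the union over all of them,
    a box not contained in [A] is replaced by the empty set. *)
Lemma open_measurable_prod (A : set (R * R)) : open A ->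
  measurable (A : set (mR * mR)).
Proof.
move=> oA.
pose B (q : (rat * rat) * (rat * rat)) : set (R * R) :=
  [set` `](ratr q.1.1), (ratr q.1.2)[] `*` [set` `](ratr q.2.1), (ratr q.2.2)[].
pose B' q : set (R * R) := if pselect (B q `<=` A) then B q else set0.
have -> : A = \bigcup_q B' q.
  apply/seteqP; split => [[x y] Axy|p [q _]]; last first.
    by rewrite /B'; case: pselect => //= qA; exact: qA.
  have : nbhs (x, y) A by apply: open_nbhs_nbhs; split.
  move=> [[X Y] /= [/nbhs_ballP[e1 /= e10 X1] /nbhs_ballP[e2 /= e20 Y2]] XYA].
  have [q1 [hq1 hq1']] := rat_ball x e10.
  have [q2 [hq2 hq2']] := rat_ball y e20.
  exists (q1, q2) => //; rewrite /B'; case: pselect => /=.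
    by move=> _; split; rewrite /= in_itv.
  move=> []; move=> [x' y'] [/=]; rewrite !in_itv/= => h1 h2; apply: XYA.
  by split; [apply: X1; exact: hq1'|apply: Y2; exact: hq2'].
apply: countable_bigcupT_measurable => // q.
rewrite /B'; case: pselect => //= _.
by apply: measurableX; exact: measurable_itv.
Qed.

Definition cmeasurable2 (f : R -> R -> C) :=
  @cmeasurable _ (mR * mR)%type R setT (fun p => f p.1 p.2).

(** The integrands are continuous only on the open half-plane where the radius is positive, and 0
    elsewhere; hence the gluing with 0. *)
Lemma measurable_fun_open_prod (A : set (R * R)) (f : R * R -> R) : open A ->
  {in A, continuous f} ->
  @measurable_fun _ _ (mR * mR)%type R setT (fun p => if p \in A then f p else 0).
Proof.
move=> oA cf.
have mA : measurable (A : set (mR * mR)) by exact: open_measurable_prod.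
have mf : @measurable_fun _ _ (mR * mR)%type R A f.
  apply: (measurability _ (RGenOpens.measurableE R)) => //.
  move=> _ [_ [a [b ->]] <-].
  apply: open_measurable_prod; rewrite openE => p [Ap pab].
  apply: filterI; first by apply: open_nbhs_nbhs; split.
  have := cf p; rewrite inE => /(_ Ap); apply.
  by apply: open_nbhs_nbhs; split => //; exact: interval_open.
by have := (measurable_restrict f mA measurableT).1; rewrite setTI => /(_ mf).
Qed.

Lemma cmeasurable2_open (A : set (R * R)) (f : R * R -> C) : open A ->
  (forall p, A p -> {for p, continuous f}) ->
  cmeasurable2 (fun x y => if (x, y) \in A then f (x, y) else 0).
Proof.
move=> oA cf.
have ER : (fun p : R * R => if p \in A then Re (f p) else 0) =
    (fun p => Re (if (p.1, p.2) \in A then f (p.1, p.2) else 0)).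
  by apply/funext => -[x y] /=; case: ifP.
have EI : (fun p : R * R => if p \in A then Im (f p) else 0) =
    (fun p => Im (if (p.1, p.2) \in A then f (p.1, p.2) else 0)).
  by apply/funext => -[x y] /=; case: ifP.
split.
  have := @measurable_fun_open_prod A (fun p => Re (f p)) oA; rewrite ER; apply.
  move=> p; rewrite inE => Ap.
  by apply: (continuous_comp (cf _ Ap)); exact: continuous_Re.
have := @measurable_fun_open_prod A (fun p => Im (f p)) oA; rewrite EI; apply.
move=> p; rewrite inE => Ap.
by apply: (continuous_comp (cf _ Ap)); exact: continuous_Im.
Qed.

Lemma cmeasurable2_l (f : R -> C) : cmeasurable setT f -> cmeasurable2 (fun x _ => f x).
Proof. by move=> mf; apply: (@cmeasurable_comp _ _ (mR * mR)%type mR R f fst). Qed.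

Lemma cmeasurable2_r (f : R -> C) : cmeasurable setT f -> cmeasurable2 (fun _ x => f x).
Proof. by move=> mf; apply: (@cmeasurable_comp _ _ (mR * mR)%type mR R f snd). Qed.

Lemma cmeasurable2_sub (f : R -> C) : cmeasurable setT f -> cmeasurable2 (fun x y => f (x - y)).
Proof.
move=> mf; apply: (@cmeasurable_comp _ _ (mR * mR)%type mR R f (fun p => p.1 - p.2)) => //.
by apply: measurable_funB.
Qed.

Lemma cmeasurable2_1 (f : R -> R -> C) x : cmeasurable2 f -> cmeasurable setT (f x).
Proof.
by move=> mf; apply: (@cmeasurable_comp _ _ mR (mR * mR)%type R (fun p => f p.1 p.2) (pair x) mf).
Qed.

Lemma cmeasurable2_2 (f : R -> R -> C) y : cmeasurable2 f -> cmeasurable setT (f^~ y).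
Proof.
by move=> mf; apply: (@cmeasurable_comp _ _ mR (mR * mR)%type R (fun p => f p.1 p.2) (pair^~ y) mf).
Qed.

(** Domination by a product a(x) b(y) makes every section integrable, not merely almost every one,
    so both iterated integrals are defined pointwise. *)
Lemma fubini_real (f : R -> R -> R) (a b : R -> R) :
  @measurable_fun _ _ (mR * mR)%type R setT (fun p => f p.1 p.2) ->
  mu.-integrable setT (EFin \o a) -> mu.-integrable setT (EFin \o b) ->
  (forall x y, `|f x y| <= a x * b y) ->
  [/\ mu.-integrable setT (fun x => (\int[mu]_y f x y)%:E),
      mu.-integrable setT (fun y => (\int[mu]_x f x y)%:E) &
      \int[mu]_x \int[mu]_y f x y = \int[mu]_y \int[mu]_x f x y].
Proof.
move=> mf ia ib fab.
have i1 x : mu.-integrable setT (EFin \o f x).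
  apply: le_integrable (integrableZl measurableT (a x) ib) => //.
    by apply/measurable_EFinP; exact: (measurableT_comp mf (pair1_measurable x)).
  by move=> y _ /=; rewrite lee_fin (le_trans (fab _ _))// ler_norm.
have i2 y : mu.-integrable setT (EFin \o f^~ y).
  apply: le_integrable (integrableZl measurableT (b y) ia) => //.
    by apply/measurable_EFinP; exact: (measurableT_comp mf (pair2_measurable y)).
  by move=> x _ /=; rewrite lee_fin (le_trans (fab _ _))// mulrC ler_norm.
have iF : (mu \x mu)%E.-integrable setT (fun p => (f p.1 p.2)%:E).
  apply/integrable12ltyP; first exact/measurable_EFinP.
  apply: (@le_lt_trans _ _ (\int[mu]_x (`|a x| * \int[mu]_y `|b y|)%:E)%E).
    apply: ge0_le_integral => //.
    - by move=> x _; exact: integral_ge0.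
    - have mfn : @measurable_fun _ _ (mR * mR)%type _ setT (fun p => `|(f p.1 p.2)%:E|%E).
        by apply: measurableT_comp => //; exact/measurable_EFinP.
      exact: (@measurable_fun_fubini_tonelli_F _ _ mR mR R mu _ mfn).
    - apply/measurable_EFinP; apply: measurable_funM; last exact: measurable_cst.
      by apply: measurableT_comp => //; apply/measurable_EFinP; exact: (measurable_int mu).
    move=> x _; rewrite EFinM.
    have ibn : mu.-integrable setT (EFin \o (fun y => `|b y|)) by exact: integrable_norm.
    rewrite /Rintegral fineK; last exact: integrable_fin_num.
    rewrite -integralZl//; apply: ge0_le_integral => //.
    - by apply: measurableT_comp => //; apply/measurable_EFinP;
        exact: (measurableT_comp mf (pair1_measurable x)).
    - by apply/measurable_EFinP; apply: measurable_funM => //;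
        apply/measurable_EFinP; exact: (measurable_int mu).
    by move=> y _; rewrite lee_fin (le_trans (fab _ _))// -normrM ler_norm.
  have ian : mu.-integrable setT (EFin \o (fun y => `|a y|)) by exact: integrable_norm.
  have := integrableZr measurableT (\int[mu]_y `|b y|) ian.
  move=> /integrable_lty; apply => //.
(* All sections being integrable, their extended-real integrals are finite and agree everywhere with
   the real ones; this carries Fubini's theorem over to real numbers. *)
have E1 x : (\int[mu]_y (f x y)%:E)%E = (\int[mu]_y f x y)%:E.
  by rewrite /Rintegral fineK//; exact: (integrable_fin_num measurableT (i1 x)).
have E2 y : (\int[mu]_x (f x y)%:E)%E = (\int[mu]_x f x y)%:E.
  by rewrite /Rintegral fineK//; exact: (integrable_fin_num measurableT (i2 y)).
split.
- have := integrable_fubini_F iF; rewrite /fubini_F.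
  by rewrite (funext E1).
- have ian : mu.-integrable setT (EFin \o (fun y => `|a y|)) by exact: integrable_norm.
  apply: le_integrable (integrableZr measurableT (\int[mu]_x `|a x|)
    (integrable_norm ib)) => //.
    have := measurable_fubini_G iF; rewrite /fubini_G.
    by rewrite (funext E2).
  move=> y _; rewrite /= lee_fin [leRHS]ger0_norm; last first.
    by rewrite mulr_ge0// Rintegral_ge0.
  rewrite (le_trans (le_normr_Rintegral measurableT (i2 y)))// -RintegralZl//.
  apply: le_Rintegral => //; first exact: integrable_norm.
    by have := integrableZl measurableT `|b y| ian.
  by move=> x _; rewrite (le_trans (fab _ _))// mulrC -normrM ler_norm.
rewrite {1}/Rintegral; under eq_integral do rewrite -E1.
rewrite [RHS]/Rintegral; under [in RHS]eq_integral do rewrite -E2.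
by congr fine; exact: (Fubini iF).
Qed.

Lemma cfubini (f : R -> R -> C) (a b : R -> R) :
  cmeasurable2 f ->
  mu.-integrable setT (EFin \o a) -> mu.-integrable setT (EFin \o b) ->
  (forall x y, normc (f x y) <= a x * b y) ->
  [/\ (forall x, cintegrable setT (f x)),
      (forall y, cintegrable setT (f^~ y)),
      cintegrable setT (fun x => cint setT (f x)),
      cintegrable setT (fun y => cint setT (f^~ y)) &
      cint setT (fun x => cint setT (f x)) = cint setT (fun y => cint setT (f^~ y))].
Proof.
move=> mf ia ib fab.
have [r1 r2 r3] := fubini_real mf.1 ia ib
  (fun x y => le_trans (normc_ge_absRe _) (fab x y)).
have [s1 s2 s3] := fubini_real mf.2 ia ib
  (fun x y => le_trans (normc_ge_absIm _) (fab x y)).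
split.
- move=> x; apply: (@cintegrable_dom _ _ _ (fun y => a x * b y)).
  + exact: measurableT.
  + exact: cmeasurable2_1.
  + exact: (integrableZl measurableT (a x) ib).
  + by move=> y _; exact: fab.
- move=> y; apply: (@cintegrable_dom _ _ _ (fun x => b y * a x)).
  + exact: measurableT.
  + exact: cmeasurable2_2.
  + exact: (integrableZl measurableT (b y) ia).
  + by move=> x _; rewrite mulrC; exact: fab.
- by split; [exact: r1|exact: s1].
- by split; [exact: r2|exact: s2].
- by rewrite /cint /= r3 s3.
Qed.

(** The change of variables is applied to nonnegative functions, hence to the positive and negative
    parts separately; these are continuous with g. *)
Lemma Rintegral_shift (g : R -> R) (c : R) : continuous g ->
  \int[mu]_x g (x - c) = \int[mu]_x g x.
Proof.
have ge0 (h : R -> R) : continuous h -> (forall x, 0 <= h x) ->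
    (\int[mu]_x (h (x - c))%:E = \int[mu]_x (h x)%:E)%E.
  move=> ch h0; pose F (x : R) := x - c.
  have dF (x : R) : is_derive x 1 F 1.
    by rewrite -[X in is_derive _ _ _ X]subr0; exact: is_deriveB.
  have F1 : (F^`())%classic = cst 1.
    by apply/funext => x; rewrite derive1E; exact: derive_val.
  rewrite [RHS](@increasing_ge0_integration_by_substitutionT _ F h) ?F1//.
  - by apply: eq_integral => x _ /=; rewrite /= mulr1.
  - by move=> x y xy; rewrite /F ltrD2r.
  - by move=> ?; exact: cvg_cst.
  - exact: is_cvg_cst.
  - exact: is_cvg_cst.
  - apply/cvgrNyPle => A; near=> x; rewrite lerBlDr; near: x.
    by apply: nbhs_ninfty_le; rewrite num_real.
  - apply/cvgryPge => A; near=> x; rewrite lerBrDr; near: x.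
    by apply: nbhs_pinfty_ge; rewrite num_real.
move=> cg.
rewrite /Rintegral; congr fine; rewrite integralE [RHS]integralE.
have E1 : (fun x => (g x)%:E)^\+%E = (fun x => (Num.max (g x) 0)%:E).
  by apply/funext => x; rewrite funeposE EFin_max.
have E2 : (fun x => (g x)%:E)^\-%E = (fun x => (Num.max (- g x) 0)%:E).
  by apply/funext => x; rewrite funenegE EFin_max EFinN.
have E3 : (fun x => (g (x - c))%:E)^\+%E = (fun x => (Num.max (g (x - c)) 0)%:E).
  by apply/funext => x; rewrite funeposE EFin_max.
have E4 : (fun x => (g (x - c))%:E)^\-%E = (fun x => (Num.max (- g (x - c)) 0)%:E).
  by apply/funext => x; rewrite funenegE EFin_max EFinN.
rewrite E1 E2 E3 E4; congr (_ - _)%E.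
  apply: (ge0 (fun x => Num.max (g x) 0)); last by move=> x; rewrite le_max lexx orbT.
  by move=> x; apply: (@continuous_max R R g (fun=> 0) x (cg x)); exact: cst_continuous.
apply: (ge0 (fun x => Num.max (- g x) 0)); last by move=> x; rewrite le_max lexx orbT.
move=> x; apply: (@continuous_max R R (fun x => - g x) (fun=> 0) x); last exact: cst_continuous.
by apply: (@continuousN _ R^o); exact: cg.
Unshelve. all: by end_near. Qed.

Lemma cint_shift (g : R -> C) (c : R) : continuous g ->
  cint setT (fun x => g (x - c)) = cint setT g.
Proof.
move=> cg; apply: complex_ext => /=.
  apply: (Rintegral_shift (g := fun x => Re (g x))) => x.
  by apply: continuous_comp; [exact: cg|exact: continuous_Re].
apply: (Rintegral_shift (g := fun x => Im (g x))) => x.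
by apply: continuous_comp; [exact: cg|exact: continuous_Im].
Qed.

End ProductMeasurable.

(** * Integrals of complex functions of a real variable and their primitives *)

Section CurveIntegral.
Variable R : realType.
Local Notation C := R[i].
Local Notation mu := (@lebesgue_measure R).

(** [R[i]] is normed over itself, so [is_derive] on it is complex; a derivative in a real variable
    is taken componentwise. *)
Definition cderiv (g : R -> C) (t : R) (d : C) : Prop :=
  is_derive t (1 : R) (fun x => Re (g x)) (Re d) /\
  is_derive t (1 : R) (fun x => Im (g x)) (Im d).

Lemma cderiv_cst (c : C) t : cderiv (fun _ => c) t 0.
Proof. by split; exact: is_derive_cst. Qed.

Lemma cderivD g h t d e : cderiv g t d -> cderiv h t e ->
  cderiv (fun x => g x + h x) t (d + e).
Proof.
move=> [g1 g2] [h1 h2]; split.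
  rewrite cReD (_ : (fun x => _) = (fun x => Re (g x)) + (fun x => Re (h x))).
    exact: is_deriveD.
  by apply/funext => x; rewrite cReD.
rewrite cImD (_ : (fun x => _) = (fun x => Im (g x)) + (fun x => Im (h x))).
  exact: is_deriveD.
by apply/funext => x; rewrite cImD.
Qed.

Lemma cderivM g h t d e : cderiv g t d -> cderiv h t e ->
  cderiv (fun x => g x * h x) t (d * h t + g t * e).
Proof.
move=> [g1 g2] [h1 h2]; split.
  rewrite (_ : (fun x => _) = (fun x => Re (g x)) * (fun x => Re (h x)) -
     (fun x => Im (g x)) * (fun x => Im (h x))); last first.
    by apply/funext => x; rewrite cReM.
  have k := is_deriveB (is_deriveM g1 h1) (is_deriveM g2 h2).
  apply: (is_derive_eq k); rewrite cReD !cReM /GRing.scale/=; ring.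
rewrite (_ : (fun x => _) = (fun x => Re (g x)) * (fun x => Im (h x)) +
     (fun x => Im (g x)) * (fun x => Re (h x))); last first.
  by apply/funext => x; rewrite cImM.
have k := is_deriveD (is_deriveM g1 h2) (is_deriveM g2 h1).
apply: (is_derive_eq k); rewrite cImD !cImM /GRing.scale/=; ring.
Qed.

Lemma cderiv_ray th t : cderiv (fun x => x%:C * expi th) t (expi th).
Proof.
split.
  rewrite (_ : (fun x => _) = (fun x => x * cos th)); last first.
    by apply/funext => x; rewrite complexRe_real.
  by apply: is_derive_eq; rewrite /GRing.scale/= mulr0 add0r mulr1.
rewrite (_ : (fun x => _) = (fun x => x * sin th)); last first.
  by apply/funext => x; rewrite complexIm_real.
by apply: is_derive_eq; rewrite /GRing.scale/= mulr0 add0r mulr1.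
Qed.

Lemma cderiv_arc r t : cderiv (fun x => r%:C * expi x) t ((0 +i* r) * expi t).
Proof.
split.
  rewrite (_ : (fun x => _) = (fun x => r * cos x)); last first.
    by apply/funext => x; rewrite complexRe_real.
  by apply: is_derive_eq; rewrite /GRing.scale/=; ring.
rewrite (_ : (fun x => _) = (fun x => r * sin x)); last first.
  by apply/funext => x; rewrite complexIm_real.
by apply: is_derive_eq; rewrite /GRing.scale/=; ring.
Qed.

Lemma cintegrable_itv (a b : R) (h : R -> C) :
  (forall x, a <= x <= b -> {for x, continuous h}) -> cintegrable `[a, b] h.
Proof.
move=> ch.
have H (k : C -> R) : continuous k -> mu.-integrable `[a, b] (fun x => (k (h x))%:E).
  move=> ck; apply: (@continuous_compact_integrable R (k \o h)); first exact: segment_compact.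
  apply: continuous_in_subspaceT => x; rewrite inE/= in_itv/= => xab.
  by apply: continuous_comp; [exact: ch|exact: ck].
by split; apply: H; [exact: continuous_Re|exact: continuous_Im].
Qed.

Lemma cintegrable_subitv (a b c d : R) (h : R -> C) : a <= c -> d <= b ->
  cintegrable `[a, b] h -> cintegrable `[c, d] h.
Proof.
move=> ac db; apply: cintegrableS => //.
by apply: subset_itv; rewrite bnd_simp.
Qed.

Lemma cint_itv_split (a b c : R) (h : R -> C) : a <= c -> c <= b ->
  cintegrable `[a, b] h ->
  cint `[a, b] h = cint `[a, c] h + cint `[c, b] h.
Proof.
move=> ac cb ih.
have E (k : C -> R) : mu.-integrable `[a, b] (fun x => (k (h x))%:E) ->
   \int[mu]_(x in `[a, b]) k (h x) = \int[mu]_(x in `[a, c]) k (h x) + \int[mu]_(x in `[c, b]) k (h x).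
  move=> ik; have := @Rintegral_itvB R (k \o h) (BLeft a) (BRight b) c ik.
  rewrite !bnd_simp => /(_ ac cb) e.
  rewrite -(@Rintegral_itv_obnd_cbnd R c (BRight b) (k \o h)); last first.
    apply: (@integrableS _ _ R mu `[a, b] `]c, b] _ _ _ _ ik) => //.
    by apply: subset_itv; rewrite bnd_simp.
  by rewrite -e addrC subrK.
case: ih => i1 i2; apply: complex_ext; rewrite ?cReD ?cImD/=; exact: E.
Qed.

Lemma normc_cint_itv (a b M : R) (h : R -> C) : a <= b -> cintegrable `[a, b] h ->
  (forall x, a <= x <= b -> normc (h x) <= M) ->
  normc (cint `[a, b] h) <= 2 * (M * (b - a)).
Proof.
move=> ab ih hM.
have iM : mu.-integrable `[a, b] (EFin \o (fun _ => M)).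
  apply: continuous_compact_integrable; first exact: segment_compact.
  by apply: continuous_subspaceT => x; exact: cst_continuous.
rewrite (le_trans (normc_cint_le _ ih iM _))//.
rewrite Rintegral_cst//= lebesgue_measure_itv/= lte_fin.
move: ab; rewrite le_eqVlt => /orP[/eqP->|ab]; first by rewrite ltxx subrr !mulr0.
by rewrite ab -EFinB.
Qed.

Lemma cint_FTC (g g' : R -> C) (a b : R) : a <= b ->
  (forall t, a <= t <= b -> cderiv g t (g' t)) ->
  (forall t, a <= t <= b -> {for t, continuous g'}) ->
  cint `[a, b] g' = g b - g a.
Proof.
rewrite le_eqVlt => /orP[/eqP <- _ _|ab dg cg'].
  rewrite subrr set_itv1; apply: complex_ext; exact: Rintegral_set1.
have E (k : C -> R) : continuous k ->
    (forall t, a <= t <= b -> is_derive t (1:R) (fun x => k (g x)) (k (g' t))) ->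
    \int[mu]_(x in `[a, b]) k (g' x) = k (g b) - k (g a).
  move=> ck dk.
  have ckg t : a <= t <= b -> {for t, continuous (fun x => k (g x))}.
    move=> tab; apply/differentiable_continuous/derivable1_diffP.
    by have [] := dk t tab.
  rewrite /Rintegral (@continuous_FTC2 _ (k \o g') (k \o g))//=.
  - apply: continuous_in_subspaceT => x; rewrite inE/= in_itv/= => xab.
    by apply: continuous_comp; [exact: cg'|exact: ck].
  - split.
    + move=> x; rewrite in_itv/= => /andP[xa xb]; have [] := dk x => //.
      by rewrite !ltW.
    + by apply/cvg_at_right_filter; apply: ckg; rewrite lexx ltW.
    + by apply/cvg_at_left_filter; apply: ckg; rewrite lexx ltW.
  - move=> x; rewrite in_itv/= => /andP[xa xb].
    have [|dx dv] := dk x; first by rewrite !ltW.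
    by rewrite derive1E.
apply: complex_ext; rewrite ?cReD ?cImD ?cReN ?cImN /=.
  by apply: E; [exact: continuous_Re|move=> t /dg[]].
by apply: E; [exact: continuous_Im|move=> t /dg[]].
Qed.

End CurveIntegral.

(** * Cauchy's theorem on polar rectangles *)

Section Subdivision.
Variable R : realType.

Lemma midpoint_le (x y : R) : x <= y -> x <= (x + y) / 2 /\ (x + y) / 2 <= y.
Proof. by move=> xy; split; lra. Qed.

Lemma nested_intervals (a b : nat -> R) (L : R) :
  (forall n, a n <= a n.+1) -> (forall n, b n.+1 <= b n) ->
  (forall n, b n - a n = L / 2 ^+ n) -> 0 <= L ->
  exists x, forall n, a n <= x <= b n.
Proof.
move=> a1 b1 ab L0.
have le_ab n : a n <= b n by rewrite -subr_ge0 ab mulr_ge0// invr_ge0 exprn_ge0.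
have aD n k : a n <= a (n + k)%N.
  by elim: k => [|k IH]; rewrite ?addn0// addnS (le_trans IH).
have bD n k : b (n + k)%N <= b n.
  by elim: k => [|k IH]; rewrite ?addn0// addnS (le_trans _ IH).
have anbm n m : a n <= b m.
  by rewrite (le_trans (aD n m))// (le_trans (le_ab _))// addnC bD.
exists (sup (range a)) => n; apply/andP; split.
  by apply: ub_le_sup; [exists (b 0%N) => _ [m _ <-]|exists n].
by apply: ge_sup; [exists (a 0%N); exists 0%N|move=> _ [m _ <-]].
Qed.

(* Cousin's lemma for rectangles, the four quarters of a rectangle keeping
   its aspect ratio. *)
Lemma rectangle_subdivision (P : R -> R -> R -> R -> Prop) (a0 b0 c0 e0 : R) :
  a0 <= b0 -> c0 <= e0 ->
  (forall a b c e, a0 <= a -> a <= b -> b <= b0 -> c0 <= c -> c <= e -> e <= e0 ->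
    let m := (a + b) / 2 in let n := (c + e) / 2 in
    P a m c n -> P m b c n -> P a m n e -> P m b n e -> P a b c e) ->
  (forall x y, a0 <= x <= b0 -> c0 <= y <= e0 -> exists2 d, 0 < d &
    forall a b c e, a0 <= a -> b <= b0 -> c0 <= c -> e <= e0 ->
      a <= x <= b -> c <= y <= e -> b - a < d -> e - c < d -> P a b c e) ->
  P a0 b0 c0 e0.
Proof.
move=> ab0 ce0 Psplit Ploc; apply: contrapT => NP0.
pose T := (R * R * R * R)%type.
pose PP (q : T) := P q.1.1.1 q.1.1.2 q.1.2 q.2.
pose ok (q : T) := [/\ a0 <= q.1.1.1, q.1.1.1 <= q.1.1.2, q.1.1.2 <= b0 &
  [/\ c0 <= q.1.2, q.1.2 <= q.2 & q.2 <= e0]].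
pose sub (q' q : T) := [/\ q.1.1.1 <= q'.1.1.1, q'.1.1.2 <= q.1.1.2,
  q'.1.1.2 - q'.1.1.1 = (q.1.1.2 - q.1.1.1) / 2 &
  [/\ q.1.2 <= q'.1.2, q'.2 <= q.2 & q'.2 - q'.1.2 = (q.2 - q.1.2) / 2]].
(* If all four quarters had the property, so would the rectangle. The hypotheses are placed under
   the existential so that [choice] yields a total function, which can be iterated. *)
have step (q : T) : exists q' : T, ok q -> ~ PP q -> [/\ ok q', ~ PP q' & sub q' q].
  have [okq|] := pselect (ok q); last by exists q.
  have [Pq|NPq] := pselect (PP q); first by exists q.
  case: q okq NPq => [[[a b] c] e] [/= h1 h2 h3 [h4 h5 h6]] NPq.
  pose m := (a + b) / 2; pose n := (c + e) / 2.
  have [am mb] := midpoint_le h2.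
  have [cn ne] := midpoint_le h5.
  have am2 : m - a = (b - a) / 2 by rewrite /m; lra.
  have bm2 : b - m = (b - a) / 2 by rewrite /m; lra.
  have cn2 : n - c = (e - c) / 2 by rewrite /n; lra.
  have en2 : e - n = (e - c) / 2 by rewrite /n; lra.
  have a0m := le_trans h1 am; have mb0 := le_trans mb h3.
  have c0n := le_trans h4 cn; have ne0 := le_trans ne h6.
  apply: contrapT => /forallNP NE; apply: NPq; apply: Psplit => //.
  - apply: contrapT => N; apply: (NE (a, m, c, n)) => _ _.
    exact: And3 (And4 h1 am mb0 (And3 h4 cn ne0)) N (And4 (lexx _) mb am2 (And3 (lexx _) ne cn2)).
  - apply: contrapT => N; apply: (NE (m, b, c, n)) => _ _.
    exact: And3 (And4 a0m mb h3 (And3 h4 cn ne0)) N (And4 am (lexx _) bm2 (And3 (lexx _) ne cn2)).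
  - apply: contrapT => N; apply: (NE (a, m, n, e)) => _ _.
    exact: And3 (And4 h1 am mb0 (And3 c0n ne h6)) N (And4 (lexx _) mb am2 (And3 cn (lexx _) en2)).
  - apply: contrapT => N; apply: (NE (m, b, n, e)) => _ _.
    exact: And3 (And4 a0m mb h3 (And3 c0n ne h6)) N (And4 am (lexx _) bm2 (And3 cn (lexx _) en2)).
have [g gP] := choice step.
pose s k := iter k g (a0, b0, c0, e0).
have sP k : ok (s k) /\ ~ PP (s k).
  elim: k => [|k [IH1 IH2]]; first by split.
  by have [] := gP (s k) IH1 IH2.
have sS k : sub (s k.+1) (s k).
  by have [h1 h2] := sP k; have [] := gP (s k) h1 h2.
have sx k : (s k).1.1.2 - (s k).1.1.1 = (b0 - a0) / 2 ^+ k.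
  elim: k => [|k IH]; first by rewrite expr0 divr1.
  have [_ _ -> _] := sS k; rewrite IH exprS invfM; ring.
have sy k : (s k).2 - (s k).1.2 = (e0 - c0) / 2 ^+ k.
  elim: k => [|k IH]; first by rewrite expr0 divr1.
  have [_ _ _ [_ _ ->]] := sS k; rewrite IH exprS invfM; ring.
have [x xP] : exists x, forall k, (s k).1.1.1 <= x <= (s k).1.1.2.
  apply: (@nested_intervals (fun k => (s k).1.1.1) (fun k => (s k).1.1.2) (b0 - a0)) => //.
  - by move=> k; have [] := sS k.
  - by move=> k; have [] := sS k.
  - by rewrite subr_ge0.
have [y yP] : exists y, forall k, (s k).1.2 <= y <= (s k).2.
  apply: (@nested_intervals (fun k => (s k).1.2) (fun k => (s k).2) (e0 - c0)) => //.
  - by move=> k; have [_ _ _ []] := sS k.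
  - by move=> k; have [_ _ _ []] := sS k.
  - by rewrite subr_ge0.
have [d d0 dP] := Ploc x y (xP 0%N) (yP 0%N).
have [k kP] : exists k : nat, (b0 - a0) + (e0 - c0) < d * 2 ^+ k.
  have [k hk] : exists k : nat, ((b0 - a0) + (e0 - c0)) / d < k%:R.
    exists (Num.truncn (((b0 - a0) + (e0 - c0)) / d)).+1.
    by rewrite truncnS_gt.
  exists k; rewrite mulrC -ltr_pdivrMr// (lt_le_trans hk)//.
  by rewrite -natrX ler_nat ltnW// ltn_expl.
have [[h1 h2 h3 [h4 h5 h6]] []] := sP k.
have p2 : 0 < 2 ^+ k :> R by rewrite exprn_gt0.
by apply: dP => //; rewrite ?sx ?sy ltr_pdivrMr//; lra.
Qed.

End Subdivision.

Ltac generalize_cint :=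
  repeat match goal with |- context [cint ?D ?h] => generalize (cint D h); intro end.

Section PolarCauchy.
Variable R : realType.
Local Notation C := R[i].
Implicit Types (f : C -> C).

Definition arc_integrand (r : R) f (th : R) : C :=
  f (r%:C * expi th) * ((0 +i* r) * expi th).

(** The boundary of a rectangle in polar coordinates, counterclockwise. Its sides are rays from the
    origin and arcs about it, exactly the pieces that occur when a ray of integration is rotated. *)
Definition polar_boundary f (r0 r1 t0 t1 : R) : C :=
  cint `[r0, r1] (ray_integrand t0 f) + cint `[t0, t1] (arc_integrand r1 f)
  - cint `[r0, r1] (ray_integrand t1 f) - cint `[t0, t1] (arc_integrand r0 f).

Definition polar_continuous f (r0 r1 t0 t1 : R) : Prop :=
  forall r t, r0 <= r <= r1 -> t0 <= t <= t1 -> {for r%:C * expi t, continuous f}.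

Lemma continuous_ReIm (T : topologicalType) (h : T -> C) x : {for x, continuous h} ->
  {for x, continuous (fun y => Re (h y))} /\ {for x, continuous (fun y => Im (h y))}.
Proof.
by move=> ch; split; apply: (cvg_comp _ _ ch); [exact: continuous_Re|exact: continuous_Im].
Qed.

Lemma continuous_mulC (T : topologicalType) (f g : T -> C) x :
  {for x, continuous f} -> {for x, continuous g} ->
  {for x, continuous (fun y => f y * g y)}.
Proof.
move=> /continuous_ReIm[f1 f2] /continuous_ReIm[g1 g2]; apply: cvgC_ReIm.
  by rewrite cReM; under eq_fun do rewrite cReM; apply: cvgB; exact: cvgM.
by rewrite cImM; under eq_fun do rewrite cImM; apply: cvgD; exact: cvgM.
Qed.

Lemma continuous_addC (T : topologicalType) (f g : T -> C) x :
  {for x, continuous f} -> {for x, continuous g} ->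
  {for x, continuous (fun y => f y + g y)}.
Proof.
move=> /continuous_ReIm[f1 f2] /continuous_ReIm[g1 g2]; apply: cvgC_ReIm.
  by rewrite cReD; under eq_fun do rewrite cReD; exact: cvgD.
by rewrite cImD; under eq_fun do rewrite cImD; exact: cvgD.
Qed.

Lemma continuous_compC (T U V : topologicalType) (f : U -> V) (g : T -> U) x :
  {for x, continuous g} -> {for g x, continuous f} ->
  {for x, continuous (fun y => f (g y))}.
Proof. by move=> cg cf; exact: (cvg_comp _ _ cg cf). Qed.

Lemma continuous_ray f r t : {for r%:C * expi t, continuous f} ->
  {for r, continuous (ray_integrand t f)}.
Proof.
move=> cf; apply: continuous_mulC; last exact: cst_continuous.
apply: (continuous_compC (g := fun r : R => r%:C * expi t)); last exact: cf.
by apply: continuous_mulC; [exact: continuous_realC|exact: cst_continuous].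
Qed.

Lemma continuous_arc f r t : {for r%:C * expi t, continuous f} ->
  {for t, continuous (arc_integrand r f)}.
Proof.
move=> cf; apply: continuous_mulC.
  apply: (continuous_compC (g := fun t : R => r%:C * expi t)); last exact: cf.
  by apply: continuous_mulC; [exact: cst_continuous|exact: continuous_expi].
by apply: continuous_mulC; [exact: cst_continuous|exact: continuous_expi].
Qed.

(** The inner sides are traversed twice, in opposite directions, and cancel. *)
Lemma polar_boundary_split f (a b c e m n : R) : a <= m <= b -> c <= n <= e ->
  polar_continuous f a b c e ->
  polar_boundary f a b c e = polar_boundary f a m c n + polar_boundary f m b c n
    + (polar_boundary f a m n e + polar_boundary f m b n e).
Proof.
move=> /andP[am mb] /andP[cn ne] pc.
have ab := le_trans am mb; have ce := le_trans cn ne.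
have iray t : c <= t <= e -> cintegrable `[a, b] (ray_integrand t f).
  by move=> tce; apply: cintegrable_itv => r rab; apply: continuous_ray; exact: pc.
have iarc r : a <= r <= b -> cintegrable `[c, e] (arc_integrand r f).
  by move=> rab; apply: cintegrable_itv => t tce; apply: continuous_arc; exact: pc.
rewrite /polar_boundary.
rewrite (cint_itv_split am mb (iray c _)) ?lexx//.
rewrite (cint_itv_split am mb (iray e _)) ?lexx ?ce//.
rewrite (cint_itv_split cn ne (iarc a _)) ?lexx//.
rewrite (cint_itv_split cn ne (iarc b _)) ?lexx ?ab//.
generalize_cint; ring.
Qed.

Lemma polar_boundaryD f g (a b c e : R) :
  polar_continuous f a b c e -> polar_continuous g a b c e -> a <= b -> c <= e ->
  polar_boundary (fun u => f u + g u) a b c e = polar_boundary f a b c e + polar_boundary g a b c e.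
Proof.
move=> pf pg ab ce.
have iray t h : polar_continuous h a b c e -> c <= t <= e -> cintegrable `[a, b] (ray_integrand t h).
  by move=> ph tce; apply: cintegrable_itv => r rab; apply: continuous_ray; exact: ph.
have iarc r h : polar_continuous h a b c e -> a <= r <= b -> cintegrable `[c, e] (arc_integrand r h).
  by move=> ph rab; apply: cintegrable_itv => t tce; apply: continuous_arc; exact: ph.
have Dray t : c <= t <= e -> cint `[a, b] (ray_integrand t (fun u => f u + g u)) =
   cint `[a, b] (ray_integrand t f) + cint `[a, b] (ray_integrand t g).
  move=> tce; rewrite -cintD//; [|exact: iray|exact: iray].
  by apply: eq_cint => x _; rewrite /ray_integrand mulrDl.
have Darc r : a <= r <= b -> cint `[c, e] (arc_integrand r (fun u => f u + g u)) =
   cint `[c, e] (arc_integrand r f) + cint `[c, e] (arc_integrand r g).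
  move=> tce; rewrite -cintD//; [|exact: iarc|exact: iarc].
  by apply: eq_cint => x _; rewrite /arc_integrand mulrDl.
rewrite /polar_boundary !Dray ?Darc ?lexx ?ab ?ce//; generalize_cint; ring.
Qed.

(** An affine function has a primitive, so each side contributes a difference of end values and the
    four differences telescope. *)
Lemma polar_boundary_affine (k l : C) (a b c e : R) : a <= b -> c <= e ->
  polar_boundary (fun u => k + l * u) a b c e = 0.
Proof.
move=> ab ce.
pose A (u : C) := (k + l * u / 2) * u.
have cont (x : C) : {for x, continuous (fun u => k + l * u)}.
  apply: continuous_addC; first exact: cst_continuous.
  by apply: continuous_mulC; [exact: cst_continuous|exact: (@cvg_id C)].
have dA (g : R -> C) t d : cderiv g t d -> cderiv (fun x => A (g x)) t ((k + l * g t) * d).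
  move=> dg; have := cderivM (cderivD (cderiv_cst k t)
    (cderivM (cderivM (cderiv_cst l t) dg) (cderiv_cst 2^-1 t))) dg.
  rewrite (_ : _ + _ * d = (k + l * g t) * d)//.
  by rewrite mul0r !mulr0 !add0r addr0; field.
have ray t : cint `[a, b] (ray_integrand t (fun u => k + l * u)) =
    A (b%:C * expi t) - A (a%:C * expi t).
  apply: (cint_FTC (g := fun x => A (x%:C * expi t)) ab) => x xab.
    by apply: dA; exact: cderiv_ray.
  exact: continuous_ray.
have arc r : cint `[c, e] (arc_integrand r (fun u => k + l * u)) =
    A (r%:C * expi e) - A (r%:C * expi c).
  apply: (cint_FTC (g := fun x => A (r%:C * expi x)) ce) => x xab.
    by apply: dA; exact: cderiv_arc.
  exact: continuous_arc.
rewrite /polar_boundary !ray !arc; ring.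
Qed.

Lemma expi_lipschitz (x y : R) : normc (expi x - expi y) <= 2 * `|x - y|.
Proof.
have -> : expi x - expi y = expi y * (expi (x - y) - 1).
  by rewrite mulrBr -expiD addrCA subrr addr0 mulr1.
rewrite normcM normc_expi mul1r (le_trans (normc_le_ReIm _))//=.
by rewrite subr0 mulr_natl mulr2n lerD// ?cos_sub1_le1// sin_norm_le.
Qed.

Lemma normc_polar_boundary f (a b c e M r1 : R) : 0 <= a -> b <= r1 -> a <= b -> c <= e ->
  polar_continuous f a b c e ->
  (forall r t, a <= r <= b -> c <= t <= e -> normc (f (r%:C * expi t)) <= M) ->
  normc (polar_boundary f a b c e) <= 4 * M * (b - a) + 4 * M * r1 * (e - c).
Proof.
move=> a0 br1 ab ce pf fM.
have M0 : 0 <= M by rewrite (le_trans (normc_ge0 _) (fM a c _ _))// lexx ?ab ?ce.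
have r10 : 0 <= r1 by lra.
have ray t : c <= t <= e ->
    normc (cint `[a, b] (ray_integrand t f)) <= 2 * (M * (b - a)).
  move=> tce; apply: normc_cint_itv => //.
    by apply: cintegrable_itv => r rab; apply: continuous_ray; exact: pf.
  by move=> x xab; rewrite /ray_integrand normcM normc_expi mulr1 fM.
have arc r : a <= r <= b ->
    normc (cint `[c, e] (arc_integrand r f)) <= 2 * (M * r1 * (e - c)).
  move=> rab; apply: normc_cint_itv => //.
    by apply: cintegrable_itv => t tce; apply: continuous_arc; exact: pf.
  move=> x xce; rewrite /arc_integrand !normcM normc_expi mulr1 ler_pM ?normc_ge0 ?fM//.
  rewrite /= expr0n add0r sqrtr_sqr; move: rab => /andP[ar rb].
  by rewrite ger0_norm; lra.
rewrite /polar_boundary.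
have := ray c ltac:(by rewrite lexx ce).
have := ray e ltac:(by rewrite lexx ce).
have := arc a ltac:(by rewrite lexx ab).
have := arc b ltac:(by rewrite lexx ab).
move: (cint `[a, b] (ray_integrand c f)) (cint `[a, b] (ray_integrand e f))
  (cint `[c, e] (arc_integrand a f)) (cint `[c, e] (arc_integrand b f)) => z1 z2 z3 z4.
move=> h1 h2 h3 h4.
have n1 := normcD (z1 + z4 - z2) (- z3).
have n2 := normcD (z1 + z4) (- z2).
have n3 := normcD z1 z4.
rewrite !normcN in n1 n2; lra.
Qed.

(** Goursat's argument in polar coordinates. The bound e L^2, with L the sum of the side lengths,
    passes from four quarters to the whole because each quarter has L / 2. On a small rectangle the
    affine part of f integrates to 0, the rest is at most a small multiple of L, and the perimeter
    is of order L. *)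
Lemma polar_cauchy f (r0 r1 t0 t1 : R) : 0 <= r0 -> r0 <= r1 -> t0 <= t1 ->
  (forall r t, r0 <= r <= r1 -> t0 <= t <= t1 -> differentiable f (r%:C * expi t)) ->
  polar_boundary f r0 r1 t0 t1 = 0.
Proof.
move=> r00 r01 t01 df.
have pc : polar_continuous f r0 r1 t0 t1.
  by move=> r t hr ht; apply: differentiable_continuous; exact: df.
have pcs a b c e : r0 <= a -> b <= r1 -> t0 <= c -> e <= t1 ->
    polar_continuous f a b c e.
  by move=> h1 h2 h3 h4 r t /andP[h5 h6] /andP[h7 h8]; apply: pc; apply/andP; split; lra.
have r10 : 0 <= r1 by lra.
suff key e : 0 < e -> normc (polar_boundary f r0 r1 t0 t1) <=
    e * ((r1 - r0) + (t1 - t0)) ^+ 2.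
  apply/eqP; rewrite -normc_eq0 eq_le normc_ge0 andbT.
  apply/ler_addgt0Pr => e e0; rewrite add0r.
  pose L := ((r1 - r0) + (t1 - t0)) ^+ 2 + 1.
  have L0 : 0 < L by rewrite /L ltr_wpDl// sqr_ge0.
  have := key (e / L) (divr_gt0 e0 L0).
  move=> /le_trans; apply; rewrite mulrAC ler_pdivrMr// ler_pM2l// /L; lra.
move=> e0.
pose P a b c d := normc (polar_boundary f a b c d) <= e * ((b - a) + (d - c)) ^+ 2.
apply: (@rectangle_subdivision R P r0 r1 t0 t1) => //.
  move=> a b c d r0a ab br1 t0c cd dt1 m n; rewrite /P => h1 h2 h3 h4.
  have [am mb] := midpoint_le ab.
  have [cn nd] := midpoint_le cd.
  rewrite (@polar_boundary_split f a b c d m n) ?am ?cn//; last exact: pcs.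
  move: h1 h2 h3 h4.
  have -> : m - a = (b - a) / 2 by rewrite /m; lra.
  have -> : b - m = (b - a) / 2 by rewrite /m; lra.
  have -> : n - c = (d - c) / 2 by rewrite /n; lra.
  have -> : d - n = (d - c) / 2 by rewrite /n; lra.
  have -> : (b - a) / 2 + (d - c) / 2 = ((b - a) + (d - c)) / 2 by lra.
  rewrite exprMn (_ : 2^-1 ^+ 2 = 4^-1 :> R); last first.
    by rewrite expr2 -invfM; congr (_^-1); ring.
  move: (polar_boundary f a m c n) (polar_boundary f m b c n)
    (polar_boundary f a m n d) (polar_boundary f m b n d) => z1 z2 z3 z4 h1 h2 h3 h4.
  have n1 := normcD (z1 + z2) (z3 + z4).
  have n2 := normcD z1 z2; have n3 := normcD z3 z4.
  rewrite mulrA in h1 h2 h3 h4.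
  move: (e * _) h1 h2 h3 h4 => w h1 h2 h3 h4; lra.
move=> x y hx hy; pose u0 := x%:C * expi y.
have [l hl] := differentiable_normcP (df x y hx hy).
(* K L bounds both the diameter, where [expi_lipschitz] brings the 2, and the perimeter of a polar
   rectangle of radius at most r1. The boundary integral is then at most 4 eta K^2 L^2, so [eta]
   makes it e L^2, and the 2 in the radius d0 / (2 K) accounts for the two sides in L. *)
pose K := 1 + 2 * r1; have K0 : 0 < K by rewrite /K; lra.
pose eta := e / (4 * K * K).
have eta0 : 0 < eta by rewrite divr_gt0// !mulr_gt0.
have [d0 d00 hd0] := hl eta eta0.
have K20 : 0 < 2 * K by rewrite mulr_gt0.
exists (d0 / (2 * K)); first exact: divr_gt0.
move=> a b c d ha hb hc hd hax hcy; rewrite !ltr_pdivlMr// => bd cd.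
have [ab cd'] : a <= b /\ c <= d by clear -hax hcy; split; lra.
pose g u := (f u0 - u0 * l) + l * u; pose h u := f u - g u.
have cg (v : C) : {for v, continuous g}.
  apply: continuous_addC; first exact: cst_continuous.
  by apply: continuous_mulC; [exact: cst_continuous|exact: (@cvg_id C)].
have ph : polar_continuous h a b c d.
  move=> r t hr ht; rewrite /h.
  rewrite (_ : (fun u => f u - g u) = (fun u => f u + (-1) * g u)); last first.
    by apply/funext => v; rewrite mulN1r.
  apply: continuous_addC; first by apply: (pcs a b c d).
  by apply: continuous_mulC; [exact: cst_continuous|exact: cg].
have pg : polar_continuous g a b c d by move=> r t _ _; exact: cg.
rewrite /P.
have -> : polar_boundary f a b c d = polar_boundary h a b c d.
  have -> : f = (fun u => h u + g u) by apply/funext => u; rewrite /h subrK.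
  by rewrite polar_boundaryD// polar_boundary_affine// addr0.
have dist r t : a <= r <= b -> c <= t <= d ->
    normc (r%:C * expi t - u0) <= K * ((b - a) + (d - c)).
  move=> /andP[ar rb] /andP[ct td].
  have -> : r%:C * expi t - u0 = (r - x)%:C * expi t + x%:C * (expi t - expi y).
    by rewrite /u0 rmorphB/=; ring.
  rewrite (le_trans (normcD _ _))// !normcM normc_expi mulr1 !normc_real.
  have h1 : `|r - x| <= b - a by rewrite ler_norml; clear -ar rb hax; apply/andP; split; lra.
  have h2 : `|x| <= r1.
    by case/andP: hx => x0 x1; rewrite ger0_norm// (le_trans r00).
  have h3 : normc (expi t - expi y) <= 2 * (d - c).
    rewrite (le_trans (expi_lipschitz _ _))// ler_pM2l//.
    by rewrite ler_norml; clear -ct td hcy; apply/andP; split; lra.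
  have h4 : `|x| * normc (expi t - expi y) <= r1 * (2 * (d - c)).
    by rewrite ler_pM// normc_ge0.
  rewrite (le_trans (lerD h1 h4))// /K mulrDl mul1r.
  have p1 : 0 <= r1 * (b - a) by rewrite mulr_ge0// subr_ge0.
  by clear -p1 ab cd'; lra.
have hM r t : a <= r <= b -> c <= t <= d ->
    normc (h (r%:C * expi t)) <= eta * (K * ((b - a) + (d - c))).
  move=> hr ht; rewrite /h /g (_ : _ - _ = f (r%:C * expi t) - f u0 - (r%:C * expi t - u0) * l).
    apply: le_trans (ler_wpM2l (ltW eta0) (dist r t hr ht)); apply: hd0.
    by rewrite (le_lt_trans (dist r t hr ht))//; lra.
  by ring.
have := @normc_polar_boundary h a b c d _ r1 (le_trans r00 ha) hb ab cd' ph hM.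
set L := (b - a) + (d - c) => hh.
have L0 : 0 <= L by rewrite /L; lra.
have M0 : 0 <= 4 * (eta * (K * L)).
  by rewrite mulr_ge0 ?(mulr_ge0 (ltW eta0))// mulr_ge0// ltW.
apply: (le_trans hh).
apply: (@le_trans _ _ (4 * (eta * (K * L)) * (K * L))).
  rewrite -[X in _ + X <= _]mulrA -mulrDr ler_wpM2l// /K mulrDl mul1r.
  have p1 : 0 <= r1 * (b - a) by rewrite mulr_ge0// subr_ge0.
  have p2 : 0 <= r1 * (d - c) by rewrite mulr_ge0// subr_ge0.
  by rewrite /L; clear -p1 p2 ab cd'; lra.
rewrite le_eqVlt; apply/orP; left; apply/eqP; rewrite /eta; field.
by rewrite gt_eqF.
Qed.

End PolarCauchy.

(** * Rotating a ray of integration *)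

Section RayRotation.
Variable R : realType.
Local Notation C := R[i].
Local Notation mu := (@lebesgue_measure R).
Implicit Types (f : C -> C) (h : R -> C).

(** The integrands carry a factor 1/u, so continuity is asked for positive radii only; the endpoint
    0 is split off as a singleton. *)
Lemma cmeasurable_ray h : (forall r, 0 < r -> {for r, continuous h}) ->
  @cmeasurable _ (measurableTypeR R) R `[0%R, +oo[ h.
Proof.
move=> ch.
have H (k : C -> R) : continuous k -> @measurable_fun _ _ (measurableTypeR R) R `[0%R, +oo[ (fun x => k (h x)).
  move=> ck; rewrite -(@setU1itv _ _ +oo%O 0 false)// measurable_funU//; split.
    exact: measurable_fun_set1.
  apply: open_continuous_measurable_fun; first exact: interval_open.
  move=> x; rewrite inE/= in_itv/= andbT => x0.
  by apply: (continuous_compC (f := k) (g := h)); [exact: ch|exact: ck].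
by split; apply: H; [exact: continuous_Re|exact: continuous_Im].
Qed.

Lemma integrable_ray_majorant (K c : R) : 0 < c ->
  mu.-integrable `[0, +oo[ (EFin \o (fun r => K * expR (- (c * r)))).
Proof.
move=> c0.
have i1 := integrableZl measurableT K (integrable_expN c0).
have i2 : mu.-integrable `[0, +oo[ (fun x => K%:E * (EFin \o (fun x => expR (- (c * `|x|)))) x)%E.
  by apply: (@integrableS _ _ R mu setT _ _ _ _ _ i1).
apply: eq_integrable i2 => //= x; rewrite inE/= in_itv/= andbT => x0.
by rewrite -EFinM ger0_norm.
Qed.

Lemma cintegrable_ray h (K c : R) : 0 < c ->
  (forall r, 0 < r -> {for r, continuous h}) ->
  (forall r, 0 <= r -> normc (h r) <= K * expR (- (c * r))) ->
  cintegrable `[0, +oo[ h.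
Proof.
move=> c0 ch hK; apply: (@cintegrable_dom _ _ _ (fun r => K * expR (- (c * r)))).
- exact: measurable_itv.
- exact: cmeasurable_ray.
- exact: integrable_ray_majorant.
- by move=> r; rewrite /= in_itv/= andbT; exact: hK.
Qed.

Lemma cint_ray_split h (b : R) : 0 <= b -> cintegrable `[0, +oo[ h ->
  cint `[0, +oo[ h = cint `[0, b] h + cint `]b, +oo[ h.
Proof.
move=> b0 ih.
have E : [set` `[0, +oo[] = [set` `[0, b]] `|` [set` `]b, +oo[] :> set R.
  by rewrite -itv_bndbnd_setU.
rewrite E cint_setU//; first by rewrite -E.
by apply/disj_setPS => x [/=]; rewrite !in_itv/= andbT => /andP[_ xb]; rewrite ltNge xb.
Qed.

(** Half of the decay exp(-r) is spent on the smallness exp(-b/2), the other half on convergence of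
    the integral. *)
Lemma normc_cint_tail h (K b : R) : 0 <= b -> 0 <= K -> cintegrable `[0, +oo[ h ->
  (forall r, b < r -> normc (h r) <= K * expR (- r)) ->
  normc (cint `]b, +oo[ h) <= 2 * (K * expR (- (2^-1 * b)) * \int[mu]_(r in `[0, +oo[) expR (- (2^-1 * r))).
Proof.
move=> b0 K0 ih hK.
have sub : ([set` `]b, +oo[] : set R) `<=` [set` `[0, +oo[].
  by apply: subset_itv; rewrite bnd_simp.
have i1 (k : R) : mu.-integrable `[0, +oo[ (EFin \o (fun r => k * expR (- (2^-1 * r)))).
  by apply: integrable_ray_majorant; rewrite invr_gt0.
have ig : mu.-integrable `]b, +oo[ (EFin \o (fun r => K * expR (- (2^-1 * b)) * expR (- (2^-1 * r)))).
  by apply: (@integrableS _ _ R mu [set` `[0, +oo[] [set` `]b, +oo[] _ _ _ sub (i1 _)).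
rewrite (le_trans (normc_cint_le _ _ ig _))//.
- exact: cintegrableS ih.
- move=> r; rewrite /= in_itv/= andbT => br; rewrite (le_trans (hK _ br))//.
  rewrite -mulrA ler_wpM2l// -expRD ler_expR; lra.
rewrite ler_pM2l// -RintegralZl//; last first.
  by have := i1 1; under [X in EFin \o X]eq_fun do rewrite mul1r.
have i2 := i1 (K * expR (- (2^-1 * b))).
rewrite Rintegral_mkcond [leRHS]Rintegral_mkcond; apply: le_Rintegral => //.
- by have := (integrable_mkcond _ _).1 ig; rewrite restrict_EFin; apply.
- by have := (integrable_mkcond _ _).1 i2; rewrite restrict_EFin; apply.
move=> x _; rewrite !patchE; case: ifPn => [/set_mem/sub xb|_].
  by rewrite mem_set.
by case: ifPn => // _; rewrite !mulr_ge0// expR_ge0.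
Qed.

(** Differentiability is known only away from the vertex, but f is bounded: Cauchy's theorem is
    applied down to radius a, and the part below contributes O(a), two ray segments and one arc. *)
Lemma polar_cauchy0 f (K c t0 t1 : R) : 0 < c -> t0 <= t1 ->
  (forall r t, 0 < r <= c -> t0 <= t <= t1 -> differentiable f (r%:C * expi t)) ->
  (forall r t, 0 <= r <= c -> t0 <= t <= t1 -> normc (f (r%:C * expi t)) <= K) ->
  cint `[0, c] (ray_integrand t1 f) - cint `[0, c] (ray_integrand t0 f)
  = cint `[t0, t1] (arc_integrand c f).
Proof.
move=> c0 t01 df fK.
have K0 : 0 <= K by rewrite (le_trans (normc_ge0 _) (fK c t0 _ _))// ?lexx ?t01// ltW.
have cf r t : 0 < r <= c -> t0 <= t <= t1 -> {for r%:C * expi t, continuous f}.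
  by move=> hr ht; exact/differentiable_continuous/df.
have iray t : t0 <= t <= t1 -> cintegrable `[0, c] (ray_integrand t f).
  move=> ht; apply: (@cintegrable_dom _ _ _ (fun _ => K)) => //.
  - have H (k : C -> R) : continuous k -> @measurable_fun _ _ (measurableTypeR R) R `[0%R, c] (fun x => k (ray_integrand t f x)).
      move=> ck; rewrite -(@setU1itv _ _ (BRight c) 0 false) ?bnd_simp ?ltW// measurable_funU//; split.
        exact: measurable_fun_set1.
      apply: subspace_continuous_measurable_fun => //.
      apply: continuous_in_subspaceT => x; rewrite inE/= in_itv/= => xc.
      apply: (continuous_compC (f := k) (g := ray_integrand t f)); last exact: ck.
      by apply: continuous_ray; exact: cf.
    by split; apply: H; [exact: continuous_Re|exact: continuous_Im].
  - apply: continuous_compact_integrable; first exact: segment_compact.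
    by apply: continuous_subspaceT => x; exact: cst_continuous.
  - move=> r; rewrite /= in_itv/= => hr.
    by rewrite /ray_integrand normcM normc_expi mulr1 fK.
pose T := t1 - t0.
suff key a : 0 < a -> a <= c -> normc (cint `[0, c] (ray_integrand t1 f)
   - cint `[0, c] (ray_integrand t0 f) - cint `[t0, t1] (arc_integrand c f)) <= a * (4 * K + 2 * K * T).
  apply/eqP; rewrite -subr_eq0 -normc_eq0 eq_le normc_ge0 andbT.
  apply/ler_addgt0Pr => e e0; rewrite add0r.
  pose L := 4 * K + 2 * K * T + 1.
  have L1 : 0 <= 4 * K + 2 * K * T by rewrite addr_ge0 ?mulr_ge0 ?subr_ge0.
  have L0 : 0 < L by rewrite /L ltr_wpDl.
  have := key (Num.min c (e / L)); rewrite lt_min c0 divr_gt0//= => /(_ isT).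
  rewrite ge_min lexx /= => /(_ isT) /le_trans; apply.
  apply: (@le_trans _ _ (e / L * (4 * K + 2 * K * T))).
    by rewrite ler_wpM2r// ge_min lexx orbT.
  rewrite mulrAC ler_pdivrMr// ler_pM2l// /L; lra.
move=> a0 ac.
have c00 := ltW c0; have a00 := ltW a0.
rewrite (cint_itv_split a00 ac (iray t0 _)) ?lexx//.
rewrite (cint_itv_split a00 ac (iray t1 _)) ?lexx ?t01//.
have h0 t : t0 <= t <= t1 -> normc (cint `[0, a] (ray_integrand t f)) <= 2 * (K * (a - 0)).
  move=> ht; apply: normc_cint_itv => //; first exact: (cintegrable_subitv (lexx 0) ac (iray t ht)).
  move=> x /andP[x0 xa]; rewrite /ray_integrand normcM normc_expi mulr1 fK//.
  by rewrite x0 (le_trans xa).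
have := @polar_cauchy R f a c t0 t1 a00 ac t01.
have -> : (forall r t, a <= r <= c -> t0 <= t <= t1 -> differentiable f (r%:C * expi t)) = True.
  rewrite propeqE; split => // _ r t /andP[ar rc] ht; apply: df => //.
  by rewrite (lt_le_trans a0).
move=> /(_ I); rewrite /polar_boundary.
have ha : normc (cint `[t0, t1] (arc_integrand a f)) <= 2 * (K * a * T).
  apply: normc_cint_itv => //.
    by apply: cintegrable_itv => t ht; apply: continuous_arc; apply: cf => //; rewrite a0.
  move=> x hx; rewrite /arc_integrand !normcM normc_expi mulr1 ler_pM ?normc_ge0 ?fK ?a00//.
  by rewrite /= expr0n add0r sqrtr_sqr ger0_norm.
have := h0 t0; have := h0 t1; rewrite !lexx t01 subr0 => /(_ isT) h1 /(_ isT) h2.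
move: ha h1 h2.
move: (cint `[t0, t1] (arc_integrand a f)) (cint `[t0, t1] (arc_integrand c f))
  (cint `[0, a] (ray_integrand t0 f)) (cint `[0, a] (ray_integrand t1 f))
  (cint `[a, c] (ray_integrand t0 f)) (cint `[a, c] (ray_integrand t1 f)) =>
  z1 z2 z3 z4 z5 z6 h1 h2 h3 E.
have -> : z4 + z6 - (z3 + z5) - z2 = z4 - z3 - z1 - (z5 + z2 - z6 - z1) by ring.
rewrite E subr0.
have n1 := normcD (z4 - z3) (- z1).
have n2 := normcD z4 (- z3).
by rewrite !normcN in n1 n2; lra.
Qed.

(** Close the two rays by the arc of radius b. The tails are O(exp(-b/2)), and so is the arc, since
    b exp(-b) <= 2 exp(-b/2); then b grows. *)
Lemma ray_int_rotate f (K t0 t1 : R) : t0 <= t1 ->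
  (forall r t, 0 < r -> t0 <= t <= t1 -> differentiable f (r%:C * expi t)) ->
  (forall r t, 0 <= r -> t0 <= t <= t1 -> normc (f (r%:C * expi t)) <= K * expR (- r)) ->
  ray_int t0 f = ray_int t1 f.
Proof.
move=> t01 df fK.
have K0 : 0 <= K.
  have := fK 0 t0 (lexx 0); rewrite lexx t01 oppr0 expR0 mulr1 => /(_ isT).
  exact: le_trans (normc_ge0 _).
have cf r t : 0 < r -> t0 <= t <= t1 -> {for r%:C * expi t, continuous f}.
  by move=> hr ht; exact/differentiable_continuous/df.
have iray t : t0 <= t <= t1 -> cintegrable `[0, +oo[ (ray_integrand t f).
  move=> ht; apply: (@cintegrable_ray _ K 1) => //.
    by move=> r r0; apply: continuous_ray; exact: cf.
  by move=> r r0; rewrite mul1r /ray_integrand normcM normc_expi mulr1 fK.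
pose I := \int[mu]_(r in `[0, +oo[) expR (- (2^-1 * r)).
have I0 : 0 <= I by apply: Rintegral_ge0 => x _; exact: expR_ge0.
pose T := t1 - t0; have T0 : 0 <= T by rewrite subr_ge0.
pose M := 4 * K * I + 4 * K * T.
have M0 : 0 <= M by rewrite addr_ge0// mulr_ge0// mulr_ge0.
suff key b : 0 < b -> normc (ray_int t1 f - ray_int t0 f) <= expR (- (2^-1 * b)) * M.
  apply/eqP; rewrite eq_sym -subr_eq0 -normc_eq0 eq_le normc_ge0 andbT.
  apply/ler_addgt0Pr => e e0; rewrite add0r.
  pose L := M + 1; have L0 : 0 < L by rewrite /L ltr_wpDl.
  have b0 : 0 < 2 * (L / e) by rewrite mulr_gt0// divr_gt0.
  apply: (le_trans (key _ b0)).
  have -> : 2^-1 * (2 * (L / e)) = L / e by rewrite mulKf.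
  rewrite expRN mulrC ler_pdivrMr ?expR_gt0//.
  apply: (@le_trans _ _ (e * (L / e))).
    by rewrite mulrCA divff ?gt_eqF// mulr1 /L; lra.
  by rewrite ler_pM2l// (le_trans _ (expR_ge1Dx _))//; lra.
move=> b0; have b00 := ltW b0.
rewrite /ray_int !(cint_ray_split b00 (iray _ _)) ?lexx ?t01//.
have tail t : t0 <= t <= t1 -> normc (cint `]b, +oo[ (ray_integrand t f)) <=
    2 * (K * expR (- (2^-1 * b)) * I).
  move=> ht; apply: normc_cint_tail => //; first exact: iray.
  move=> r br; rewrite /ray_integrand normcM normc_expi mulr1 fK//; lra.
have fK' r t : 0 <= r <= b -> t0 <= t <= t1 -> normc (f (r%:C * expi t)) <= K.
  move=> /andP[r0 rb] ht; rewrite (le_trans (fK _ _ r0 ht))// ler_piMr//.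
  by rewrite -expR0 ler_expR; lra.
have df' r t : 0 < r <= b -> t0 <= t <= t1 -> differentiable f (r%:C * expi t).
  by move=> /andP[r0 _]; exact: df.
have E := polar_cauchy0 b0 t01 df' fK'.
have ha : normc (cint `[t0, t1] (arc_integrand b f)) <= 2 * (K * expR (- b) * b * T).
  apply: normc_cint_itv => //.
    by apply: cintegrable_itv => t ht; apply: continuous_arc; exact: cf.
  move=> x hx; rewrite /arc_integrand !normcM normc_expi mulr1 ler_pM ?normc_ge0 ?fK ?b00//.
  by rewrite /= expr0n add0r sqrtr_sqr ger0_norm.
have := tail t0; have := tail t1; rewrite !lexx t01 => /(_ isT) h1 /(_ isT) h2.
move: E ha h1 h2.
move: (cint `[t0, t1] (arc_integrand b f)) (cint `[0, b] (ray_integrand t1 f))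
 (cint `[0, b] (ray_integrand t0 f)) (cint `]b, +oo[ (ray_integrand t0 f))
 (cint `]b, +oo[ (ray_integrand t1 f)) => z1 z2 z3 z4 z5 E ha h1 h2.
rewrite (_ : z2 + z5 - (z3 + z4) = (z2 - z3) + z5 - z4); last by ring.
rewrite E.
have n1 := normcD (z1 + z5) (- z4).
have n2 := normcD z1 z5.
rewrite normcN in n1.
have eb : expR (- b) * b <= 2 * expR (- (2^-1 * b)).
  have -> : - b = - (2^-1 * b) + - (2^-1 * b) by lra.
  rewrite expRD -mulrA mulrC ler_pM2r ?expR_gt0// expRN mulrC ler_pdivrMr ?expR_gt0//.
  by have := expR_ge1Dx (2^-1 * b); lra.
have : K * expR (- b) * b * T <= K * (2 * expR (- (2^-1 * b))) * T.
  by rewrite ler_wpM2r// -mulrA ler_wpM2l.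
rewrite /M; move: (expR (- (2^-1 * b))) h1 h2 ha eb => w h1 h2 ha _ ha2.
rewrite [leRHS](_ : _ = 2 * (K * (2 * w) * T) + 2 * (K * w * I) + 2 * (K * w * I)); last by ring.
by move: (K * _ * b * T) (K * (2 * w) * T) (K * w * I) ha ha2 h1 h2 => *; lra.
Qed.

End RayRotation.

(** * Laplace-Fourier integrals *)

Section DoubleIntegral.
Variable R : realType.
Local Notation C := R[i].
Local Notation mu := (@lebesgue_measure R).
Implicit Types (F G : R -> R -> C).

(** Beyond the threshold B one has r^(k-j) >= r >= |A| / c; below it the left side is at most |A|
    B^j, which is the constant K. *)
Lemma monomial_dominated (A c : R) (j k : nat) : 0 < c -> (j < k)%N ->
  exists2 K, 0 <= K & forall r, 0 <= r -> A * r ^+ j <= K + c * r ^+ k.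
Proof.
move=> c0 jk; pose B := Num.max 1 (`|A| / c).
have B1 : 1 <= B by rewrite /B le_max lexx.
have B0 : 0 <= B by lra.
exists (`|A| * B ^+ j) => [|r r0]; first by rewrite mulr_ge0// exprn_ge0.
apply: (@le_trans _ _ (`|A| * r ^+ j)).
  by rewrite ler_wpM2r ?exprn_ge0// ler_norm.
have [rB|Br] := leP r B.
  rewrite -[leLHS]addr0 lerD//; last by rewrite mulr_ge0 ?exprn_ge0// ltW.
  by rewrite ler_wpM2l// lerXn2r ?nnegrE.
rewrite -[leLHS]add0r lerD//; first by rewrite mulr_ge0// exprn_ge0.
have r1 : 1 <= r by lra.
rewrite -(subnKC jk) addSn exprS exprD [leRHS](_ : _ = (c * r * r ^+ (k - j.+1)) * r ^+ j); last by ring.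
rewrite ler_wpM2r ?exprn_ge0//.
have : `|A| <= c * r.
  rewrite mulrC -ler_pdivrMr//; apply: le_trans (ltW Br).
  by rewrite /B le_max lexx orbT.
move=> /le_trans; apply; rewrite ler_peMr ?mulr_ge0 ?(ltW c0)//.
by rewrite exprn_ege1.
Qed.

(** The class is stable under linear combinations and its bound has the product form required by
    [cfubini]. *)
Definition dominated F : Prop := cmeasurable2 F /\
  exists2 c : R, 0 < c & exists2 K : R, 0 <= K &
    forall r m, normc (F r m) <= K * expR (- (c * `|r|)) * expR (- (c * `|m|)).

Definition dint F : C := cint setT (fun m => cint setT (fun r => F r m)).

Lemma dominated_fubini F : dominated F ->
  [/\ (forall r, cintegrable setT (F r)),
      (forall m, cintegrable setT (F^~ m)),
      cintegrable setT (fun r => cint setT (F r)),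
      cintegrable setT (fun m => cint setT (F^~ m)) &
      cint setT (fun r => cint setT (F r)) = dint F].
Proof.
move=> [mF [c c0 [K K0 FK]]].
apply: (@cfubini R F (fun r => K * expR (- (c * `|r|))) (fun m => expR (- (c * `|m|)))) => //.
  exact: (integrableZl measurableT K (integrable_expN c0)).
exact: integrable_expN.
Qed.

Lemma dominatedD F G : dominated F -> dominated G -> dominated (fun r m => F r m + G r m).
Proof.
move=> [mF [c c0 [K K0 FK]]] [mG [d d0 [L L0 GL]]]; split; first exact: cmeasurableD.
exists (Num.min c d); first by rewrite lt_min c0.
exists (K + L) => [|r m]; first exact: addr_ge0.
have e1 x : expR (- (c * `|x|)) <= expR (- (Num.min c d * `|x|)).
  by rewrite ler_expR lerN2 ler_wpM2r// ge_min lexx.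
have e2 x : expR (- (d * `|x|)) <= expR (- (Num.min c d * `|x|)).
  by rewrite ler_expR lerN2 ler_wpM2r// ge_min lexx orbT.
rewrite (le_trans (normcD _ _))// !mulrDl lerD//.
  by rewrite (le_trans (FK _ _))// ler_pM ?mulr_ge0 ?expR_ge0// ler_wpM2l.
by rewrite (le_trans (GL _ _))// ler_pM ?mulr_ge0 ?expR_ge0// ler_wpM2l.
Qed.

Lemma dominatedZ F (k : C) : dominated F -> dominated (fun r m => k * F r m).
Proof.
move=> [mF [c c0 [K K0 FK]]]; split.
  by apply: cmeasurableM => //; exact: cmeasurable_cst.
exists c => //; exists (normc k * K) => [|r m]; first by rewrite mulr_ge0// normc_ge0.
by rewrite normcM -!mulrA ler_wpM2l ?normc_ge0// mulrA.
Qed.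

Lemma dominated_le F G (k : R) : cmeasurable2 F -> dominated G ->
  (forall r m, normc (F r m) <= k * normc (G r m)) -> dominated F.
Proof.
move=> mF [_ [c c0 [K K0 GK]]] FG; split=> //; exists c => //.
exists (`|k| * K) => [|r m]; first by rewrite mulr_ge0.
rewrite (le_trans (FG _ _))// (le_trans (ler_wpM2r (normc_ge0 _) (ler_norm _)))//.
by rewrite -!mulrA ler_wpM2l// mulrA.
Qed.

Lemma dintD F G : dominated F -> dominated G ->
  dint (fun r m => F r m + G r m) = dint F + dint G.
Proof.
move=> /dominated_fubini[_ F1 _ F2 _] /dominated_fubini[_ G1 _ G2 _].
rewrite /dint -cintD//; apply: eq_cint => m _.
by apply: cintD; [exact: measurableT|exact: F1|exact: G1].
Qed.

Lemma dintZ F (k : C) : dominated F -> dint (fun r m => k * F r m) = k * dint F.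
Proof.
move=> /dominated_fubini[_ F1 _ F2 _].
rewrite /dint -cintZ//; apply: eq_cint => m _.
by apply: cintZ; [exact: measurableT|exact: F1].
Qed.

Lemma eq_dint F G : (forall r m, F r m = G r m) -> dint F = dint G.
Proof. by move=> FG; apply: eq_cint => m _; apply: eq_cint => r _. Qed.

Definition expN_mass (c : R) : R := \int[mu]_x expR (- (c * `|x|)).

Lemma normc_dint F (K c : R) : 0 < c -> 0 <= K -> cmeasurable2 F ->
  (forall r m, normc (F r m) <= K * expR (- (c * `|r|)) * expR (- (c * `|m|))) ->
  normc (dint F) <= 4 * expN_mass c ^+ 2 * K.
Proof.
move=> c0 K0 mF FK.
have [_ F1 _ F2 _] : [/\ (forall r, cintegrable setT (F r)),
      (forall m, cintegrable setT (F^~ m)),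
      cintegrable setT (fun r => cint setT (F r)),
      cintegrable setT (fun m => cint setT (F^~ m)) &
      cint setT (fun r => cint setT (F r)) = dint F].
  by apply: dominated_fubini; split => //; exists c => //; exists K.
have ie k : mu.-integrable setT (EFin \o (fun r => k * expR (- (c * `|r|)))).
  exact: (integrableZl measurableT k (integrable_expN c0)).
have h m : normc (cint setT (F^~ m)) <= (2 * (K * expN_mass c)) * expR (- (c * `|m|)).
  have := @normc_cint_le R setT (F^~ m) (fun r => (K * expR (- (c * `|m|))) * expR (- (c * `|r|))).
  move=> /(_ measurableT (F1 m) (ie _)).
  rewrite RintegralZl//; last exact: integrable_expN.
  rewrite (_ : 2 * (K * expN_mass c) * _ = 2 * (K * expR (- (c * `|m|)) * expN_mass c)); last by ring.
  by apply => r _; rewrite mulrAC.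
have := @normc_cint_le R setT _ _ measurableT F2 (ie _) (fun m _ => h m).
rewrite RintegralZl//; last exact: integrable_expN.
move=> /le_trans; apply; rewrite -/(expN_mass c) le_eqVlt; apply/orP; left.
by apply/eqP; ring.
Qed.

End DoubleIntegral.

Section LaplaceFourier.
Variable R : realType.
Variables (k1 k2 kp : nat) (beta : R).
Hypothesis k12 : (0 < k1 < k2)%N.
Hypothesis kp2 : (1 < kp < k2)%N.
Local Notation C := R[i].
Implicit Types (G : R -> R -> C).

(** What remains of the integrand without the kernel: growth of order kp in r, and decay in m at
    every rate below [beta], with a rate N independent of b. Leaving out the rate [beta] itself
    makes the class stable under powers of m; vanishing for r <= 0 makes ray integrals integrals
    over the line. *)
Definition weight G : Prop := cmeasurable2 G /\
  exists2 N : R, 0 <= N & forall b, b < beta -> exists2 K : R, 0 <= K &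
    forall r m, normc (G r m) <= (if 0 < r then K * expR (N * r ^+ kp) * expR (- (b * `|m|)) else 0).

(** [a] and [b] stand for (e^{i xi}/T1)^k1 and (e^{i xi}/T2)^k2; in these coordinates the exponent
    is linear in (a, b, z). *)
Definition kernel_exponent (a b z : C) (r m : R) : C :=
  - (a * r%:C ^+ k1) - b * r%:C ^+ k2 + (0 +i* 1) * z * m%:C.

Definition laplace_fourier G (a b z : C) : C :=
  dint (fun r m => G r m * cexp (kernel_exponent a b z r m)).

(** A power of r is absorbed by exp(r^kp), at the cost of raising N by 1; for r <= 1 it is simply at
    most 1. *)
Lemma weight_rX G j : weight G -> weight (fun r m => r%:C ^+ j * G r m).
Proof.
move=> [m1 [N1 N10 h1]]; split.
  apply: cmeasurableM => //; apply: cmeasurableX; apply: cmeasurable2_l.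
  by apply: cmeasurable_real; exact: measurable_id.
exists (N1 + 1) => [|b bb]; first exact: addr_ge0.
have [K1 K10 {}h1] := h1 b bb.
have jk : (0 < j.+1 * kp)%N by rewrite muln_gt0/=; case/andP: kp2 => /ltnW.
exists (j.+1`!%:R * K1) => [|r m]; first by rewrite mulr_ge0.
rewrite normcM normcX normc_real; move: (h1 r m); case: ifP => r0 h; last by
  rewrite (le_trans (ler_wpM2l _ h)) ?mulr0// exprn_ge0.
rewrite gtr0_norm//.
have rj : r ^+ j <= j.+1`!%:R * expR (r ^+ kp).
  have rk0 : 0 <= r ^+ kp by rewrite exprn_ge0// ltW.
  have [r1|r1] := leP r 1.
    apply: (@le_trans _ _ 1); first by rewrite exprn_ile1// ltW.
    by rewrite -[leLHS]mulr1 ler_pM// ?ler1n ?fact_gt0// -[leLHS]expR0 ler_expR.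
  have rrk : r <= r ^+ kp by rewrite -[leLHS]expr1 ler_eXn2l//; case/andP: kp2 => /ltnW.
  apply: (@le_trans _ _ (r ^+ j.+1)); first by rewrite ler_eXn2l.
  apply: (@le_trans _ _ (j.+1`!%:R * expR r)); last first.
    by rewrite ler_wpM2l// ler_expR.
  have h2 := @expR_ge1Dxn R r j (ltW r0).
  rewrite mulrC -ler_pdivrMr ?ltr0n ?fact_gt0//; move: (_ / _) h2 => w; lra.
rewrite mulrDl mul1r expRD.
rewrite [leRHS](_ : _ = (j.+1`!%:R * expR (r ^+ kp)) * (K1 * expR (N1 * r ^+ kp) * expR (- (b * `|m|)))); last by ring.
by rewrite ler_pM ?exprn_ge0 ?normc_ge0// ltW.
Qed.

(** A power of m is absorbed by exp(d |m|), where d is half of the gap between b and [beta]. *)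
Lemma weight_mX G j : weight G -> weight (fun r m => m%:C ^+ j * G r m).
Proof.
move=> [m1 [N1 N10 h1]]; split.
  apply: cmeasurableM => //; apply: cmeasurableX; apply: cmeasurable2_r.
  by apply: cmeasurable_real; exact: measurable_id.
exists N1 => // b bb; pose d := (beta - b) / 2.
have d0 : 0 < d by rewrite /d; lra.
have [K1 K10 {}h1] := h1 (b + d) ltac:(rewrite /d; lra).
exists (j.+1`!%:R * d^-1 ^+ j * expR 1 * K1) => [|r m].
  by rewrite !mulr_ge0// ?expR_ge0// exprn_ge0// invr_ge0 ltW.
rewrite normcM normcX normc_real; move: (h1 r m); case: ifP => r0 h; last by
  rewrite (le_trans (ler_wpM2l _ h)) ?mulr0// exprn_ge0.
have mj : `|m| ^+ j <= j.+1`!%:R * d^-1 ^+ j * expR 1 * expR (d * `|m|).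
  have -> : `|m| ^+ j = d^-1 ^+ j * (d * `|m|) ^+ j.
    by rewrite -exprMn mulKf// gt_eqF.
  rewrite -[leRHS]mulrA -[leRHS]mulrA mulrCA ler_wpM2l ?exprn_ge0 ?invr_ge0 ?(ltW d0)//.
  move: (d * `|m|) (mulr_ge0 (ltW d0) (normr_ge0 m)) => x x0.
  rewrite mulrA -mulrA -expRD.
  apply: (@le_trans _ _ ((1 + x) ^+ j.+1)).
    apply: (@le_trans _ _ ((1 + x) ^+ j)); first by rewrite lerXn2r ?nnegrE; lra.
    by rewrite ler_weXn2l//; lra.
  have h2 := @expR_ge1Dxn R (1 + x) j ltac:(lra).
  rewrite mulrC -ler_pdivrMr ?ltr0n ?fact_gt0//; move: (_ / _) h2 => w; lra.
have -> : expR (- (b * `|m|)) = expR (d * `|m|) * expR (- ((b + d) * `|m|)).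
  by rewrite -expRD; congr expR; ring.
rewrite [leRHS](_ : _ = (j.+1`!%:R * d^-1 ^+ j * expR 1 * expR (d * `|m|)) *
  (K1 * expR (N1 * r ^+ kp) * expR (- ((b + d) * `|m|)))); last by ring.
by rewrite ler_pM ?exprn_ge0 ?normc_ge0.
Qed.

Lemma cmeasurable_kernel a b z : cmeasurable2 (fun r m => kernel_exponent a b z r m).
Proof.
have mr : cmeasurable2 (fun r _ : R => r%:C).
  by apply: cmeasurable2_l; apply: cmeasurable_real; exact: measurable_id.
have mm : cmeasurable2 (fun _ m : R => m%:C).
  by apply: cmeasurable2_r; apply: cmeasurable_real; exact: measurable_id.
have mc (c : C) : cmeasurable2 (fun _ _ : R => c) by exact: cmeasurable_cst.
have -> : (fun r m => kernel_exponent a b z r m) =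
   (fun r m => (- a) * r%:C ^+ k1 + (- b) * r%:C ^+ k2 + (0 +i* 1) * z * m%:C).
  by apply/funext => r; apply/funext => m; rewrite /kernel_exponent !mulNr.
apply: cmeasurableD; last by apply: cmeasurableM => //; exact: mc.
by apply: cmeasurableD; apply: cmeasurableM => //; (try exact: mc);
  exact: cmeasurableX.
Qed.

(* The factor [expR (e * _)] is the room left for perturbations of (a, b, z). *)
Lemma weight_kernel_bound G (A cb eta : R) : weight G -> 0 < cb -> eta < beta ->
  exists2 c : R, 0 < c & exists2 e : R, 0 < e & exists2 K : R, 0 <= K &
  forall a b z r m, normc a <= A -> cb <= Re b -> `|Im z| <= eta ->
    normc (G r m * cexp (kernel_exponent a b z r m)) *
      expR (e * (`|r| ^+ k1 + `|r| ^+ k2 + `|m|)) <=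
    K * expR (- (c * `|r|)) * expR (- (c * `|m|)).
Proof.
move=> [_ [N N0 hG]] cb0 etab.
have [d [d0 d3]] : exists d : R, 0 < d /\ eta + 3 * d < beta.
  by exists ((beta - eta) / 4); split; lra.
have [K K0 hK] := hG (eta + 3 * d) d3.
(* One quarter of cb r^k2 absorbs each of the growth N r^kp, the terms in r^k1, the decay d r and
   the perturbation e r^k2. Of the three shares d in the decay in m, one is the final rate and one
   covers e |m|. *)
have cb4 : 0 < cb / 4 by rewrite divr_gt0.
pose e := Num.min d (cb / 4).
have e0 : 0 < e by rewrite lt_min d0 cb4.
have k21 : (1 < k2)%N by case/andP: kp2 => ? /(ltn_trans _); apply.
have [L1 L10 hL1] := @monomial_dominated R N (cb / 4) kp k2 cb4 (andP kp2).2.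
have [L2 L20 hL2] := @monomial_dominated R (A + e) (cb / 4) k1 k2 cb4 (andP k12).2.
have [L3 L30 hL3] := @monomial_dominated R d (cb / 4) 1 k2 cb4 k21.
exists d => //; exists e => //; exists (K * expR (L1 + L2 + L3)) => [|a b z r m aA bcb zeta].
  by rewrite mulr_ge0// expR_ge0.
rewrite normcM normc_cexp; move: (hK r m); case: ifP => r0 h; last first.
  have -> : normc (G r m) = 0 by apply/eqP; rewrite eq_le h normc_ge0.
  by rewrite !mul0r !mulr_ge0// expR_ge0.
rewrite gtr0_norm//.
have Rk : Re (kernel_exponent a b z r m) <= A * r ^+ k1 - cb * r ^+ k2 + eta * `|m|.
  rewrite /kernel_exponent !cReD !cReN -!rmorphXn/= 2!(mulrC _ (_ ^+ _)%:C) !complexRe_real.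
  have -> : Re ((0 +i* 1) * z * m%:C) = - (m * Im z).
    rewrite mulrC complexRe_real; case: (z) => x y /=; ring.
  have r1 : 0 <= r ^+ k1 by rewrite exprn_ge0// ltW.
  have r2 : 0 <= r ^+ k2 by rewrite exprn_ge0// ltW.
  rewrite lerD// ?lerD//.
  - rewrite -mulrN mulrC ler_wpM2r//; apply: le_trans aA.
    by rewrite (le_trans _ (normc_ge_absRe _))// -normrN ler_norm.
  - by rewrite lerN2 mulrC ler_wpM2l.
  - rewrite -mulrN (le_trans (ler_norm _))// normrM normrN mulrC ler_wpM2r//.
rewrite (le_trans (ler_wpM2r _ (ler_wpM2r _ h))) ?expR_ge0//.
rewrite -!mulrA ler_wpM2l// -!expRD ler_expR.
have := hL1 r (ltW r0); have := hL2 r (ltW r0); have := hL3 r (ltW r0).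
rewrite expr1 mulrDl => g1 g2 g3.
have g4 : e * r ^+ k2 <= cb / 4 * r ^+ k2.
  by rewrite ler_wpM2r ?exprn_ge0 ?(ltW r0)// /e ge_min lexx orbT.
have g5 : e * `|m| <= d * `|m| by rewrite ler_wpM2r// /e ge_min lexx.
rewrite !mulrDr; rewrite mulrDl.
move: Rk g1 g2 g3 g4 g5.
have -> : cb * r ^+ k2 = 4 * (cb / 4 * r ^+ k2) by field.
have -> : 3 * d * `|m| = 3 * (d * `|m|) by rewrite mulrA.
have : 0 <= d * `|m| by rewrite mulr_ge0// ltW.
move: (Re _) (e * r ^+ k1) (e * r ^+ k2) (e * `|m|) (d * `|m|) (cb / 4 * r ^+ k2)
  (A * r ^+ k1) (eta * `|m|) (N * r ^+ kp) (d * r) => x1 x2 x3 x4 x5 x6 x7 x8 x9 x10.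
by move=> *; lra.
Qed.

Lemma weight_dominated G a b z : weight G -> 0 < Re b -> `|Im z| < beta ->
  dominated (fun r m => G r m * cexp (kernel_exponent a b z r m)).
Proof.
move=> wG b0 zb; split.
  apply: cmeasurableM; first by case: wG.
  exact: (cmeasurable_cexp measurableT (cmeasurable_kernel _ _ _)).
have [c c0 [e e0 [K K0 hK]]] := weight_kernel_bound (normc a) wG b0 zb.
exists c => //; exists K => // r m.
rewrite -[leLHS]mulr1; apply: le_trans (hK a b z r m _ _ _) => //.
rewrite ler_wpM2l ?normc_ge0// -[leLHS]expR0 ler_expR mulr_ge0 ?(ltW e0)//.
Qed.

Lemma laplace_fourierD G1 G2 a b z : weight G1 -> weight G2 -> 0 < Re b -> `|Im z| < beta ->
  laplace_fourier (fun r m => G1 r m + G2 r m) a b z =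
  laplace_fourier G1 a b z + laplace_fourier G2 a b z.
Proof.
move=> w1 w2 b0 zb; rewrite /laplace_fourier.
rewrite -(dintD (weight_dominated a w1 b0 zb) (weight_dominated a w2 b0 zb)).
by apply: eq_dint => r m; rewrite mulrDl.
Qed.

Lemma laplace_fourierZ G (k : C) a b z : weight G -> 0 < Re b -> `|Im z| < beta ->
  laplace_fourier (fun r m => k * G r m) a b z = k * laplace_fourier G a b z.
Proof.
move=> w1 b0 zb; rewrite /laplace_fourier -(dintZ k (weight_dominated a w1 b0 zb)).
by apply: eq_dint => r m; rewrite mulrA.
Qed.

(** By linearity of the exponent the left side is the integral of G times the kernel times exp H - 1
    - H, with H the exponent of the increments. The quadratic bound on this factor and the room left
    by [weight_kernel_bound] give O(s^2), for all three variables together. *)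
Lemma laplace_fourier_quadratic G a b z : weight G -> 0 < Re b -> `|Im z| < beta ->
  exists2 e : R, 0 < e & exists K : R, forall (ha hb hz : C) (s : R),
    s < e -> normc ha <= s -> normc hb <= s -> normc hz <= s ->
    normc (laplace_fourier G (a + ha) (b + hb) (z + hz) - laplace_fourier G a b z
      - ha * - laplace_fourier (fun r m => r%:C ^+ k1 * G r m) a b z
      - hb * - laplace_fourier (fun r m => r%:C ^+ k2 * G r m) a b z
      - hz * ((0 +i* 1) * laplace_fourier (fun r m => m%:C ^+ 1 * G r m) a b z))
    <= K * s ^+ 2.
Proof.
move=> wG b0 zb.
have [c c0 [e e0 [K K0 hK]]] := weight_kernel_bound (normc a) wG b0 zb.
(* exp(e T) is split into three factors exp(e T / 3): one bounds exp |H|, one absorbs T^2, one is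
   spare. The other two terms of the minimum keep b + hb in the right half-plane and z + hz in the
   strip. *)
pose e1 := Num.min (e / 3) (Num.min (Re b) (beta - `|Im z|)).
have e3 : 0 < e / 3 by rewrite divr_gt0.
exists e1; first by rewrite !lt_min e3 b0 subr_gt0 zb.
pose K2 := 4 * (2 / (e / 3) ^+ 2) * K.
exists (4 * expN_mass c ^+ 2 * K2) => ha hb hz s.
rewrite !lt_min => /andP[s1 /andP[s2 s3]] has hbs hzs.
have s0 : 0 <= s by rewrite (le_trans (normc_ge0 _) has).
have bD : 0 < Re (b + hb).
  rewrite cReD; have := le_trans (normc_ge_absRe _) hbs.
  rewrite ler_norml => /andP[h _]; lra.
have zD : `|Im (z + hz)| < beta.
  rewrite cImD (le_lt_trans (ler_normD _ _))//; have := le_trans (normc_ge_absIm _) hzs; lra.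
have d0 := weight_dominated (a + ha) wG bD zD.
have d1 := weight_dominated a wG b0 zb.
have d2 := weight_dominated a (weight_rX k1 wG) b0 zb.
have d3 := weight_dominated a (weight_rX k2 wG) b0 zb.
have d4 := weight_dominated a (weight_mX 1 wG) b0 zb.
pose H r m := kernel_exponent ha hb hz r m.
pose F r m := G r m * cexp (kernel_exponent a b z r m) * (cexp (H r m) - 1 - H r m).
have EF r m : F r m = G r m * cexp (kernel_exponent (a + ha) (b + hb) (z + hz) r m)
    + (-1) * (G r m * cexp (kernel_exponent a b z r m))
    + ha * (r%:C ^+ k1 * G r m * cexp (kernel_exponent a b z r m))
    + hb * (r%:C ^+ k2 * G r m * cexp (kernel_exponent a b z r m))
    + (- hz * (0 +i* 1)) * (m%:C ^+ 1 * G r m * cexp (kernel_exponent a b z r m)).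
  rewrite /F (_ : kernel_exponent (a + ha) _ _ _ _ = kernel_exponent a b z r m + H r m); last first.
    by rewrite /H /kernel_exponent; ring.
  rewrite cexpD {2}/H /kernel_exponent; ring.
have -> : laplace_fourier G (a + ha) (b + hb) (z + hz) - laplace_fourier G a b z
      - ha * - laplace_fourier (fun r m => r%:C ^+ k1 * G r m) a b z
      - hb * - laplace_fourier (fun r m => r%:C ^+ k2 * G r m) a b z
      - hz * ((0 +i* 1) * laplace_fourier (fun r m => m%:C ^+ 1 * G r m) a b z) = dint F.
  set A0 := laplace_fourier G (a + ha) _ _; set A1 := laplace_fourier G a _ _.
  set A2 := laplace_fourier _ a b z; set A3 := laplace_fourier _ a b z.
  set A4 := laplace_fourier _ a b z.
  transitivity (A0 + (-1) * A1 + ha * A2 + hb * A3 + (- hz * (0 +i* 1)) * A4).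
    by move: A0 A1 A2 A3 A4 => x0 x1 x2 x3 x4; ring.
  rewrite (eq_dint EF).
  have z1 := dominatedZ (-1) d1; have z2 := dominatedZ ha d2.
  have z3 := dominatedZ hb d3; have z4 := dominatedZ (- hz * (0 +i* 1)) d4.
  have p1 := dominatedD d0 z1; have p2 := dominatedD p1 z2; have p3 := dominatedD p2 z3.
  rewrite (dintD p3 z4) (dintD p2 z3) (dintD p1 z2) (dintD d0 z1).
  by rewrite (dintZ (-1) d1) (dintZ ha d2) (dintZ hb d3) (dintZ (- hz * (0 +i* 1)) d4).
have mF : cmeasurable2 F.
  apply: cmeasurableM; first by case: d1.
  have mH := cmeasurable_kernel ha hb hz.
  have mc (k : C) : cmeasurable2 (fun _ _ : R => k) by exact: cmeasurable_cst.
  have -> : (fun p : R * R => cexp (H p.1 p.2) - 1 - H p.1 p.2) =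
    (fun p => cexp (H p.1 p.2) + (-1) + (-1) * H p.1 p.2).
    by apply/funext => p; rewrite mulN1r.
  apply: cmeasurableD; last by apply: cmeasurableM => //; exact: mc.
  by apply: cmeasurableD; [exact: cmeasurable_cexp|exact: mc].
have K20 : 0 <= K2 by rewrite !mulr_ge0// invr_ge0 sqr_ge0.
rewrite -mulrA; apply: (normc_dint c0) => //; first by rewrite mulr_ge0// sqr_ge0.
move=> r m; rewrite /F normcM.
pose T := `|r| ^+ k1 + `|r| ^+ k2 + `|m|.
have T0 : 0 <= T by rewrite !addr_ge0// exprn_ge0.
have HT : normc (H r m) <= s * T.
  rewrite /H /kernel_exponent (le_trans (normcD _ _))// /T mulrDr lerD//; last first.
    by rewrite !normcM normc_i mul1r normc_real ler_wpM2r.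
  rewrite (le_trans (normcB _ _))// mulrDr normcN !normcM !normcX !normc_real.
  by rewrite lerD// ler_wpM2r// exprn_ge0.
have hexp : normc (cexp (H r m) - 1 - H r m) <= (4 * (2 / (e / 3) ^+ 2)) * s ^+ 2 * expR (e * T).
  rewrite (le_trans (cexp_sub1x_le _))//.
  apply: (@le_trans _ _ (4 * (s * T) ^+ 2 * expR (e / 3 * T))).
    apply: ler_pM; [by rewrite mulr_ge0// sqr_ge0|exact: expR_ge0| |].
      by rewrite ler_wpM2l// lerXn2r ?nnegrE ?normc_ge0 ?mulr_ge0.
    by rewrite ler_expR (le_trans HT)// ler_wpM2r// ltW.
  have hT : T ^+ 2 <= 2 / (e / 3) ^+ 2 * expR (e / 3 * T).
    have := @expR_ge1Dxn R (e / 3 * T) 1 (mulr_ge0 (ltW e3) T0).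
    rewrite exprMn (_ : 2`!%:R = 2) // => h.
    rewrite mulrAC ler_pdivlMr ?exprn_gt0//.
    move: h; rewrite mulrC; move: (T ^+ 2) ((e / 3) ^+ 2) => u v; lra.
  have -> : expR (e * T) = expR (e / 3 * T) * expR (e / 3 * T) * expR (e / 3 * T).
    by rewrite -!expRD; congr expR; field.
  move: (expR (e / 3 * T)) (expR_ge0 (e / 3 * T)) hT (expR_ge1Dx (e / 3 * T)) => w w0 hT hw.
  have w1 : 1 <= w by rewrite (le_trans _ hw)// lerDl mulr_ge0// ltW.
  rewrite exprMn.
  apply: (@le_trans _ _ (4 * (s ^+ 2 * (2 / (e / 3) ^+ 2 * w)) * w)).
    by rewrite ler_wpM2r// ler_wpM2l// ler_wpM2l// sqr_ge0.
  rewrite [leRHS](_ : _ = (4 * (s ^+ 2 * (2 / (e / 3) ^+ 2 * w)) * w) * w); last by ring.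
  by rewrite ler_peMr// !mulr_ge0// ?sqr_ge0// invr_ge0 sqr_ge0.
have h1 := hK a b z r m (lexx _) (lexx _) (lexx _).
apply: le_trans (ler_wpM2l (normc_ge0 _) hexp) _.
rewrite /K2 [leRHS](_ : _ = 4 * (2 / (e / 3) ^+ 2) * s ^+ 2 *
  (K * expR (- (c * `|r|)) * expR (- (c * `|m|)))); last by ring.
rewrite mulrCA ler_wpM2l// ?mulr_ge0 ?sqr_ge0// ?invr_ge0 ?sqr_ge0//.
Qed.

End LaplaceFourier.

(** * Sectors and directions *)

Section Sectors.
Variable R : realType.
Local Notation C := R[i].

(** Near 1 the argument is the arcsine of Im v / |v|, which is continuous at 0; the real part stays
    above 1/2, which fixes the sign of the cosine. *)
Lemma near_one_arg (eta : R) : 0 < eta -> exists2 d : R, 0 < d &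
  forall v : C, normc (v - 1) < d ->
    v != 0 /\ exists2 s : R, `|s| < eta & v = (normc v)%:C * expi s.
Proof.
move=> eta0.
have /cvgrPdist_lt/(_ _ eta0)/nbhs_ballP[e /= e0 he] := @continuous_asin R 0
  ltac:(apply/andP; split; lra).
pose d := Num.min (2^-1) (e / 2); exists d.
  by rewrite lt_min invr_gt0 divr_gt0//= ltr0n.
move=> v; rewrite lt_min => /andP[v1 v2].
have vR : 2^-1 < Re v.
  have := le_lt_trans (normc_ge_absRe _) v1; rewrite cReD cReN /=.
  rewrite ltr_norml => /andP[h _]; lra.
have nR : Re v <= normc v by rewrite (le_trans _ (normc_ge_absRe _))// ler_norm.
have n0 : 0 < normc v by lra.
split; first by rewrite -normc_gt0.
pose y := Im v / normc v.
have y1 : -1 <= y <= 1.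
  by rewrite -ler_norml normrM normfV (gtr0_norm n0) ler_pdivrMr// mul1r normc_ge_absIm.
have ye : `|y| < e.
  rewrite normrM normfV (gtr0_norm n0) ltr_pdivrMr//.
  have := le_lt_trans (normc_ge_absIm _) v2; rewrite cImD cImN /= subr0 => h.
  rewrite (lt_trans h)// ltr_pM2l//; lra.
exists (asin y).
  have := he y; rewrite /ball/= sub0r normrN => /(_ ye).
  by rewrite (_ : asin 0 = 0) ?sub0r ?normrN// -[X in asin X]sin0 sinK// in_itv/=;
    have := @pi_gt0 R; lra.
apply: complex_ext; rewrite ?complexRe_real ?complexIm_real/=.
  rewrite cos_asin//.
  have -> : 1 - y ^+ 2 = (Re v / normc v) ^+ 2.
    rewrite !expr_div_n -[1](@divff _ (normc v ^+ 2)) ?expf_neq0 ?gt_eqF//.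
    by rewrite -mulrBl -ReIm_normc addrK.
  have vn : 0 <= Re v / normc v by rewrite divr_ge0 ?normc_ge0//; lra.
  rewrite sqrtr_sqr ger0_norm//.
  by rewrite mulrC divfK// gt_eqF.
have -> : sin (asin y) = y by apply: asinK; rewrite in_itv.
by rewrite mulrC divfK// gt_eqF.
Qed.

Lemma near_arg (T : C) (a eta : R) : T = (normc T)%:C * expi a -> T != 0 -> 0 < eta ->
  \forall T' \near T, T' != 0 /\ exists2 s : R, `|s| < eta & T' = (normc T')%:C * expi (a + s).
Proof.
move=> Ta T0 eta0; have [d d0 hd] := near_one_arg eta0.
have nT : 0 < normc T by rewrite normc_gt0.
apply/nbhs_normcP; exists (d * normc T); first exact: mulr_gt0.
move=> T' TT'.
have /hd[v0 [s s1 s2]] : normc (T' / T - 1) < d.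
  have -> : T' / T - 1 = (T' - T) / T by rewrite mulrBl divff.
  by rewrite normcM normcV ltr_pdivrMr.
have E : T' = T' / T * T by rewrite divfK.
split; first by rewrite E mulf_neq0.
exists s => //.
rewrite {1}E {1}s2 {2}Ta normcM normcV expiD.
have n0 : (normc T)%:C != 0 :> C by rewrite -normc_gt0 normc_real normr_gt0 gt_eqF.
rewrite rmorphM/= fmorphV/=.
by field.
Qed.

Lemma sector_open (a b : R) : open (@sector R a b).
Proof.
rewrite openE => z [r [t [r0 at_ tb zE]]]; rewrite /interior.
have nz : normc z = r by rewrite zE normcM normc_expi mulr1 normc_real gtr0_norm.
have z0 : z != 0 by rewrite -normc_gt0 nz.
have e0 : 0 < Num.min (t - a) (b - t) by rewrite lt_min !subr_gt0 at_ tb.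
have zE' : z = (normc z)%:C * expi t by rewrite nz.
have := near_arg zE' z0 e0; apply: filterS => T' [T0 [s]].
rewrite lt_min => /andP[/ltr_normlP[s1 s2] /ltr_normlP[s3 s4]] TE.
by exists (normc T'), (t + s); rewrite normc_gt0; split => //; lra.
Qed.

Lemma disc_open (r : R) : open (@disc R r).
Proof.
rewrite /disc (_ : [set z | _] = (fun z : C => normc z) @^-1` [set x | x < r])//.
by apply: open_comp => [z _|]; [exact: continuous_normc|exact: open_lt].
Qed.

Lemma strip_open (b : R) : open (@strip R b).
Proof.
rewrite /strip (_ : [set z | _] = (fun z : C => `|Im z|) @^-1` [set x | x < b])//.
apply: open_comp => [z _|]; last exact: open_lt.
by apply: (continuous_compC (f := fun x : R => `|x|) (g := fun z : C => Im z));
  [exact: continuous_Im|exact: norm_continuous].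
Qed.

Lemma sector_cone (a b r : R) (t : R) : 0 < r -> @sector R a b (expi t) ->
  sector a b (r%:C * expi t).
Proof.
move=> r0 [s [t' [s0 h1 h2 E]]]; exists (r * s), t'; split => //; first exact: mulr_gt0.
by rewrite E rmorphM/= mulrA.
Qed.

Lemma sector_expi (a b t : R) : a < t < b -> @sector R a b (expi t).
Proof. by move=> /andP[at_ tb]; exists 1, t; rewrite mul1r; split. Qed.

Lemma sector_expiP (a b t : R) : @sector R a b (expi t) ->
  exists n : int, a < t + n%:~R * (2 * pi) < b.
Proof.
move=> [s [t' [s0 h1 h2 E]]].
have E' : s%:C * expi t' = 1%:C * expi t by rewrite -E mul1r.
have [_ [n hn]] := polar_inj s0 ltr01 E'.
by exists n; rewrite -hn h1 h2.
Qed.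

Lemma good_directionW (delta : R) k (xi : R) (T : C) : 0 <= delta ->
  good_direction delta k xi T -> good_direction 0 k xi T.
Proof.
move=> d0 [T0 [a [E h1 h2]]]; split => //; exists a; split => //; rewrite ?addr0 ?subr0; lra.
Qed.

Lemma good_direction_near k (xi : R) (T : C) : good_direction 0 k xi T ->
  \forall T' \near T, good_direction 0 k xi T'.
Proof.
move=> [T0 [a [E]]]; rewrite addr0 subr0 => h1 h2.
pose y := k%:R * xi - k%:R * a.
(* The slack to the nearer end of the interval, divided by k + 1 rather than by k, as k may be 0. *)
pose e := Num.min (y + pi / 2) (pi / 2 - y) / (k%:R + 1).
have k0 : 0 < k%:R + 1 :> R by rewrite ltr_wpDl.
have e0 : 0 < e by rewrite divr_gt0// lt_min /y; apply/andP; split; lra.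
have := near_arg E T0 e0; apply: filterS => T' [T'0 [s hs TE]]; split => //.
exists (a + s); split => //; rewrite ?addr0 ?subr0;
  have : `|k%:R * s| < Num.min (y + pi / 2) (pi / 2 - y).
- rewrite normrM normr_nat (@le_lt_trans _ _ ((k%:R + 1) * `|s|))//; first by rewrite ler_wpM2r//; lra.
  by rewrite mulrC -ltr_pdivlMr.
- by rewrite lt_min => /andP[/ltr_normlP[s1 s2] /ltr_normlP[s3 s4]]; rewrite /y in s1 s2 s3 s4; lra.
- rewrite normrM normr_nat (@le_lt_trans _ _ ((k%:R + 1) * `|s|))//; first by rewrite ler_wpM2r//; lra.
  by rewrite mulrC -ltr_pdivlMr.
by rewrite lt_min => /andP[/ltr_normlP[s1 s2] /ltr_normlP[s3 s4]]; rewrite /y in s1 s2 s3 s4; lra.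
Qed.

(* Both directions lie in a single arc of length [pi / k] centred at a common
   argument of [T]; the bound on the aperture of the sector keeps that arc,
   cut by the sector, connected. *)
Lemma good_directions_connected (k : nat) (a1 a2 xi xi' : R) (T : C) : (0 < k)%N ->
  a2 - a1 <= 2 * pi - pi / k%:R ->
  sector a1 a2 (expi xi) -> sector a1 a2 (expi xi') ->
  good_direction 0 k xi T -> good_direction 0 k xi' T ->
  exists t t' c : R, [/\ expi t = expi xi :> C, expi t' = expi xi' :> C, T = (normc T)%:C * expi c &
    [/\ a1 < t < a2, a1 < t' < a2, `|k%:R * (t - c)| < pi / 2 & `|k%:R * (t' - c)| < pi / 2]].
Proof.
move=> k0 a21 /sector_expiP[n1 hn1] /sector_expiP[n2 hn2] [T0 [b [E]]].
rewrite addr0 subr0 => h1 h2 [_ [b' [E']]]; rewrite addr0 subr0 => h3 h4.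
have nT : 0 < normc T by rewrite normc_gt0.
have [|_ [n bb]] := @polar_inj R (normc T) (normc T) b b' nT nT.
  by rewrite -E -E'.
have kR : 0 < k%:R :> R by rewrite ltr0n.
exists (xi + n1%:~R * (2 * pi)), (xi' + n2%:~R * (2 * pi)), (b + n1%:~R * (2 * pi)).
have p0 := @pi_gt0 R.
have y1 : `|k%:R * (xi - b)| < pi / 2 by rewrite ltr_norml mulrBr; apply/andP; split; lra.
have y2 : `|k%:R * (xi' - b')| < pi / 2 by rewrite ltr_norml mulrBr; apply/andP; split; lra.
(* Both directions, lifted to ]a1, a2[, belong to the same determination of arg T: a mismatch would
   be a nonzero multiple of 2 pi, but it is less than the aperture 2 pi - pi / k plus two half-arcs
   pi / (2 k). *)
have nE : n2 = n1 + n.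
  pose N : int := n1 + n - n2.
  suff : `|N%:~R * (2 * pi)| < 2 * pi :> R.
    rewrite normrM (gtr0_norm (mulr_gt0 _ p0))// -ltr_pdivlMr ?mulr_gt0// divff ?mulf_neq0 ?gt_eqF//.
    rewrite -intr_norm ltrz1 => hN; apply/eqP; rewrite eq_sym -subr_eq0 -/N -normr_eq0.
    by move: hN; case: (`|N|%R) (normr_ge0 N) => [[|m]|m].
  have z1 : `|xi - b| < pi / k%:R / 2.
    by move: y1; rewrite normrM normr_nat mulrC -ltr_pdivlMr// mulrAC.
  have z2 : `|xi' - b'| < pi / k%:R / 2.
    by move: y2; rewrite normrM normr_nat mulrC -ltr_pdivlMr// mulrAC.
  have -> : N%:~R * (2 * pi) = n1%:~R * (2 * pi) + n%:~R * (2 * pi) - n2%:~R * (2 * pi) :> R.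
    by rewrite /N rmorphB rmorphD/=; ring.
  rewrite ltr_norml; move: z1 z2 => /ltr_normlP[z1 z2] /ltr_normlP[z3 z4].
  move: a21; move: (pi / k%:R) z1 z2 z3 z4 => w z1 z2 z3 z4 a21.
  move/andP: hn1 => [q1 q2]; move/andP: hn2 => [q3 q4].
  move: (n1%:~R * (2 * pi)) (n2%:~R * (2 * pi)) (n%:~R * (2 * pi)) bb q1 q2 q3 q4 => x1 x2 x3 bb q1 q2 q3 q4.
  apply/andP; split; lra.
split.
- by rewrite expiD expi2piz mulr1.
- by rewrite expiD expi2piz mulr1.
- by rewrite expiD expi2piz mulr1.
split => //.
  by rewrite (_ : _ - _ = xi - b) //; ring.
by rewrite (_ : _ - _ = xi' - b')// bb nE rmorphD/=; ring.
Qed.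

Lemma cos_lower (y Y : R) : `|y| <= Y -> Y < pi / 2 -> cos Y <= cos y.
Proof.
move=> yY Y2; have p0 := @pi_gt0 R.
have y0 := normr_ge0 y.
have m1 : `|y| \in `[0, pi] by rewrite in_itv/=; apply/andP; split; lra.
have m2 : Y \in `[0, pi] by rewrite in_itv/=; apply/andP; split; lra.
by rewrite -(cos_norm y) leNgt ltr_cos// -leNgt.
Qed.

End Sectors.

(** * Partial derivatives and joint differentiability of Laplace-Fourier integrals *)

Section LaplaceFourierDerivatives.
Variable R : realType.
Variables (k1 k2 kp : nat) (beta : R).
Hypothesis k12 : (0 < k1 < k2)%N.
Hypothesis kp2 : (1 < kp < k2)%N.
Local Notation C := R[i].
Implicit Types (G : R -> R -> C) (a b z : C).
Local Notation weight := (weight kp beta).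
Local Notation laplace_fourier := (laplace_fourier k1 k2).

(** The remainder estimate with its three coefficients made opaque; partial derivatives are read off
    by letting one increment be nonzero. *)
Lemma laplace_fourier_expansion G a b z : weight G -> 0 < Re b -> `|Im z| < beta ->
  exists A B D : C, [/\
    A = - laplace_fourier (fun r m => r%:C ^+ k1 * G r m) a b z,
    B = - laplace_fourier (fun r m => r%:C ^+ k2 * G r m) a b z,
    D = (0 +i* 1) * laplace_fourier (fun r m => m%:C ^+ 1 * G r m) a b z &
    exists2 e : R, 0 < e & exists K : R, forall (ha hb hz : C) (s : R),
    s < e -> normc ha <= s -> normc hb <= s -> normc hz <= s ->
    normc (laplace_fourier G (a + ha) (b + hb) (z + hz) - laplace_fourier G a b z
      - ha * A - hb * B - hz * D) <= K * s ^+ 2].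
Proof.
move=> wG b0 zb; do 3 eexists; split; [by []|by []|by []|].
exact: (laplace_fourier_quadratic k12 kp2 a wG b0 zb).
Qed.

Lemma laplace_fourier_is_derive1 G a b z : weight G -> 0 < Re b -> `|Im z| < beta ->
  is_derive a 1 (fun a => laplace_fourier G a b z)
    (- laplace_fourier (fun r m => r%:C ^+ k1 * G r m) a b z).
Proof.
move=> wG b0 zb; have [A [B [D [E1 _ _ [e e0 [K hK]]]]]] := laplace_fourier_expansion a wG b0 zb.
rewrite -E1; apply: (quadratic_is_derive (K := K) e0) => h he.
have := hK h 0 0 (normc h) he (lexx _); rewrite !normc0 !normc_ge0 => /(_ isT isT).
by rewrite !addr0 !mul0r !subr0.
Qed.

Lemma laplace_fourier_is_derive2 G a b z : weight G -> 0 < Re b -> `|Im z| < beta ->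
  is_derive b 1 (fun b => laplace_fourier G a b z)
    (- laplace_fourier (fun r m => r%:C ^+ k2 * G r m) a b z).
Proof.
move=> wG b0 zb; have [A [B [D [_ E1 _ [e e0 [K hK]]]]]] := laplace_fourier_expansion a wG b0 zb.
rewrite -E1; apply: (quadratic_is_derive (K := K) e0) => h he.
have := hK 0 h 0 (normc h) he; rewrite !normc0 !normc_ge0 lexx => /(_ isT isT isT).
by rewrite !addr0 !mul0r !subr0.
Qed.

Lemma laplace_fourier_is_derive3 G a b z : weight G -> 0 < Re b -> `|Im z| < beta ->
  is_derive z 1 (fun z => laplace_fourier G a b z)
    ((0 +i* 1) * laplace_fourier (fun r m => m%:C ^+ 1 * G r m) a b z).
Proof.
move=> wG b0 zb; have [A [B [D [_ _ E1 [e e0 [K hK]]]]]] := laplace_fourier_expansion a wG b0 zb.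
rewrite -E1; apply: (quadratic_is_derive (K := K) e0) => h he.
have := hK 0 0 h (normc h) he; rewrite !normc0 !normc_ge0 lexx => /(_ isT isT isT).
by rewrite !addr0 !mul0r !subr0.
Qed.

Lemma differentiable_fst (V W : normedModType C) (x : V * W) : differentiable (@fst V W) x.
Proof. by apply: (@linear_differentiable C (V * W)%type V fst) => y; exact: cvg_fst. Qed.

Lemma differentiable_snd (V W : normedModType C) (x : V * W) : differentiable (@snd V W) x.
Proof. by apply: (@linear_differentiable C (V * W)%type W snd) => y; exact: cvg_snd. Qed.

Lemma prod_norm_normc (h1 h2 h3 : C) :
  `|(h1, h2, h3) : C * C * C| = (Num.max (Num.max (normc h1) (normc h2)) (normc h3))%:C.
Proof.
have E (x y : R) : Num.max x%:C y%:C = (Num.max x y)%:C :> C.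
  by rewrite /Order.max ltcR; case: ifP.
by rewrite !prod_normE /= !normcE_norm !E.
Qed.

Lemma laplace_fourier_differentiable G a b z : weight G -> 0 < Re b -> `|Im z| < beta ->
  differentiable (fun p : C * C * C => laplace_fourier G p.1.1 p.1.2 p.2) (a, b, z).
Proof.
move=> wG b0 zb; have [A [B [D [_ _ _ [e e0 [K hK]]]]]] := laplace_fourier_expansion a wG b0 zb.
set L := laplace_fourier G a b z in hK *.
have d11 : differentiable (fun p : C * C * C => p.1.1) (a, b, z).
  by apply: (differentiable_comp (f := fst) (g := fst)); exact: differentiable_fst.
have d12 : differentiable (fun p : C * C * C => p.1.2) (a, b, z).
  by apply: (differentiable_comp (f := fst) (g := snd));
    [exact: differentiable_fst|exact: differentiable_snd].
have d2 : differentiable (fun p : C * C * C => p.2) (a, b, z).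
  exact: differentiable_snd.
have dc (c : C) : differentiable (fun _ : C * C * C => c) (a, b, z).
  exact: differentiable_cst.
pose g := fun p : C * C * C => L + ((p.1.1 + - a) * A + (p.1.2 + - b) * B + (p.2 + - z) * D).
have dg : differentiable g (a, b, z).
  apply: (differentiableD (f := fun=> L) (g := fun p => _)); first exact: dc.
  apply: (differentiableD (f := fun p => _) (g := fun p => _)).
    apply: (differentiableD (f := fun p => _) (g := fun p => _)).
      apply: (differentiableM (f := fun p => _) (g := fun p => _)); last exact: dc.
      by apply: (differentiableD (f := fun p => _) (g := fun p => _)); [exact: d11|exact: dc].
    apply: (differentiableM (f := fun p => _) (g := fun p => _)); last exact: dc.
    by apply: (differentiableD (f := fun p => _) (g := fun p => _)); [exact: d12|exact: dc].
  apply: (differentiableM (f := fun p => _) (g := fun p => _)); last exact: dc.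
  by apply: (differentiableD (f := fun p => _) (g := fun p => _)); [exact: d2|exact: dc].
apply: (@quadratic_differentiable2 R (C * C * C)%type _ g _ K e dg e0) => -[[h1 h2] h3].
move=> hh.
move: hh; rewrite prod_norm_normc ltcR => hh.
have := hK h1 h2 h3 _ hh; rewrite !le_max !lexx !orbT /= => /(_ isT isT isT).
rewrite -rmorphXn/= -rmorphM/= normcE_norm lecR /g /=.
congr (normc _ <= _).
rewrite (addrC h1) (addrC h2) (addrC h3).
rewrite (_ : a + h1 - a = h1); last by rewrite addrC addKr.
rewrite (_ : b + h2 - b = h2); last by rewrite addrC addKr.
rewrite (_ : z + h3 - z = h3); last by rewrite addrC addKr.
by move: (laplace_fourier G _ _ _) => X; ring.
Qed.

End LaplaceFourierDerivatives.

(** * Borel-Laplace transforms *)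

Section TameSymbols.
Variable R : realType.
Variables (kp : nat) (beta : R) (S : set R[i]).
Hypothesis kp1 : (1 < kp)%N.
Local Notation C := R[i].
Implicit Types (w : C -> R -> C).

(** The factor [normc tau] compensates the 1/u of du/u; the rates in m are those below [beta], as in
    [weight]. *)
Definition growth_bound (A : set C) w : Prop := exists2 N : R, 0 <= N &
  forall b, b < beta -> exists2 K : R, 0 <= K &
    forall tau m, A tau -> normc (w tau m) <=
      K * normc tau * expR (N * normc tau ^+ kp) * expR (- (b * `|m|)).

(** Joint continuity provides measurability on the plane, holomorphy in tau the rotation of rays,
    and the growth bound convergence. The class is stable under the symbols of all operators of the
    equation. *)
Definition tame w : Prop :=
  [/\ (forall tau m, S tau -> {for (tau, m), continuous (fun p : C * R => w p.1 p.2)}),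
      (forall m, holomorphic_on S (fun tau => w tau m)) & growth_bound S w].

Lemma le_1X (k : nat) (y : R) : (0 < k)%N -> 0 <= y -> y <= 1 + y ^+ k.
Proof.
move=> k0 y0; have yk0 : 0 <= y ^+ k by rewrite exprn_ge0.
have [y1|y1] := leP y 1; first lra.
by rewrite (@le_trans _ _ (y ^+ k))//; [rewrite -[leLHS]expr1 ler_eXn2l// ltnW|lra].
Qed.

Lemma expR_pow_le (x : R) (j : nat) : 0 <= x -> x ^+ j <= j.+1`!%:R * expR (1 + x).
Proof.
move=> x0; apply: (@le_trans _ _ ((1 + x) ^+ j.+1)).
  apply: (@le_trans _ _ ((1 + x) ^+ j)); first by rewrite lerXn2r ?nnegrE; lra.
  by rewrite ler_weXn2l//; lra.
have h2 := @expR_ge1Dxn R (1 + x) j ltac:(lra).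
by rewrite mulrC -ler_pdivrMr ?ltr0n ?fact_gt0//; move: (_ / _) h2 => v; lra.
Qed.

Lemma tameD w1 w2 : tame w1 -> tame w2 -> tame (fun tau m => w1 tau m + w2 tau m).
Proof.
move=> [c1 h1 [N1 N10 g1]] [c2 h2 [N2 N20 g2]]; split.
- by move=> tau m St; apply: continuous_addC; [exact: c1|exact: c2].
- move=> m tau St; apply: (differentiableD (f := fun t => w1 t m) (g := fun t => w2 t m)).
    exact: h1.
  exact: h2.
exists (N1 + N2) => [|b bb]; first exact: addr_ge0.
have [K1 K10 {}g1] := g1 b bb; have [K2 K20 {}g2] := g2 b bb.
exists (K1 + K2) => [|tau m St]; first exact: addr_ge0.
have tk : 0 <= normc tau ^+ kp by rewrite exprn_ge0// normc_ge0.
have e1 : expR (N1 * normc tau ^+ kp) <= expR ((N1 + N2) * normc tau ^+ kp).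
  by rewrite ler_expR ler_wpM2r//; lra.
have e2 : expR (N2 * normc tau ^+ kp) <= expR ((N1 + N2) * normc tau ^+ kp).
  by rewrite ler_expR ler_wpM2r//; lra.
move: (expR ((N1 + N2) * _)) e1 e2 => E e1 e2.
rewrite (le_trans (normcD _ _))// !mulrDl lerD//.
  apply: (le_trans (g1 _ _ St)); apply: ler_wpM2r; first exact: expR_ge0.
  by apply: ler_wpM2l => //; rewrite mulr_ge0// normc_ge0.
apply: (le_trans (g2 _ _ St)); apply: ler_wpM2r; first exact: expR_ge0.
by apply: ler_wpM2l => //; rewrite mulr_ge0// normc_ge0.
Qed.

Lemma tameZ (k : C) w : tame w -> tame (fun tau m => k * w tau m).
Proof.
move=> [c1 h1 [N1 N10 g1]]; split.
- by move=> tau m St; apply: continuous_mulC; [exact: cst_continuous|exact: c1].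
- move=> m tau St; apply: (differentiableM (f := fun=> k) (g := fun t => w t m)).
    exact: differentiable_cst.
  exact: h1.
exists N1 => // b bb; have [K1 K10 {}g1] := g1 b bb.
exists (normc k * K1) => [|tau m St]; first by rewrite mulr_ge0// normc_ge0.
by rewrite normcM -!mulrA ler_wpM2l ?normc_ge0// !mulrA g1.
Qed.

Lemma tame0 : tame (fun _ _ => 0).
Proof.
split.
- by move=> tau m St; exact: cst_continuous.
- by move=> m tau St; exact: differentiable_cst.
exists 0 => // b bb; exists 0 => // tau m St.
by rewrite normc0 !mul0r.
Qed.

Lemma tame_sum I (r : seq I) (F : I -> C -> R -> C) : (forall i, tame (F i)) ->
  tame (fun tau m => \sum_(i <- r) F i tau m).
Proof.
move=> tF; elim: r => [|i r IH].
  by under eq_fun do under eq_fun do rewrite big_nil; exact: tame0.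
by under eq_fun do under eq_fun do rewrite big_cons; exact: tameD.
Qed.

Lemma differentiable_expn (j : nat) (x : C) : differentiable (fun t : C => t ^+ j) x.
Proof. by apply/derivable1_diffP; exact: exprn_derivable. Qed.

Lemma continuous_expnC (T : topologicalType) (f : T -> C) x (j : nat) :
  {for x, continuous f} -> {for x, continuous (fun y => f y ^+ j)}.
Proof.
move=> cf; elim: j => [|j IH]; first exact: cst_continuous.
have -> : (fun y => f y ^+ j.+1) = (fun y => f y * f y ^+ j).
  by apply/funext => y; rewrite exprS.
exact: continuous_mulC.
Qed.

Lemma tame_tauX (j : nat) w : tame w -> tame (fun tau m => tau ^+ j * w tau m).
Proof.
move=> [c1 h1 [N1 N10 g1]]; split.
- move=> tau m St; apply: continuous_mulC; last exact: c1.
  by apply: (continuous_expnC (f := fst)); exact: cvg_fst.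
- move=> m tau St; apply: (differentiableM (f := fun t : C => t ^+ j) (g := fun t : C => w t m)).
    exact: differentiable_expn.
  exact: h1.
exists (N1 + 1) => [|b bb]; first exact: addr_ge0.
have [K1 K10 {}g1] := g1 b bb.
(* In [expR 2], one unit comes from [expR_pow_le] and one from x <= 1 + x^kp. *)
exists (j.+1`!%:R * expR 2 * K1) => [|tau m St].
  by rewrite !mulr_ge0// expR_ge0.
rewrite normcM normcX; have n0 := normc_ge0 tau.
have -> : expR ((N1 + 1) * normc tau ^+ kp) = expR (N1 * normc tau ^+ kp) * expR (normc tau ^+ kp).
  by rewrite -expRD mulrDl mul1r.
rewrite [leRHS](_ : _ = (j.+1`!%:R * (expR 2 * expR (normc tau ^+ kp))) *
  (K1 * normc tau * expR (N1 * normc tau ^+ kp) * expR (- (b * `|m|)))); last by ring.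
rewrite ler_pM ?normc_ge0 ?exprn_ge0 ?g1//.
rewrite (le_trans (expR_pow_le j n0))// ler_wpM2l// -expRD ler_expR.
by have := le_1X (ltnW kp1) n0; lra.
Qed.

Lemma tame_mX (j : nat) w : tame w -> tame (fun tau m => m%:C ^+ j * w tau m).
Proof.
move=> [c1 h1 [N1 N10 g1]]; split.
- move=> tau m St; apply: continuous_mulC; last exact: c1.
  apply: (continuous_expnC (f := fun p : C * R => p.2%:C)).
  by apply: (continuous_compC (g := snd) (f := fun x : R => x%:C));
    [exact: cvg_snd|exact: continuous_realC].
- move=> m tau St; apply: (differentiableM (f := fun=> m%:C ^+ j) (g := fun t => w t m)).
    exact: differentiable_cst.
  exact: h1.
exists N1 => // b bb; pose d := (beta - b) / 2.
have d0 : 0 < d by rewrite /d; lra.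
have [K1 K10 {}g1] := g1 (b + d) ltac:(rewrite /d; lra).
exists (d^-1 ^+ j * (j.+1`!%:R * expR 1) * K1) => [|tau m St].
  by rewrite mulr_ge0// mulr_ge0 ?exprn_ge0 ?invr_ge0 ?(ltW d0)// mulr_ge0// expR_ge0.
rewrite normcM normcX normc_real.
have -> : expR (- (b * `|m|)) = expR (d * `|m|) * expR (- ((b + d) * `|m|)).
  by rewrite -expRD; congr expR; ring.
rewrite [leRHS](_ : _ = (d^-1 ^+ j * (j.+1`!%:R * (expR 1 * expR (d * `|m|)))) *
  (K1 * normc tau * expR (N1 * normc tau ^+ kp) * expR (- ((b + d) * `|m|)))); last by ring.
rewrite ler_pM ?normc_ge0 ?exprn_ge0 ?g1//.
have -> : `|m| ^+ j = d^-1 ^+ j * (d * `|m|) ^+ j.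
  by rewrite -exprMn mulKf// gt_eqF.
rewrite ler_wpM2l ?exprn_ge0 ?invr_ge0 ?(ltW d0)// -expRD.
by apply: expR_pow_le; rewrite mulr_ge0// ltW.
Qed.

Lemma tame_poly (p : {poly C}) w : tame w -> tame (fun tau m => p.[0 +i* m] * w tau m).
Proof.
move=> tw.
have -> : (fun tau m => p.[0 +i* m] * w tau m) =
   (fun tau m => \sum_(i <- iota 0 (size p)) (p`_i * (0 +i* 1) ^+ i) * (m%:C ^+ i * w tau m)).
  apply/funext => tau; apply/funext => m.
  rewrite horner_coef mulr_suml -(big_mkord xpredT
    (fun i => p`_i * (0 +i* m) ^+ i * w tau m)) /index_iota subn0.
  apply: eq_bigr => i _.
  rewrite -[0 +i* m](_ : (0 +i* 1) * m%:C = _); first by rewrite exprMn; ring.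
  by apply: complex_ext => /=; ring.
by apply: tame_sum => i; apply: tameZ; exact: tame_mX.
Qed.

Lemma continuous_pairC (T U V : topologicalType) (f : T -> U) (g : T -> V) x :
  {for x, continuous f} -> {for x, continuous g} ->
  {for x, continuous (fun y => (f y, g y))}.
Proof. by move=> cf cg; exact: (cvg_pair cf cg). Qed.

(** Along the ray du/u is dr/r, the factor e^{i xi} cancelling; the value 0 for r <= 0 extends the
    integral to the line. *)
Definition wray (xi : R) w (r m : R) : C :=
  if 0 < r then w (r%:C * expi xi) m / r%:C else 0.

Lemma wray_weight (xi : R) w : (forall r, 0 < r -> S (r%:C * expi xi)) -> tame w ->
  weight kp beta (wray xi w).
Proof.
move=> Sr [c1 _ [N N0 g1]]; split.
  pose A : set (R * R) := [set p | 0 < p.1].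
  have oA : open A.
    rewrite (_ : A = fst @^-1` [set x | 0 < x])//.
    by apply: open_comp => [z _|]; [exact: cvg_fst|exact: open_gt].
  have := @cmeasurable2_open R A (fun p => w (p.1%:C * expi xi) p.2 * (p.1^-1)%:C) oA.
  rewrite (_ : (fun x y => _) = wray xi w).
    apply => -[r m] /= r0; apply: continuous_mulC.
      apply: (continuous_compC (f := fun p : C * R => w p.1 p.2) (g := fun p : R * R => (p.1%:C * expi xi, p.2))).
        apply: (continuous_pairC (f := fun p : R * R => p.1%:C * expi xi) (g := snd));
          last exact: cvg_snd.
        apply: (continuous_mulC (f := fun p : R * R => p.1%:C)); last exact: cst_continuous.
        by apply: (continuous_compC (g := fst) (f := fun x : R => x%:C));
          [exact: cvg_fst|exact: continuous_realC].
      by apply: c1; exact: Sr.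
    apply: (continuous_compC (g := fun p : R * R => p.1^-1) (f := fun x : R => x%:C));
      last exact: continuous_realC.
    apply: (continuous_compC (g := fst) (f := fun x : R => x^-1)); first exact: cvg_fst.
    by apply: inv_continuous; rewrite gt_eqF.
  apply/funext => r; apply/funext => m; rewrite /wray /A mem_setE.
  case: ifPn => [|]; rewrite ?inE/= => r0; first by rewrite ifT// fmorphV.
  by rewrite ifN.
exists N => // b bb; have [K K0 {}g1] := g1 b bb.
exists K => // r m; rewrite /wray; case: ifP => r0; last by rewrite normc0.
have nr : normc (r%:C * expi xi) = r by rewrite normcM normc_expi mulr1 normc_real gtr0_norm.
have := g1 _ m (Sr r r0); rewrite nr => h.
rewrite normcM normcV normc_real gtr0_norm// ler_pdivrMr// (le_trans h)//.
by rewrite le_eqVlt; apply/orP; left; apply/eqP; ring.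
Qed.

End TameSymbols.

Section BorelLaplace.
Variable R : realType.
Variable P : equation_data R.
Hypothesis hP : equation_hyp P.
Local Notation C := R[i].
Local Notation k1 := P.(k1).
Local Notation k2 := P.(k2).
Local Notation kp := P.(kp).
Local Notation beta := P.(beta).

Lemma orders_k12 : (0 < k1 < k2)%N.
Proof. exact: hyp_k hP. Qed.

Lemma orders_kp2 : (1 < kp < k2)%N.
Proof.
have /andP[h1 h2] := hyp_k hP; have /andP[h3 h4] := hyp_kp hP.
by rewrite h4 andbT (leq_ltn_trans h1 h3).
Qed.

(** Since kp, k1 and 1 are all below k2, each of the three lower-order terms takes a third of cb
    r^k2. The term - r is left for integrability. *)
Lemma exponent_bound (N A cb : R) : 0 < cb -> exists2 L, 0 <= L &
  forall r, 0 <= r -> N * r ^+ kp + A * r ^+ k1 - cb * r ^+ k2 <= L - r.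
Proof.
move=> cb0; have c3 : 0 < cb / 3 by rewrite divr_gt0.
have /andP[h1 h2] := orders_kp2; have /andP[h3 h4] := orders_k12.
have [L1 L10 hL1] := @monomial_dominated R N (cb / 3) kp k2 c3 h2.
have [L2 L20 hL2] := @monomial_dominated R A (cb / 3) k1 k2 c3 h4.
have [L3 L30 hL3] := @monomial_dominated R 1 (cb / 3) 1 k2 c3 (ltn_trans h1 h2).
exists (L1 + L2 + L3); first by rewrite !addr_ge0.
move=> r r0; have := hL1 r r0; have := hL2 r r0; have := hL3 r r0.
rewrite expr1 mul1r; have -> : cb * r ^+ k2 = 3 * (cb / 3 * r ^+ k2) by field.
by move: (cb / 3 * _) (N * _) (A * _) => x y v; lra.
Qed.

Lemma powV_polar (r t c : R) (T : C) k : T = (normc T)%:C * expi c ->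
  (r%:C * expi t / T) ^+ k = ((r / normc T) ^+ k)%:C * expi (k%:R * (t - c)).
Proof.
move=> TE; rewrite {1}TE invfM -expiN mulrACA -expiD exprMn expiX rmorphXn rmorphM/=.
by rewrite fmorphV.
Qed.

Lemma ReV_polar (r t c : R) (T : C) k : T = (normc T)%:C * expi c ->
  Re ((r%:C * expi t / T) ^+ k) = (r / normc T) ^+ k * cos (k%:R * (t - c)).
Proof. by move=> TE; rewrite (powV_polar _ _ _ TE) complexRe_real. Qed.

Lemma good_direction_Re k xi T : good_direction 0 k xi T -> 0 < Re ((expi xi / T) ^+ k : C).
Proof.
move=> [T0 [a [TE]]]; rewrite addr0 subr0 => h1 h2.
rewrite -[expi xi]mul1r (ReV_polar _ _ _ TE) mulr_gt0//.
  by rewrite exprn_gt0// div1r invr_gt0 normc_gt0.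
by rewrite mulrBr; apply: cos_gt0_pihalf; rewrite h1.
Qed.

(** No condition links the direction t to T1: the k1 term is bounded by its modulus, and only the k2
    term contributes decay, uniformly on the arc of half-width Y. *)
Lemma normc_laplace_kernel (r t c Y : R) (T1 T2 : C) : 0 <= r -> T2 = (normc T2)%:C * expi c ->
  `|k2%:R * (t - c)| <= Y -> Y < pi / 2 ->
  normc (cexp (- (r%:C * expi t / T1) ^+ k1 - (r%:C * expi t / T2) ^+ k2)) <=
  expR ((normc T1)^-1 ^+ k1 * r ^+ k1 - (normc T2)^-1 ^+ k2 * cos Y * r ^+ k2).
Proof.
move=> r0 TE tY Y2; rewrite normc_cexp ler_expR cReD !cReN.
rewrite (ReV_polar _ _ _ TE) lerD//.
  rewrite (le_trans (ler_norm _))// normrN (le_trans (normc_ge_absRe _))//.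
  by rewrite normcX !normcM normcV normc_expi mulr1 normc_real ger0_norm// -exprMn mulrC.
rewrite lerN2 exprMn mulrAC [_ * cos _]mulrC -mulrA [X in _ <= X]mulrC -!mulrA.
rewrite [leRHS]mulrC [r ^+ k2 * _]mulrC -mulrA.
rewrite [leLHS](_ : _ = (normc T2)^-1 ^+ k2 * r ^+ k2 * cos Y); last by ring.
rewrite [leRHS](_ : _ = (normc T2)^-1 ^+ k2 * r ^+ k2 * cos (k2%:R * (t - c))); last by ring.
rewrite ler_wpM2l ?cos_lower// mulr_ge0 ?exprn_ge0// invr_ge0 normc_ge0//.
Qed.

Lemma borel_laplace_differentiable (g : C -> C) (T1 T2 u : C) : u != 0 -> differentiable g u ->
  differentiable (borel_laplace_integrand P g T1 T2) u.
Proof.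
move=> u0 dg.
have dd (T : C) k : differentiable (fun v : C => - (v / T) ^+ k) u.
  apply: (differentiableN (f := fun v : C => (v / T) ^+ k)).
  apply: (differentiable_comp (f := fun v : C => v / T) (g := fun v : C => v ^+ k));
    last exact: differentiable_expn.
  by apply: (differentiableM (f := fun v : C => v) (g := fun=> T^-1));
    [exact: ex_diff|exact: differentiable_cst].
apply: (differentiableM (f := fun v : C => g v * cexp (- (v / T1) ^+ k1 - (v / T2) ^+ k2))
   (g := fun v : C => v^-1)); last first.
  by apply: (differentiableV (f := fun v : C => v)) => //; exact: ex_diff.
apply: (differentiableM (f := g) (g := fun v : C => cexp (- (v / T1) ^+ k1 - (v / T2) ^+ k2))); first exact: dg.
apply: (differentiable_comp (f := fun v : C => - (v / T1) ^+ k1 - (v / T2) ^+ k2) (g := @cexp R)).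
  by apply: (differentiableD (f := fun v : C => - (v / T1) ^+ k1) (g := fun v : C => - (v / T2) ^+ k2)); exact: dd.
exact: differentiable_cexp.
Qed.

(** All directions between t and t' satisfy |k2 (s - c)| <= Y < pi / 2, so r^k2 enters with the
    positive coefficient cos Y / |T2|^k2 and dominates the growth of order kp as well as the k1
    term. *)
Lemma laplace_rotate (g : C -> C) (N K t t' c : R) (T1 T2 : C) : 0 <= N -> 0 <= K ->
  T2 = (normc T2)%:C * expi c -> T2 != 0 ->
  `|k2%:R * (t - c)| < pi / 2 -> `|k2%:R * (t' - c)| < pi / 2 ->
  (forall r s, 0 < r -> Num.min t t' <= s <= Num.max t t' -> differentiable g (r%:C * expi s)
    /\ normc (g (r%:C * expi s)) <= K * r * expR (N * r ^+ kp)) ->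
  ray_int t (borel_laplace_integrand P g T1 T2) = ray_int t' (borel_laplace_integrand P g T1 T2).
Proof.
wlog tt' : t t' / t <= t'.
  move=> H; have /orP[tt'|t't] := le_total t t'; first exact: (H t t' tt').
  move=> N0 K0 TE T20 h1 h2 hg; symmetry; apply: (H t' t t't N0 K0 TE T20 h2 h1) => r s.
  by rewrite minC maxC; exact: hg.
move=> N0 K0 TE T20 h1 h2; rewrite min_l// max_r// => hg.
pose Y := Num.max `|k2%:R * (t - c)| `|k2%:R * (t' - c)|.
have Y2 : Y < pi / 2 by rewrite gt_max h1 h2.
have Y0 : 0 <= Y by rewrite le_max normr_ge0.
have sY s : t <= s <= t' -> `|k2%:R * (s - c)| <= Y.
  move=> /andP[ts st']; rewrite /Y !normrM normr_nat -maxr_pMr// ler_wpM2l//.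
  have hA : `|t - c| <= Num.max `|t - c| `|t' - c| by rewrite le_max lexx.
  have hB : `|t' - c| <= Num.max `|t - c| `|t' - c| by rewrite le_max lexx orbT.
  move: hA hB; move: (Num.max _ _) => M hA hB.
  have h3 := ler_norm (t' - c); have h4 := ler_norm (- (t - c)); rewrite normrN in h4.
  by rewrite ler_norml; apply/andP; split; lra.
have cY : 0 < cos Y by apply: cos_gt0_pihalf; apply/andP; split=> //; lra.
have nT : 0 < normc T2 by rewrite normc_gt0.
have cb0 : 0 < (normc T2)^-1 ^+ k2 * cos Y by rewrite mulr_gt0// exprn_gt0// invr_gt0.
have [L L0 hL] := exponent_bound N ((normc T1)^-1 ^+ k1) cb0.
apply: (@ray_int_rotate R _ (K * expR L) t t' tt').
  move=> r s r0 hs; have [dg _] := hg r s r0 hs.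
  have u0 : r%:C * expi s != 0 :> C.
    by rewrite mulf_neq0 ?expi_neq0// -normc_gt0 normc_real normr_gt0 gt_eqF.
  move: (r%:C * expi s) dg u0 => u dg u0.
  exact: borel_laplace_differentiable.
move=> r s; rewrite le_eqVlt => /orP[/eqP <- _|r0 hs].
  rewrite /borel_laplace_integrand mul0r invr0 mulr0 normc0 mulr_ge0 ?expR_ge0//.
  by rewrite mulr_ge0// expR_ge0.
have [_ gb] := hg r s r0 hs.
rewrite /borel_laplace_integrand normcM normcV (normcM r%:C) normc_expi mulr1 normc_real gtr0_norm//.
rewrite ler_pdivrMr// normcM.
apply: (le_trans (ler_pM _ _ gb (normc_laplace_kernel T1 (ltW r0) TE (sY s hs) Y2))); rewrite ?normc_ge0//.
rewrite [leLHS](_ : _ = K * r * expR (N * r ^+ kp + (normc T1)^-1 ^+ k1 * r ^+ k1 - (normc T2)^-1 ^+ k2 * cos Y * r ^+ k2)); last first.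
  by rewrite -[N * _ + _ - _]addrA [expR (N * _ + _)]expRD; ring.
rewrite [leRHS](_ : _ = K * r * expR (L - r)); last by rewrite expRD; ring.
by rewrite ler_wpM2l ?mulr_ge0 ?(ltW r0)// ler_expR hL// ltW.
Qed.

End BorelLaplace.

(** * Calculus of derivatives in one complex variable *)

Section DeriveC.
Variable R : realType.
Local Notation C := R[i].

Lemma is_derive_normcP (f : C -> C) (x l : C) : is_derive x 1 f l <->
  forall e : R, 0 < e -> exists2 d : R, 0 < d & forall y, normc (y - x) < d ->
    normc (f y - f x - (y - x) * l) <= e * normc (y - x).
Proof.
split.
  move=> [fx fl] e e0; have {fl}fx : (fun h => h^-1 *: ((f \o shift x) (h *: 1) - f x)) @ (0 : C)^' --> l.
    by rewrite -fl; exact: fx.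
  have /cvgC_normP/(_ _ e0) := fx.
  rewrite near_withinE => /nbhs_normcP[d d0 h]; exists d => // y yd.
  have [->|yx] := eqVneq y x; first by rewrite !subrr mul0r !subrr normc0 mulr0.
  have := h (y - x); rewrite subr0 => /(_ yd); rewrite subr_eq0 => /(_ yx).
  rewrite [_ *: 1]mulr1 /= /shift/= subrK.
  have -> : (y - x)^-1 *: (f y - f x) - l = (y - x)^-1 * (f y - f x - (y - x) * l).
    by rewrite mulrBr mulrA mulVf ?subr_eq0// mul1r.
  rewrite normcM normcV mulrC ltr_pdivrMr ?normc_gt0 ?subr_eq0//.
  by move=> /ltW.
move=> hf; suff h : (fun h => h^-1 *: ((f \o shift x) (h *: 1) - f x)) @ (0 : C)^' --> l.
  by split; [apply/cvg_ex; exists l|exact: cvg_lim].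
apply/cvgC_normP => e e0; have [d d0 hd] := hf (e / 2) (divr_gt0 e0 (ltr0Sn _ 1)).
near=> h.
have h0 : h != 0 by near: h; exact: nbhs_dnbhs_neq.
have hlt : normc h < d.
  by rewrite -ltcR -normcE_norm; near: h; apply: dnbhs0_lt; rewrite ltcR.
rewrite [h *: _]mulr1 /= /shift/= [h + x]addrC.
have -> : h^-1 *: (f (x + h) - f x) - l = h^-1 * (f (x + h) - f x - h * l).
  by rewrite mulrBr mulrA mulVf// mul1r.
have hp : 0 < normc h by rewrite normc_gt0.
rewrite normcM normcV mulrC ltr_pdivrMr//.
have := hd (x + h); rewrite (_ : x + h - x = h); last by rewrite addrC addKr.
by move=> /(_ hlt) /le_lt_trans; apply; rewrite ltr_pM2r//; lra.
Unshelve. all: by end_near. Qed.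

Lemma is_derive_compC (f g : C -> C) (x df dg : C) : is_derive x 1 f df ->
  is_derive (f x) 1 g dg -> is_derive x 1 (fun y => g (f y)) (dg * df).
Proof.
move=> /is_derive_normcP hf /is_derive_normcP hg; apply/is_derive_normcP => e e0.
pose M := normc df + normc dg + 1.
have M0 : 0 < M by rewrite /M ltr_wpDl// addr_ge0 ?normc_ge0.
(* The two error terms are each at most e1 M |y - x|, hence half of the target; e1 <= 1 keeps the
   difference quotient of f below M. *)
pose e1 := Num.min 1 (e / (2 * M)).
have e10 : 0 < e1 by rewrite lt_min ltr01 divr_gt0// mulr_gt0.
have e11 : e1 <= 1 by rewrite ge_min lexx.
have e1M : e1 * M <= e / 2.
  by rewrite -ler_pdivlMr// -mulrA -invfM ge_min lexx orbT.
have [d1 d10 hd1] := hf _ e10; have [d2 d20 hd2] := hg _ e10.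
exists (Num.min d1 (d2 / M)); first by rewrite lt_min d10 divr_gt0.
move=> y; rewrite lt_min => /andP[y1 y2].
have h1 := hd1 y y1.
have n0 := normc_ge0 (y - x).
have fl : normc (f y - f x) <= (normc df + e1) * normc (y - x).
  have -> : f y - f x = (f y - f x - (y - x) * df) + (y - x) * df by rewrite subrK.
  rewrite (le_trans (normcD _ _))// normcM; move: h1; lra.
have flM : (normc df + e1) * normc (y - x) <= M * normc (y - x).
  by rewrite ler_wpM2r// /M; have := normc_ge0 dg; lra.
have h2 : normc (f y - f x) < d2.
  by rewrite (le_lt_trans (le_trans fl flM))// mulrC -ltr_pdivlMr.
have h3 := hd2 _ h2.
have -> : g (f y) - g (f x) - (y - x) * (dg * df) =
   (g (f y) - g (f x) - (f y - f x) * dg) + dg * (f y - f x - (y - x) * df) by ring.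
rewrite (le_trans (normcD _ _))// normcM.
have h4 : e1 * normc (f y - f x) <= e1 * (M * normc (y - x)).
  by rewrite ler_wpM2l ?(ltW e10)// (le_trans fl).
have h5 : normc dg * normc (f y - f x - (y - x) * df) <= M * (e1 * normc (y - x)).
  by rewrite ler_pM ?normc_ge0// /M; have := normc_ge0 df; lra.
have h6 : e1 * M * normc (y - x) <= e / 2 * normc (y - x) by rewrite ler_wpM2r.
rewrite (le_trans (lerD (le_trans h3 h4) h5))// mulrA [M * _]mulrA [M * e1]mulrC.
by lra.
Qed.

Lemma is_derive_invX (k : nat) (x : C) : x != 0 ->
  is_derive x 1 (fun s => s^-1 ^+ k) (- (k%:R * x^-1 ^+ k.+1)).
Proof.
move=> x0.
have dV : is_derive x 1 (fun s : C => s^-1) (- x^-1 ^+ 2).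
  split; first by apply: derivableV => //; exact: derivable_id.
  by rewrite (deriveV (f := id))// derive_id /GRing.scale/= mulr1 exprVn.
elim: k => [|k IH].
  by rewrite mul0r oppr0; exact: is_derive_cst.
have -> : (fun s : C => s^-1 ^+ k.+1) = (fun s => s^-1) * (fun s => s^-1 ^+ k).
  by apply/funext => s; rewrite exprS.
apply: (is_derive_eq (is_deriveM dV IH)).
rewrite /GRing.scale/= -natr1 !exprS; ring.
Qed.

End DeriveC.

(** * Solutions along a ray and their independence of the direction *)

Section Solutions.
Variable R : realType.
Variable P : equation_data R.
Hypothesis hP : equation_hyp P.
Local Notation C := R[i].
Local Notation k1 := P.(k1).
Local Notation k2 := P.(k2).
Local Notation kp := P.(kp).
Local Notation beta := P.(beta).
Local Notation lf := (laplace_fourier k1 k2).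
Local Notation fconst := (((Num.sqrt (2 * pi))^-1)%:C : C).
Implicit Types (w : C -> R -> C).

(** With epsilon fixed, only the section of omega at epsilon matters; [w] is that section, so tame
    symbols can be substituted for it. *)
Definition inner_sol w (xi : R) (t1 t2 z eps : C) : C :=
  sol P (fun tau m _ => w tau m) xi t1 t2 z eps.

Lemma ray_sol_integrand w xi (t1 t2 z eps : C) m :
  ray_integrand xi (sol_ray_integrand P (fun tau m _ => w tau m) t1 t2 z eps m) \_ `[0%R, +oo[
  = (fun r => wray xi w r m * cexp (kernel_exponent k1 k2
      ((expi xi / (eps ^+ P.(lam1) * t1)) ^+ k1) ((expi xi / (eps ^+ P.(lam2) * t2)) ^+ k2) z r m)).
Proof.
apply/funext => r; rewrite patchE /wray.
case: ifPn => [|]; rewrite ?inE ?notin_setE /= in_itv/= andbT => r0; last first.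
  by rewrite ifN ?mul0r//; apply/negP => /ltW.
rewrite /ray_integrand /sol_ray_integrand.
(* At r = 0 both sides vanish: the left one because 0^-1 = 0, the right one by definition of
   [wray]. *)
move: r0; rewrite le_eqVlt => /orP[/eqP <-|r0].
  by rewrite ltxx mul0r invr0 mulr0 !mul0r.
rewrite r0 /kernel_exponent.
have rn : r%:C != 0 :> C by rewrite -normc_gt0 normc_real normr_gt0 gt_eqF.
rewrite -[in RHS]mulrA [r%:C^-1 * _]mulrC.
have E (T : C) k : (expi xi / T) ^+ k * r%:C ^+ k = (r%:C * expi xi / T) ^+ k.
  by rewrite -exprMn mulrC mulrA.
rewrite !E [cexp (_ + (0 +i* 1) * z * m%:C)]cexpD.
move: (cexp _) (cexp _) (w _ _) => x y v.
rewrite invfM; have := expi_neq0 xi; move: (expi xi) rn => e rn en.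
by field; rewrite en rn.
Qed.

Lemma inner_sol_laplace w xi t1 t2 z eps : inner_sol w xi t1 t2 z eps =
  fconst * lf (wray xi w) ((expi xi / (eps ^+ P.(lam1) * t1)) ^+ k1)
    ((expi xi / (eps ^+ P.(lam2) * t2)) ^+ k2) z.
Proof.
apply: (congr1 (fun x : C => fconst * x)); apply: eq_cint => m _.
by rewrite /ray_int cint_mkcond ray_sol_integrand.
Qed.

Lemma inner_sol_converges (S : set C) w xi t1 t2 z eps : tame kp beta S w ->
  (forall r, 0 < r -> S (r%:C * expi xi)) ->
  good_direction 0 k2 xi (eps ^+ P.(lam2) * t2) -> `|Im z| < beta ->
  sol_converges P (fun tau m _ => w tau m) xi t1 t2 z eps.
Proof.
move=> tw Sr /good_direction_Re b0 zb.
have wG := wray_weight Sr tw.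
have [_ d2 _ d4 _] := dominated_fubini (weight_dominated (orders_k12 hP) (orders_kp2 hP)
  ((expi xi / (eps ^+ P.(lam1) * t1)) ^+ k1) wG b0 zb).
split => [m|].
  rewrite /ray_integrable cintegrable_mkcond ?ray_sol_integrand; last exact: measurable_itv.
  exact: d2.
apply: eq_cintegrable d4 => // m _.
by rewrite /ray_int [in RHS]cint_mkcond ray_sol_integrand.
Qed.

Lemma ray_int_expi (xi xi' : R) (g : C -> C) : expi xi = expi xi' :> C ->
  ray_int xi g = ray_int xi' g.
Proof. by move=> E; apply: eq_cint => r _; rewrite /ray_integrand E. Qed.

Variables (a1 a2 : R).
Hypothesis a12 : a2 - a1 <= 2 * pi - pi / k2%:R.
Local Notation S := (@sector R a1 a2).
Local Notation tame := (tame kp beta S).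

(** [good_directions_connected] lifts both directions to one interval inside ]a1, a2[ on which the
    T2 kernel decays, and [laplace_rotate] is applied for each m. *)
Lemma inner_sol_rotate w xi xi' t1 t2 z eps : tame w ->
  S (expi xi) -> S (expi xi') ->
  good_direction 0 k2 xi (eps ^+ P.(lam2) * t2) ->
  good_direction 0 k2 xi' (eps ^+ P.(lam2) * t2) ->
  inner_sol w xi t1 t2 z eps = inner_sol w xi' t1 t2 z eps.
Proof.
move=> [_ hw [N N0 gw]] Sx Sx' gx gx'.
have k20 : (0 < k2)%N by have /andP[h1 h2] := orders_kp2 hP; exact: ltn_trans (ltnW h1) h2.
have T20 : eps ^+ P.(lam2) * t2 != 0 by case: gx.
have [t [t' [c [E E' TE [h1 h2 h3 h4]]]]] := good_directions_connected k20 a12 Sx Sx' gx gx'.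
apply: (congr1 (fun x : C => fconst * x)); apply: eq_cint => m _.
rewrite -(ray_int_expi _ E) -(ray_int_expi _ E').
(* Here m is fixed, so any rate below [beta] will do. *)
have [K K0 {}gw] := gw (beta - 1) ltac:(lra).
pose em := cexp ((0 +i* 1) * z * m%:C).
have -> : sol_ray_integrand P (fun tau m _ => w tau m) t1 t2 z eps m =
  borel_laplace_integrand P (fun u => w u m * em) (eps ^+ P.(lam1) * t1) (eps ^+ P.(lam2) * t2).
  apply/funext => u; rewrite /sol_ray_integrand /borel_laplace_integrand -/em; ring.
apply: (@laplace_rotate _ _ hP _ N (K * expR (- ((beta - 1) * `|m|)) * normc em) t t' c _ _ N0 _ TE T20 h3 h4).
  by rewrite !mulr_ge0 ?expR_ge0 ?normc_ge0.
move=> r s r0 hs.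
have Ss : S (r%:C * expi s).
  apply: sector_cone => //; apply: sector_expi.
  move: hs; rewrite ge_min le_max; case/andP: h1 => h5 h6; case/andP: h2 => h7 h8.
  by clear -h5 h6 h7 h8 => /andP[/orP[] ? /orP[] ?]; apply/andP; split; lra.
split.
  apply: (differentiableM (f := fun u : C => w u m) (g := fun=> em)); first exact: hw.
  exact: differentiable_cst.
have nr : normc (r%:C * expi s) = r by rewrite normcM normc_expi mulr1 normc_real gtr0_norm.
rewrite normcM; have := gw _ m Ss; rewrite nr => h.
rewrite [leRHS](_ : _ = K * r * expR (N * r ^+ kp) * expR (- ((beta - 1) * `|m|)) * normc em); last by ring.
by rewrite ler_wpM2r// normc_ge0.
Qed.

End Solutions.

Section LocalEquality.
Variable R : realType.
Local Notation C := R[i].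

Lemma near_eq_differentiable (V : normedModType C) (f g : V -> C) (x : V) :
  (\forall y \near x, f y = g y) -> differentiable g x -> differentiable f x.
Proof.
move=> /nbhs_normP[e /= e0 he] dg.
have [d d0 de] := ltC_real e0.
apply: (@quadratic_differentiable2 R V f g x 0 d dg d0) => h hd.
have hx : f (h + x) = g (h + x).
  by apply: he; rewrite /= opprD addrCA subrr addr0 normrN de.
by rewrite hx subrr normr0 mul0r.
Qed.

Lemma is_deriveMl (k : C) (f : C -> C) (x l : C) :
  is_derive x 1 f l -> is_derive x 1 (fun y => k * f y) (k * l).
Proof.
move=> /is_derive_normcP hf; apply/is_derive_normcP => e e0.
have k0 : 0 < normc k + 1 by have := normc_ge0 k; lra.
have [d d0 hd] := hf (e / (normc k + 1)) (divr_gt0 e0 k0).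
exists d => // y /hd h.
have -> : k * f y - k * f x - (y - x) * (k * l) = k * (f y - f x - (y - x) * l) by ring.
rewrite normcM; apply: (le_trans (ler_wpM2l (normc_ge0 k) h)).
rewrite mulrA ler_wpM2r ?normc_ge0// mulrCA -[leRHS]mulr1 ler_wpM2l ?(ltW e0)//.
by rewrite ler_pdivrMr//; lra.
Qed.

End LocalEquality.

(** * The operators of the equation acting on solutions with variable direction *)

Section InnerSolutionDerivatives.
Variable R : realType.
Variable P : equation_data R.
Hypothesis hP : equation_hyp P.
Local Notation C := R[i].
Local Notation k1 := P.(k1).
Local Notation k2 := P.(k2).
Local Notation kp := P.(kp).
Local Notation beta := P.(beta).
Local Notation lf := (laplace_fourier k1 k2).
Local Notation fconst := (((Num.sqrt (2 * pi))^-1)%:C : C).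
Variables (a1 a2 : R).
Hypothesis a12 : a2 - a1 <= 2 * pi - pi / k2%:R.
Local Notation S := (@sector R a1 a2).
Local Notation tame := (tame kp beta S).
Implicit Types (w : C -> R -> C).

Variables (D1 D2 : set C) (bz : R) (eps : C) (xi : C -> C -> R).
Hypothesis bz_beta : bz <= beta.
Hypotheses (D1_open : open D1) (D2_open : open D2).
Hypothesis D1_neq0 : forall t1, D1 t1 -> t1 != 0.
Hypothesis xi_good : forall t1 t2, D1 t1 -> D2 t2 ->
  S (expi (xi t1 t2)) /\ good_direction 0 k2 (xi t1 t2) (eps ^+ P.(lam2) * t2).

Definition directed_sol w (t1 t2 z : C) : C := inner_sol P w (xi t1 t2) t1 t2 z eps.

Definition on_domain (Q : C -> C -> C -> Prop) : Prop :=
  forall t1 t2 z, D1 t1 -> D2 t2 -> strip bz z -> Q t1 t2 z.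

Lemma strip_beta z : strip bz z -> `|Im z| < beta.
Proof. by move=> /lt_le_trans; apply. Qed.

Lemma D2_neq0 t1 t2 : D1 t1 -> D2 t2 -> t2 != 0.
Proof.
by move=> d1 d2; have [_ [+ _]] := xi_good d1 d2; apply: contraNN => /eqP ->; rewrite mulr0.
Qed.

Definition ray_coef1 (x t : C) : C := (x / (eps ^+ P.(lam1) * t)) ^+ k1.
Definition ray_coef2 (x t : C) : C := (x / (eps ^+ P.(lam2) * t)) ^+ k2.

(** Derivatives are always taken of the right-hand side, whose direction stays that of (t1, t2)
    while the point moves to (s1, s2); [good_near] supplies the hypothesis on s2 nearby. *)
Lemma directed_sol_fixed w t1 t2 s1 s2 z : tame w -> D1 t1 -> D2 t2 -> D1 s1 -> D2 s2 ->
  good_direction 0 k2 (xi t1 t2) (eps ^+ P.(lam2) * s2) ->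
  directed_sol w s1 s2 z = fconst * lf (wray (xi t1 t2) w)
    (ray_coef1 (expi (xi t1 t2)) s1) (ray_coef2 (expi (xi t1 t2)) s2) z.
Proof.
move=> tw d1 d2 ds1 ds2 g; have [S1 g1] := xi_good ds1 ds2; have [S2 g2] := xi_good d1 d2.
by rewrite /directed_sol (inner_sol_rotate hP a12 s1 z tw S1 S2 g1 g) inner_sol_laplace.
Qed.

Lemma good_near t1 t2 : D1 t1 -> D2 t2 ->
  \forall s2 \near t2, good_direction 0 k2 (xi t1 t2) (eps ^+ P.(lam2) * s2).
Proof.
move=> d1 d2; have [_ g] := xi_good d1 d2.
have c : {for t2, continuous (fun s => eps ^+ P.(lam2) * s)}.
  by apply: continuous_mulC; [exact: cst_continuous|exact: cvg_id].
exact: (c _ (good_direction_near g)).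
Qed.

Lemma ray_coef2_gt0 t1 t2 : D1 t1 -> D2 t2 -> 0 < Re (ray_coef2 (expi (xi t1 t2)) t2).
Proof. by move=> d1 d2; have [_ g] := xi_good d1 d2; exact: good_direction_Re g. Qed.

Lemma wray_weight_xi w t1 t2 : tame w -> D1 t1 -> D2 t2 ->
  weight kp beta (wray (xi t1 t2) w).
Proof.
move=> tw d1 d2; have [Sx _] := xi_good d1 d2.
by apply: (@wray_weight R kp beta S) => // r r0; exact: sector_cone.
Qed.

Lemma ray_coefE (lam k : nat) (x t : C) :
  (x / (eps ^+ lam * t)) ^+ k = (x / eps ^+ lam) ^+ k * t^-1 ^+ k.
Proof. by rewrite invfM mulrA exprMn. Qed.

(** The symbol of t^(k+1) d/dt: tau is dual to T = eps^lam t, and differentiating exp(-(tau/T)^k)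
    brings out k tau^k eps^(-lam k) t^(-k-1). *)
Definition irreg_symbol (k lam : nat) w (tau : C) (m : R) : C :=
  k%:R * eps^-1 ^+ (lam * k) * (tau ^+ k * w tau m).

Lemma kp_gt1 : (1 < kp)%N.
Proof. by have /andP[] := orders_kp2 hP. Qed.

Lemma irreg_symbol_tame k lam w : tame w -> tame (irreg_symbol k lam w).
Proof. by move=> tw; apply: tameZ; apply: tame_tauX => //; exact: kp_gt1. Qed.

Lemma wray_irreg_symbol k lam (x : R) w r m : wray x (irreg_symbol k lam w) r m =
  k%:R * (expi x / eps ^+ lam) ^+ k * (r%:C ^+ k * wray x w r m).
Proof.
rewrite /wray; case: ifP => r0; last by rewrite !mulr0.
rewrite /irreg_symbol exprM exprVn.
move: (w _ _) => v; move: (eps ^+ lam)^-1 (expi x) (r%:C)^-1 => e x' i; move: (r%:C) => r'.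
by rewrite !exprMn; move: (e ^+ k) (x' ^+ k) (r' ^+ k) => a b d; ring.
Qed.

Lemma lf_irreg_symbol k lam w t1 t2 z (a : C) : tame w -> D1 t1 -> D2 t2 -> strip bz z ->
  lf (wray (xi t1 t2) (irreg_symbol k lam w)) a (ray_coef2 (expi (xi t1 t2)) t2) z =
  k%:R * (expi (xi t1 t2) / eps ^+ lam) ^+ k *
   lf (fun r m => r%:C ^+ k * wray (xi t1 t2) w r m) a (ray_coef2 (expi (xi t1 t2)) t2) z.
Proof.
move=> tw d1 d2 sz.
have wX := weight_rX (orders_kp2 hP) k (wray_weight_xi tw d1 d2).
have E := laplace_fourierZ (orders_k12 hP) (orders_kp2 hP)
  (k%:R * (expi (xi t1 t2) / eps ^+ lam) ^+ k) a wX (ray_coef2_gt0 d1 d2) (strip_beta sz).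
have H : wray (xi t1 t2) (irreg_symbol k lam w) = (fun r m =>
    k%:R * (expi (xi t1 t2) / eps ^+ lam) ^+ k * (r%:C ^+ k * wray (xi t1 t2) w r m)).
  by apply/funext => r; apply/funext => m; rewrite wray_irreg_symbol.
by rewrite H; exact: E.
Qed.

Lemma is_derive_directed_sol1 w t1 t2 z : tame w -> D1 t1 -> D2 t2 -> strip bz z ->
  is_derive t1 1 (fun s => directed_sol w s t2 z)
    (t1^-1 ^+ k1.+1 * directed_sol (irreg_symbol k1 P.(lam1) w) t1 t2 z).
Proof.
move=> tw d1 d2 sz; have [_ g] := xi_good d1 d2.
rewrite (directed_sol_fixed _ (irreg_symbol_tame _ _ tw) d1 d2 d1 d2 g).
rewrite lf_irreg_symbol//.
pose F s := fconst * lf (wray (xi t1 t2) w) ((expi (xi t1 t2) / eps ^+ P.(lam1)) ^+ k1 * s^-1 ^+ k1)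
  (ray_coef2 (expi (xi t1 t2)) t2) z.
apply: (near_eq_is_derive (f := F)).
  have h : \forall s \near t1, D1 s by exact: open_nbhs_nbhs.
  apply: filterS h => s ds.
  by rewrite (directed_sol_fixed z tw d1 d2 ds d2 g) /ray_coef1 ray_coefE.
have w1 := wray_weight_xi tw d1 d2.
have h1 := laplace_fourier_is_derive1 (orders_k12 hP) (orders_kp2 hP)
  (ray_coef1 (expi (xi t1 t2)) t1) w1 (ray_coef2_gt0 d1 d2) (strip_beta sz).
rewrite /ray_coef1 ray_coefE in h1 *.
have h2 := is_deriveMl ((expi (xi t1 t2) / eps ^+ P.(lam1)) ^+ k1) (is_derive_invX k1 (D1_neq0 d1)).
have h3 := is_deriveMl fconst (is_derive_compC h2 h1).
apply: (is_derive_eq h3); move: (lf _ _ _ _) => x; move: (_ ^+ k1) (fconst) => y v; ring.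
Qed.

Lemma is_derive_directed_sol2 w t1 t2 z : tame w -> D1 t1 -> D2 t2 -> strip bz z ->
  is_derive t2 1 (fun s => directed_sol w t1 s z)
    (t2^-1 ^+ k2.+1 * directed_sol (irreg_symbol k2 P.(lam2) w) t1 t2 z).
Proof.
move=> tw d1 d2 sz; have [_ g] := xi_good d1 d2.
rewrite (directed_sol_fixed _ (irreg_symbol_tame _ _ tw) d1 d2 d1 d2 g).
rewrite lf_irreg_symbol//.
pose F s := fconst * lf (wray (xi t1 t2) w) (ray_coef1 (expi (xi t1 t2)) t1)
  ((expi (xi t1 t2) / eps ^+ P.(lam2)) ^+ k2 * s^-1 ^+ k2) z.
apply: (near_eq_is_derive (f := F)).
  have h : \forall s \near t2, D2 s by exact: open_nbhs_nbhs.
  apply: filterS2 h (good_near d1 d2) => s ds gs.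
  by rewrite (directed_sol_fixed z tw d1 d2 d1 ds gs) /ray_coef2 ray_coefE.
have w1 := wray_weight_xi tw d1 d2.
have h1 := laplace_fourier_is_derive2 (orders_k12 hP) (orders_kp2 hP)
  (ray_coef1 (expi (xi t1 t2)) t1) w1 (ray_coef2_gt0 d1 d2) (strip_beta sz).
rewrite /ray_coef2 ray_coefE in h1 *.
have h2 := is_deriveMl ((expi (xi t1 t2) / eps ^+ P.(lam2)) ^+ k2) (is_derive_invX k2 (D2_neq0 d1 d2)).
have h3 := is_deriveMl fconst (is_derive_compC h2 h1).
apply: (is_derive_eq h3); move: (lf _ _ _ _) => x; move: (_ ^+ k2) (fconst) => y v; ring.
Qed.

Lemma directed_solD w1 w2 t1 t2 z : tame w1 -> tame w2 -> D1 t1 -> D2 t2 -> strip bz z ->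
  directed_sol (fun tau m => w1 tau m + w2 tau m) t1 t2 z =
  directed_sol w1 t1 t2 z + directed_sol w2 t1 t2 z.
Proof.
move=> tw1 tw2 d1 d2 sz; rewrite /directed_sol !inner_sol_laplace -mulrDr.
have E := laplace_fourierD (orders_k12 hP) (orders_kp2 hP) (ray_coef1 (expi (xi t1 t2)) t1)
  (wray_weight_xi tw1 d1 d2) (wray_weight_xi tw2 d1 d2) (ray_coef2_gt0 d1 d2) (strip_beta sz).
apply: (congr1 (fun x : C => fconst * x)); apply: etrans E.
apply: (congr1 (fun G => lf G _ _ _)); apply/funext => r; apply/funext => m.
by rewrite /wray; case: ifP; rewrite ?addr0// mulrDl.
Qed.

Lemma directed_solZ (k : C) w t1 t2 z : tame w -> D1 t1 -> D2 t2 -> strip bz z ->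
  directed_sol (fun tau m => k * w tau m) t1 t2 z = k * directed_sol w t1 t2 z.
Proof.
move=> tw d1 d2 sz; rewrite /directed_sol !inner_sol_laplace mulrCA.
have E := laplace_fourierZ (orders_k12 hP) (orders_kp2 hP) k (ray_coef1 (expi (xi t1 t2)) t1)
  (wray_weight_xi tw d1 d2) (ray_coef2_gt0 d1 d2) (strip_beta sz).
apply: (congr1 (fun x : C => fconst * x)); apply: etrans E.
apply: (congr1 (fun G => lf G _ _ _)); apply/funext => r; apply/funext => m.
by rewrite /wray; case: ifP; rewrite ?mulr0// mulrA.
Qed.

Lemma eq_directed_sol w w' t1 t2 z : (forall tau m, w tau m = w' tau m) ->
  directed_sol w t1 t2 z = directed_sol w' t1 t2 z.
Proof.
move=> ww; have -> // : w = w'.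
by apply/funext => tau; apply/funext.
Qed.

Lemma tame_imX j w : tame w -> tame (fun tau m => (0 +i* m) ^+ j * w tau m).
Proof.
move=> /(tame_poly ('X^j)); rewrite (_ : (fun _ _ => _) = (fun tau m => (0 +i* m) ^+ j * w tau m))//.
by apply/funext => tau; apply/funext => m; rewrite hornerXn.
Qed.

Lemma directed_sol0 t1 t2 z : D1 t1 -> D2 t2 -> strip bz z ->
  directed_sol (fun _ _ => 0) t1 t2 z = 0.
Proof.
move=> d1 d2 sz.
apply: (etrans _ (etrans (directed_solZ 0 (tame0 kp beta S) d1 d2 sz) (mul0r _))).
by apply: eq_directed_sol => tau m; rewrite mul0r.
Qed.

Lemma directed_sol_sum I (r : seq I) (F : I -> C -> R -> C) t1 t2 z :
  (forall i, tame (F i)) -> D1 t1 -> D2 t2 -> strip bz z ->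
  directed_sol (fun tau m => \sum_(i <- r) F i tau m) t1 t2 z =
  \sum_(i <- r) directed_sol (F i) t1 t2 z.
Proof.
move=> tF d1 d2 sz; elim: r => [|i r IH].
  apply: (etrans _ (etrans (directed_sol0 d1 d2 sz) _)); last by rewrite big_nil.
  by apply: eq_directed_sol => tau m; rewrite big_nil.
have tr : tame (fun tau m => \sum_(i <- r) F i tau m) by exact: tame_sum.
rewrite big_cons -IH; apply: (etrans _ (directed_solD (tF i) tr d1 d2 sz)).
by apply: eq_directed_sol => tau m; rewrite big_cons.
Qed.

Lemma is_derive_directed_sol3 w t1 t2 z : tame w -> D1 t1 -> D2 t2 -> strip bz z ->
  is_derive z 1 (directed_sol w t1 t2)
    (directed_sol (fun tau m => (0 +i* m) * w tau m) t1 t2 z).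
Proof.
move=> tw d1 d2 sz; have w1 := wray_weight_xi tw d1 d2.
have tm := tame_mX 1 tw.
have -> : (fun tau m => (0 +i* m) * w tau m) = (fun tau m => (0 +i* 1) * (m%:C ^+ 1 * w tau m)).
  apply/funext => tau; apply/funext => m; rewrite mulrA.
  by apply: (congr1 (fun x : C => x * _)); apply: complex_ext => /=; ring.
rewrite directed_solZ//.
have h1 := is_deriveMl fconst (laplace_fourier_is_derive3 (orders_k12 hP) (orders_kp2 hP)
  (ray_coef1 (expi (xi t1 t2)) t1) w1 (ray_coef2_gt0 d1 d2) (strip_beta sz)).
rewrite (_ : directed_sol w t1 t2 = (fun z => fconst * lf (wray (xi t1 t2) w)
  (ray_coef1 (expi (xi t1 t2)) t1) (ray_coef2 (expi (xi t1 t2)) t2) z)); last first.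
  by apply/funext => y; rewrite /directed_sol inner_sol_laplace.
apply: (is_derive_eq h1); rewrite /directed_sol inner_sol_laplace mulrCA.
apply: (congr1 (fun G => (0 +i* 1) * (fconst * lf G _ _ _))).
by apply/funext => r; apply/funext => m; rewrite /wray; case: ifP => r0; rewrite ?mulr0// mulrA.
Qed.

Lemma derive1n_directed_sol w t1 t2 z i : tame w -> D1 t1 -> D2 t2 -> strip bz z ->
  derive1n i (directed_sol w t1 t2) z = directed_sol (fun tau m => (0 +i* m) ^+ i * w tau m) t1 t2 z.
Proof.
move=> tw d1 d2; elim: i z => [|i IH] z sz.
  by apply: eq_directed_sol => tau m; rewrite expr0 mul1r.
rewrite derive1nS derive1E (near_eq_derive (g := directed_sol (fun tau m => (0 +i* m) ^+ i * w tau m) t1 t2)).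
  have [_ ->] := is_derive_directed_sol3 (tame_imX i tw) d1 d2 sz.
  by apply: eq_directed_sol => tau m; rewrite exprS mulrA.
have h : \forall y \near z, strip bz y by apply: open_nbhs_nbhs; split => //; exact: strip_open.
by apply: filterS h => y; exact: IH.
Qed.

Lemma poly_dz_directed_sol (p : {poly C}) w : tame w ->
  on_domain (fun t1 t2 z => poly_dz p (directed_sol w) t1 t2 z =
    directed_sol (fun tau m => p.[0 +i* m] * w tau m) t1 t2 z).
Proof.
move=> tw t1 t2 z d1 d2 sz; rewrite /poly_dz.
have tX j : tame (fun tau m => p`_j * ((0 +i* m) ^+ j * w tau m)).
  by apply: tameZ; exact: tame_imX.
rewrite -(big_mkord xpredT (fun i => p`_i * derive1n i (directed_sol w t1 t2) z)).
rewrite /index_iota subn0.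
have E := directed_sol_sum (iota 0 (size p)) tX d1 d2 sz.
apply: (@etrans _ _ (directed_sol (fun tau m => \sum_(j <- iota 0 (size p)) p`_j * ((0 +i* m) ^+ j * w tau m)) t1 t2 z)).
  apply: (etrans _ (esym E)); apply: eq_bigr => i _.
  apply: (etrans _ (esym (directed_solZ p`_i (tame_imX i tw) d1 d2 sz))).
  by apply: (congr1 (fun x : C => p`_i * x)); exact: derive1n_directed_sol.
apply: eq_directed_sol => tau m; rewrite horner_coef mulr_suml.
rewrite -(big_mkord xpredT (fun i => p`_i * (0 +i* m) ^+ i * w tau m)) /index_iota subn0.
by apply: eq_bigr => i _; rewrite mulrA.
Qed.

(** The factor [c z] makes the statement apply to products c(z) R(d/dz) u: it is constant in t1 and
    t2. Being stated on an open domain, the identity can be differentiated again, which allows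
    iteration. *)
Lemma irreg1_directed_sol (V : C -> C -> C -> C) (c : C -> C) w : tame w ->
  on_domain (fun t1 t2 z => V t1 t2 z = c z * directed_sol w t1 t2 z) ->
  on_domain (fun t1 t2 z => irreg1 k1 V t1 t2 z =
    c z * directed_sol (irreg_symbol k1 P.(lam1) w) t1 t2 z).
Proof.
move=> tw hV t1 t2 z d1 d2 sz; rewrite /irreg1 derive1E.
rewrite (near_eq_derive (g := fun s => c z * directed_sol w s t2 z)).
  have [_ ->] := is_deriveMl (c z) (is_derive_directed_sol1 tw d1 d2 sz).
  rewrite [RHS](_ : _ = t1 ^+ k1.+1 * t1^-1 ^+ k1.+1 * (c z * directed_sol (irreg_symbol k1 P.(lam1) w) t1 t2 z)).
    by move: (directed_sol _ _ _ _) => v; ring.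
  by rewrite -exprMn mulfV ?D1_neq0// expr1n mul1r.
have h : \forall s \near t1, D1 s by exact: open_nbhs_nbhs.
by apply: filterS h => s ds; exact: hV.
Qed.

Lemma irreg2_directed_sol (V : C -> C -> C -> C) (c : C -> C) w : tame w ->
  on_domain (fun t1 t2 z => V t1 t2 z = c z * directed_sol w t1 t2 z) ->
  on_domain (fun t1 t2 z => irreg2 k2 V t1 t2 z =
    c z * directed_sol (irreg_symbol k2 P.(lam2) w) t1 t2 z).
Proof.
move=> tw hV t1 t2 z d1 d2 sz; rewrite /irreg2 derive1E.
rewrite (near_eq_derive (g := fun s => c z * directed_sol w t1 s z)).
  have [_ ->] := is_deriveMl (c z) (is_derive_directed_sol2 tw d1 d2 sz).
  rewrite [RHS](_ : _ = t2 ^+ k2.+1 * t2^-1 ^+ k2.+1 * (c z * directed_sol (irreg_symbol k2 P.(lam2) w) t1 t2 z)).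
    by move: (directed_sol _ _ _ _) => v; ring.
  by rewrite -exprMn mulfV ?(D2_neq0 d1 d2)// expr1n mul1r.
have h : \forall s \near t2, D2 s by exact: open_nbhs_nbhs.
by apply: filterS h => s ds; exact: hV.
Qed.

Lemma irreg_symbol_iter n k lam w tau m : iter n (irreg_symbol k lam) w tau m =
  eps^-1 ^+ (lam * k * n) * (k%:R * tau ^+ k) ^+ n * w tau m.
Proof.
elim: n => [|n IH] /=; first by rewrite muln0 !mul1r.
by rewrite /irreg_symbol IH mulnS exprD !exprS; ring.
Qed.

Lemma iter_irreg_directed_sol (n1 n2 : nat) (V : C -> C -> C -> C) (c : C -> C) w : tame w ->
  on_domain (fun t1 t2 z => V t1 t2 z = c z * directed_sol w t1 t2 z) ->
  on_domain (fun t1 t2 z => iter n1 (irreg1 k1) (iter n2 (irreg2 k2) V) t1 t2 z =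
    c z * directed_sol (fun tau m => eps^-1 ^+ (P.(lam1) * k1 * n1) * (k1%:R * tau ^+ k1) ^+ n1 *
      (eps^-1 ^+ (P.(lam2) * k2 * n2) * (k2%:R * tau ^+ k2) ^+ n2 * w tau m)) t1 t2 z).
Proof.
move=> tw hV t1 t2 z d1 d2 sz.
have h2 n : tame (iter n (irreg_symbol k2 P.(lam2)) w) /\
   on_domain (fun t1 t2 z => iter n (irreg2 k2) V t1 t2 z =
     c z * directed_sol (iter n (irreg_symbol k2 P.(lam2)) w) t1 t2 z).
  elim: n => [//|n [IH1 IH2]] /=; split; first exact: irreg_symbol_tame.
  exact: irreg2_directed_sol.
have h1 n : tame (iter n (irreg_symbol k1 P.(lam1)) (iter n2 (irreg_symbol k2 P.(lam2)) w)) /\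
   on_domain (fun t1 t2 z => iter n (irreg1 k1) (iter n2 (irreg2 k2) V) t1 t2 z =
     c z * directed_sol (iter n (irreg_symbol k1 P.(lam1)) (iter n2 (irreg_symbol k2 P.(lam2)) w)) t1 t2 z).
  elim: n => [|n [IH1 IH2]] /=; first exact: h2.
  split; first exact: irreg_symbol_tame.
  exact: irreg1_directed_sol.
have [_ ->] := h1 n1; [|by []..].
apply: (congr1 (fun x : C => c z * x)); apply: eq_directed_sol => tau m.
by rewrite !irreg_symbol_iter.
Qed.

(** Near each point the solution is a Laplace-Fourier integral composed with [phi], which maps (t1,
    t2, z) to the coordinates (a, b, z) of a frozen direction. *)
Lemma directed_sol_holomorphic w : tame w ->
  holomorphic_on (D1 `*` D2 `*` strip bz) (fun p : C * C * C => directed_sol w p.1.1 p.1.2 p.2).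
Proof.
move=> tw -[[t1 t2] z] /= [[d1 d2] sz]; have [_ g] := xi_good d1 d2.
pose A := (expi (xi t1 t2) / eps ^+ P.(lam1)) ^+ k1 : C.
pose B := (expi (xi t1 t2) / eps ^+ P.(lam2)) ^+ k2 : C.
pose phi (p : C * C * C) : C * C * C := (A * p.1.1^-1 ^+ k1, B * p.1.2^-1 ^+ k2, p.2).
pose L (p : C * C * C) := lf (wray (xi t1 t2) w) p.1.1 p.1.2 p.2.
apply: (near_eq_differentiable (g := fun p => fconst * L (phi p))).
  have h1 : \forall s \near t1, D1 s by exact: open_nbhs_nbhs.
  have h2 : \forall s \near t2, D2 s by exact: open_nbhs_nbhs.
  have c11 : {for (t1, t2, z), continuous (fun p : C * C * C => p.1.1)}.
    by apply: (continuous_compC (g := fst) (f := fst)); exact: cvg_fst.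
  have c12 : {for (t1, t2, z), continuous (fun p : C * C * C => p.1.2)}.
    by apply: (continuous_compC (g := fst) (f := snd)); [exact: cvg_fst|exact: cvg_snd].
  have n1 : \forall p \near (t1, t2, z), D1 p.1.1 by exact: (c11 _ h1).
  have n2 : \forall p \near (t1, t2, z), D2 p.1.2 by exact: (c12 _ h2).
  have n3 : \forall p \near (t1, t2, z), good_direction 0 k2 (xi t1 t2) (eps ^+ P.(lam2) * p.1.2).
    exact: (c12 _ (good_near d1 d2)).
  apply: filterS (filterI (filterI n1 n2) n3) => -[[s1 s2] y] /= [[e1 e2] e3].
  by rewrite (directed_sol_fixed y tw d1 d2 e1 e2 e3) /L /phi /= /ray_coef1 /ray_coef2 !ray_coefE.
apply: (differentiableM (f := fun=> fconst) (g := fun p => L (phi p))); first exact: differentiable_cst.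
have dinv (k : nat) (K s : C) : s != 0 -> differentiable (fun x : C => K * x^-1 ^+ k) s.
  move=> s0; apply/derivable1_diffP.
  by have [] := is_deriveMl K (is_derive_invX k s0).
apply: (differentiable_comp (f := phi) (g := L)).
  apply: (differentiable_pair (f := fun p : C * C * C => (A * p.1.1^-1 ^+ k1, B * p.1.2^-1 ^+ k2)) (g := snd));
    last exact: differentiable_snd.
  apply: (differentiable_pair (f := fun p : C * C * C => A * p.1.1^-1 ^+ k1) (g := fun p : C * C * C => B * p.1.2^-1 ^+ k2)).
    apply: (differentiable_comp (f := fun p : C * C * C => p.1.1) (g := fun x : C => A * x^-1 ^+ k1)).
      by apply: (differentiable_comp (f := fst) (g := fst)); exact: differentiable_fst.
    by apply: dinv; exact: D1_neq0.
  apply: (differentiable_comp (f := fun p : C * C * C => p.1.2) (g := fun x : C => B * x^-1 ^+ k2)).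
    by apply: (differentiable_comp (f := fst) (g := snd)); [exact: differentiable_fst|exact: differentiable_snd].
  by apply: dinv; exact: (D2_neq0 d1 d2).
have b0 : 0 < Re (B * t2^-1 ^+ k2) by have := ray_coef2_gt0 d1 d2; rewrite /ray_coef2 ray_coefE.
exact: (laplace_fourier_differentiable (orders_k12 hP) (orders_kp2 hP) (A * t1^-1 ^+ k1)
  (wray_weight_xi tw d1 d2) b0 (strip_beta sz)).
Qed.

End InnerSolutionDerivatives.

(** * The main equation *)

Section Convolution.
Variable R : realType.
Local Notation C := R[i].
Local Notation mu := (@lebesgue_measure R).
Local Notation fconst := (((Num.sqrt (2 * pi))^-1)%:C : C).

Lemma continuous_cmeasurable (f : R -> C) : continuous f -> cmeasurable setT f.
Proof.
move=> cf; split; apply: continuous_measurable_fun => x.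
  exact: (continuous_compC (g := f) (f := Re) (cf x) (@continuous_Re R _)).
exact: (continuous_compC (g := f) (f := Im) (cf x) (@continuous_Im R _)).
Qed.

Lemma continuous_cexpi (z : C) : continuous (fun m : R => cexp ((0 +i* 1) * z * m%:C)).
Proof.
move=> x; apply: (continuous_compC (g := fun m : R => (0 +i* 1) * z * m%:C) (f := @cexp R));
  last exact: continuous_cexp.
by apply: (continuous_mulC (f := fun=> _)); [exact: cst_continuous|exact: continuous_realC].
Qed.

Lemma normc_cexpi (z : C) (m : R) :
  normc (cexp ((0 +i* 1) * z * m%:C)) <= expR (`|Im z| * `|m|).
Proof.
rewrite normc_cexp ler_expR -normrM (_ : Re _ = - (Im z * m)); last by case: z => x y /=; ring.
by rewrite -normrN ler_norm.
Qed.

(** Measurability rather than continuity is asked, because ray integrals obtained from Fubini's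
    theorem are handled only as measurable functions of m. *)
Definition decays (b0 : R) (h : R -> C) : Prop := cmeasurable setT h /\
  forall b, b < b0 -> exists2 K : R, 0 <= K & forall m, normc (h m) <= K * expR (- (b * `|m|)).

Lemma decays_integrable b0 h z : decays b0 h -> `|Im z| < b0 ->
  cintegrable setT (fun m => h m * cexp ((0 +i* 1) * z * m%:C)).
Proof.
move=> [mh hh] zb; pose b := (`|Im z| + b0) / 2.
have [|K K0 hK] := hh b; first by rewrite /b; lra.
have bz : 0 < b - `|Im z| by rewrite /b; lra.
apply: (cintegrable_dom (g := fun m => K * expR (- ((b - `|Im z|) * `|m|)))) => //.
- by apply: cmeasurableM => //; apply: continuous_cmeasurable; exact: continuous_cexpi.
- exact: (integrableZl measurableT K (integrable_expN bz)).
move=> m _; rewrite normcM (_ : - ((b - `|Im z|) * `|m|) = - (b * `|m|) + `|Im z| * `|m|); last by ring.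
by rewrite expRD mulrA ler_pM ?normc_ge0// normc_cexpi.
Qed.

Lemma decays_continuous b0 h (K : R) : continuous h ->
  (forall m, normc (h m) <= K * expR (- (b0 * `|m|))) -> decays b0 h.
Proof.
move=> ch hK; split; first exact: continuous_cmeasurable.
move=> b bb; exists `|K| => // m; apply: (le_trans (hK m)).
rewrite ler_pM ?expR_ge0 ?ler_norm//; last by rewrite ler_expR lerN2 ler_wpM2r// ltW.
by have := le_trans (normc_ge0 _) (hK m); rewrite pmulr_lge0// expR_gt0.
Qed.

(** Multiplication by exp(i z m) splits as exp(i z (m - m1)) exp(i z m1); after exchanging the
    integrals, the inner one is a translate of the transform of f. *)
Lemma inv_fourier_conv (b0 : R) (f h : R -> C) (z : C) (Kf : R) : continuous f ->
  (forall m, normc (f m) <= Kf * expR (- (b0 * `|m|))) -> decays b0 h -> `|Im z| < b0 ->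
  [/\ forall m, cintegrable setT (fun m1 => f (m - m1) * h m1),
      cintegrable setT (fun m => fconst * cint setT (fun m1 => f (m - m1) * h m1)
        * cexp ((0 +i* 1) * z * m%:C)) &
      inv_fourier (fun m => fconst * cint setT (fun m1 => f (m - m1) * h m1)) z =
        inv_fourier f z * inv_fourier h z].
Proof.
move=> cf fK dh zb; have dh' := dh; have [mh hh] := dh'.
(* Decay of f at rate b beats exp(|Im z| |m|), but passing from |m - m1| to |m| costs exp(b |m1|);
   the larger rate b' of h pays for it. *)
pose b := (`|Im z| + b0) / 2; pose b' := (b + b0) / 2.
have bz : 0 < b - `|Im z| by rewrite /b; lra.
have b0' : 0 <= b by rewrite /b; have := normr_ge0 (Im z); lra.
have bb' : 0 < b' - b by rewrite /b' /b; lra.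
have [|K' K'0 hK] := hh b'; first by rewrite /b' /b; lra.
have [_ df] := decays_continuous cf fK.
have [|K1 K10 {}fK] := df b; first by rewrite /b; lra.
pose e m := cexp ((0 +i* 1) * z * m%:C).
have me : cmeasurable setT e by apply: continuous_cmeasurable; exact: continuous_cexpi.
pose F m m1 := f (m - m1) * h m1 * e m.
have mF : cmeasurable2 F.
  apply: cmeasurableM; last exact: cmeasurable2_l.
  by apply: cmeasurableM; [apply: cmeasurable2_sub; exact: continuous_cmeasurable|exact: cmeasurable2_r].
have hb4 (m m1 : R) : expR (- (b * `|m - m1|)) <= expR (- (b * `|m|)) * expR (b * `|m1|).
  rewrite -expRD ler_expR; have := ler_normD (m - m1) m1; rewrite subrK => /(ler_wpM2l b0').
  by rewrite mulrDr; lra.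
have hF m m1 : normc (F m m1) <=
    (K1 * expR (- ((b - `|Im z|) * `|m|))) * (K' * expR (- ((b' - b) * `|m1|))).
  rewrite /F !normcM.
  have h5 := ler_wpM2l K10 (hb4 m m1).
  have h6 := ler_pM (normc_ge0 _) (normc_ge0 _) (le_trans (fK (m - m1)) h5) (hK m1).
  apply: (le_trans (ler_pM (mulr_ge0 (normc_ge0 _) (normc_ge0 _)) (normc_ge0 _) h6 (normc_cexpi z m))).
  rewrite (_ : - ((b - `|Im z|) * `|m|) = - (b * `|m|) + `|Im z| * `|m|); last by ring.
  rewrite (_ : - ((b' - b) * `|m1|) = b * `|m1| + - (b' * `|m1|)); last by ring.
  rewrite !expRD le_eqVlt; apply/orP; left; apply/eqP; ring.
have [F1 F2 F3 F4 F5] := cfubini mF (integrableZl measurableT K1 (integrable_expN bz))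
  (integrableZl measurableT K' (integrable_expN bb')) hF.
have ce m : cexp (- ((0 +i* 1) * z * m%:C)) * e m = 1 by rewrite -cexpD addNr cexp0.
have I1 m : cintegrable setT (fun m1 => f (m - m1) * h m1).
  apply: (eq_cintegrable (f := fun m1 => cexp (- ((0 +i* 1) * z * m%:C)) * F m m1) measurableT);
    last exact: (cintegrableZ _ measurableT (F1 m)).
  by move=> m1 _; rewrite /F mulrCA ce mulr1.
have E1 m : cint setT (F m) = cint setT (fun m1 => f (m - m1) * h m1) * e m.
  rewrite [RHS]mulrC -(cintZ _ measurableT (I1 m)); apply: eq_cint => m1 _; exact: mulrC.
have E2 : (fun m => fconst * cint setT (fun m1 => f (m - m1) * h m1) * e m) =
    (fun m => fconst * cint setT (F m)).
  by apply/funext => m; rewrite E1 mulrA.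
split; [exact: I1|by rewrite E2; exact: (cintegrableZ _ measurableT F3)|].
rewrite /inv_fourier -/e E2 (cintZ _ measurableT F3) F5.
pose g m := f m * e m.
have cg : continuous g by move=> x; apply: continuous_mulC; [exact: cf|exact: continuous_cexpi].
have E3 m1 : cint setT (F^~ m1) = cint setT g * (h m1 * e m1).
  have E4 m : F m m1 = h m1 * e m1 * g (m - m1).
    have -> : F m m1 = f (m - m1) * h m1 * (e (m - m1) * e m1).
      by rewrite /F /e -cexpD -mulrDr -rmorphD/= subrK.
    by rewrite /g; move: (f _) (h m1) (e _) (e m1) => A B D G; ring.
  (* If the factor in m1 vanishes, both sides are 0; otherwise the integrability of the translate of
     g is recovered from that of F by dividing by it. *)
  rewrite -(cint_shift m1 cg) [RHS]mulrC; have [k0|k0] := eqVneq (h m1 * e m1) 0.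
    by rewrite k0 mul0r -[RHS](cint0 setT); apply: eq_cint => m _ /=; rewrite E4 k0 mul0r.
  have ig : cintegrable setT (fun m => g (m - m1)).
    apply: (eq_cintegrable (f := fun m => (h m1 * e m1)^-1 * F m m1) measurableT);
      last exact: (cintegrableZ _ measurableT (F2 m1)).
    by move=> m _ /=; rewrite E4 mulKf.
  by rewrite -(cintZ _ measurableT ig); apply: eq_cint => m _; exact: E4.
rewrite (eq_cint (fun m1 _ => E3 m1)) (cintZ _ measurableT (decays_integrable dh zb)).
rewrite /g /e; move: (cint _ _) (cint _ _) => A B; ring.
Qed.
End Convolution.

(** * The fixed point equation integrated along one ray *)

Section RayTransform.
Variable R : realType.
Variable P : equation_data R.
Hypothesis hP : equation_hyp P.
Local Notation C := R[i].
Local Notation k1 := P.(k1).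
Local Notation k2 := P.(k2).
Local Notation kp := P.(kp).
Local Notation beta := P.(beta).
Local Notation lf := (laplace_fourier k1 k2).
Local Notation fconst := (((Num.sqrt (2 * pi))^-1)%:C : C).
Variables (S : set C) (xi : R) (a b : C).
Hypothesis S_ray : forall r, 0 < r -> S (r%:C * expi xi).
Hypothesis b_gt0 : 0 < Re b.
Local Notation tame := (tame kp beta S).
Implicit Types (w : C -> R -> C).
Local Notation ker r := (cexp (kernel_exponent k1 k2 a b 0 r 0)).

Lemma kernel_exponent_at0 r m : kernel_exponent k1 k2 a b 0 r m = kernel_exponent k1 k2 a b 0 r 0.
Proof. by rewrite /kernel_exponent mulr0 !mul0r. Qed.

Lemma kernel_exponent_Fourier (z : C) r m : cexp (kernel_exponent k1 k2 a b z r m) =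
  ker r * cexp ((0 +i* 1) * z * m%:C).
Proof. by rewrite /kernel_exponent mulr0 addr0 cexpD. Qed.

Lemma Im0_beta : `|Im (0 : C)| < beta.
Proof. by rewrite /= normr0; exact: hyp_beta hP. Qed.

(** The Laplace integral at frequency m; in [ker] the Fourier factor is removed by taking z and m
    equal to 0, so that the solution is the inverse Fourier transform of this function. *)
Definition ray_transform w (m : R) : C := cint setT (fun r => wray xi w r m * ker r).

Lemma ray_dominated w : tame w -> dominated (fun r m => wray xi w r m * ker r).
Proof.
move=> tw; have := weight_dominated (orders_k12 hP) (orders_kp2 hP) a
  (wray_weight S_ray tw) b_gt0 Im0_beta.
rewrite (_ : (fun _ _ => _) = (fun r m => wray xi w r m * ker r))//.
by apply/funext => r; apply/funext => m; rewrite kernel_exponent_at0.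
Qed.

Lemma ray_transform_integrable w m : tame w -> cintegrable setT (fun r => wray xi w r m * ker r).
Proof. by move=> /ray_dominated/dominated_fubini[_ h _ _ _]; exact: h. Qed.

Lemma lf_ray_transform w z : tame w -> `|Im z| < beta ->
  fconst * lf (wray xi w) a b z = inv_fourier (ray_transform w) z.
Proof.
move=> tw zb; apply: (congr1 (fun x : C => fconst * x)); apply: eq_cint => m _.
rewrite [RHS]mulrC /ray_transform -(cintZ _ measurableT (ray_transform_integrable m tw)).
apply: eq_cint => r _; rewrite kernel_exponent_Fourier.
by move: (cexp _) (cexp _) => x y; ring.
Qed.

Lemma ray_transform_decays w : tame w -> decays beta (ray_transform w).
Proof.
move=> tw; have [_ _ _ h _] := dominated_fubini (ray_dominated tw).
split; first exact: cintegrable_cmeasurable h.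
have [_ [N N0 hG]] := wray_weight S_ray tw => b0 /hG[K K0 hK].
have [L L0 hL] := exponent_bound hP N (normc a) b_gt0.
have ie (k : R) : (@lebesgue_measure R).-integrable setT (EFin \o (fun r : R => k * expR (- (1 * `|r|)))).
  exact: (integrableZl measurableT k (integrable_expN ltr01)).
pose M := 2 * \int[@lebesgue_measure R]_(x in setT) expR (- (1 * `|x|)).
exists (M * (K * expR L)) => [|m].
  rewrite !mulr_ge0 ?expR_ge0//.
  by apply: Rintegral_ge0 => x _; exact: expR_ge0.
have hb r : normc (wray xi w r m * ker r) <= (K * expR L * expR (- (b0 * `|m|))) * expR (- (1 * `|r|)).
  have := hK r m; case: ifP => r0 hr; last first.
    have -> : wray xi w r m = 0 by apply/eqP; rewrite -normc_eq0 eq_le hr normc_ge0.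
    by rewrite mul0r normc0 !mulr_ge0 ?expR_ge0.
  have hk : normc (ker r) <= expR (normc a * r ^+ k1 - Re b * r ^+ k2).
    rewrite normc_cexp ler_expR /kernel_exponent mulr0 addr0 -!rmorphXn/=.
    rewrite cReD !cReN [b * _]mulrC complexRe_real [Re b * _]mulrC lerD2r.
    rewrite (le_trans (ler_norm _))// normrN (le_trans (normc_ge_absRe _))// normcM normc_real.
    by rewrite ger0_norm ?exprn_ge0// ltW.
  rewrite normcM; apply: (le_trans (ler_pM (normc_ge0 _) (normc_ge0 _) hr hk)).
  have := hL r (ltW r0); rewrite -ler_expR => hl.
  rewrite mul1r (gtr0_norm r0).
  rewrite [leLHS](_ : _ = K * expR (- (b0 * `|m|)) * expR (N * r ^+ kp + normc a * r ^+ k1 - Re b * r ^+ k2)); last first.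
    by rewrite -addrA [in RHS]expRD; move: (expR _) (expR _) (expR _) => x y v; ring.
  rewrite [leRHS](_ : _ = K * expR (- (b0 * `|m|)) * expR (L - r)); last by rewrite expRD; ring.
  by rewrite ler_wpM2l// mulr_ge0// expR_ge0.
apply: (le_trans (normc_cint_le measurableT (ray_transform_integrable m tw) (ie _) (fun r _ => hb r))).
rewrite RintegralZl//; last first.
  by have := ie 1; rewrite (_ : (fun r : R => 1 * _) = (fun r : R => expR (- (1 * `|r|))))//; apply/funext => r; rewrite mul1r.
by rewrite le_eqVlt; apply/orP; left; apply/eqP; rewrite /M; move: (\int[_]_(_ in _) _) => v; ring.
Qed.

Lemma ray_transform_conv w (f : R -> C) (Kf : R) m : tame w -> continuous f ->
  (forall x, normc (f x) <= Kf) ->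
  [/\ forall r, cintegrable setT (fun m1 => f (m - m1) * (wray xi w r m1 * ker r)),
      cintegrable setT (fun r => cint setT (fun m1 => f (m - m1) * (wray xi w r m1 * ker r))) &
      cint setT (fun r => cint setT (fun m1 => f (m - m1) * (wray xi w r m1 * ker r))) =
      cint setT (fun m1 => f (m - m1) * ray_transform w m1)].
Proof.
move=> tw cf fK; have dw := ray_dominated tw.
have dF : dominated (fun r m1 => f (m - m1) * (wray xi w r m1 * ker r)).
  apply: (dominated_le (k := Kf) _ dw) => [|r m1]; last first.
    by rewrite normcM ler_wpM2r ?normc_ge0.
  apply: cmeasurableM; last by case: dw.
  apply: (cmeasurable2_r (f := fun m1 => f (m - m1))); apply: continuous_cmeasurable => x.
  apply: (continuous_compC (g := fun m1 : R => m - m1) (f := f)); last exact: cf.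
  by apply: (@cvgB _ R^o); [exact: cvg_cst|exact: cvg_id].
have [h1 h2 h3 h4 ->] := dominated_fubini dF; split => //.
apply: eq_cint => m1 _ /=.
by rewrite (cintZ _ measurableT (ray_transform_integrable m1 tw)).
Qed.

Lemma tame_decays w tau : tame w -> S tau -> decays beta (w tau).
Proof.
move=> [cw _ [N N0 hw]] St; split.
  apply: continuous_cmeasurable => m.
  apply: (continuous_compC (g := fun m : R => (tau, m)) (f := fun p : C * R => w p.1 p.2)); last exact: cw.
  by apply: continuous_pairC; [exact: cst_continuous|exact: cvg_id].
move=> b0 /hw[K K0 hK]; exists (K * normc tau * expR (N * normc tau ^+ kp)) => [|m].
  by rewrite !mulr_ge0 ?normc_ge0 ?expR_ge0.
exact: hK.
Qed.

(** [p] stands for psi, which is continuous in tau and in m only separately. Its transform is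
    therefore expressed through those of the other terms, whose integrability is known, and
    linearity is applied to these. *)
Lemma ray_transform_fixed_point (I : eqType) (s : seq I) (wL wT : C -> R -> C)
    (f : I -> R -> C) (wI : I -> C -> R -> C) (Kf : I -> R) (p : C -> R -> C) z :
  tame wL -> tame wT -> (forall i, i \in s -> tame (wI i)) ->
  (forall i, i \in s -> continuous (f i)) ->
  (forall i, i \in s -> forall m, normc (f i m) <= Kf i * expR (- (beta * `|m|))) ->
  (forall r m, 0 < r -> let tau := r%:C * expi xi in
    wL tau m = wT tau m + \sum_(i <- s) fconst * cint setT (fun m1 => f i (m - m1) * wI i tau m1)
      + p tau m) ->
  `|Im z| < beta ->
  inv_fourier (ray_transform wL) z = inv_fourier (ray_transform wT) z
   + \sum_(i <- s) inv_fourier (f i) z * inv_fourier (ray_transform (wI i)) z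
   + inv_fourier (ray_transform p) z.
Proof.
move=> tL tT tI cf fK E zb.
have fK' i : i \in s -> forall m, normc (f i m) <= Kf i.
  move=> si m; have h := fK i si m; apply: (le_trans h).
  have : 0 <= Kf i * expR (- (beta * `|m|)) by exact: le_trans (normc_ge0 _) h.
  rewrite pmulr_lge0 ?expR_gt0// => K0; rewrite -[leRHS]mulr1 ler_wpM2l// -[leRHS]expR0 ler_expR.
  by rewrite oppr_le0 mulr_ge0//; exact/ltW/(hyp_beta hP).
pose H i m := cint setT (fun m1 => f i (m - m1) * ray_transform (wI i) m1).
have conv i m (si : i \in s) := ray_transform_conv m (tI i si) (cf i si) (fK' i si).
have fc i (si : i \in s) := inv_fourier_conv (cf i si) (fK i si) (ray_transform_decays (tI i si)) zb.
have Ep : ray_transform p = (fun m => ray_transform wL m - ray_transform wT m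
    - \sum_(i <- s) fconst * H i m).
  apply/funext => m; rewrite /ray_transform.
  pose X i r := cint setT (fun m1 => f i (m - m1) * (wray xi (wI i) r m1 * ker r)).
  have iX i : i \in s -> cintegrable setT (fun r => fconst * X i r).
    by move=> si; have [_ h _] := conv i m si; exact: (cintegrableZ _ measurableT h).
  have -> : \sum_(i <- s) fconst * H i m = cint setT (fun r => \sum_(i <- s) fconst * X i r).
    rewrite (cint_sum measurableT iX) big_seq [RHS]big_seq; apply: eq_bigr => i si.
    by have [_ h E'] := conv i m si; rewrite /H -E' (cintZ _ measurableT h).
  have iL := ray_transform_integrable m tL; have iT := ray_transform_integrable m tT.
  have iS := cintegrable_sum measurableT iX.
  rewrite -(cintB measurableT iL iT) -(cintB measurableT (cintegrableB measurableT iL iT) iS).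
  apply: eq_cint => r _; rewrite /wray; case: ifPn => r0; last first.
    rewrite !mul0r subrr big1 ?subr0// => i _; rewrite /X (eq_cint (g := fun=> 0)) ?cint0 ?mulr0// => m1 _.
    by rewrite /wray ifN ?mul0r ?mulr0.
  have -> : \sum_(i <- s) fconst * X i r = (\sum_(i <- s) fconst *
      cint setT (fun m1 => f i (m - m1) * wI i (r%:C * expi xi) m1)) / r%:C * ker r.
    rewrite !mulr_suml big_seq [RHS]big_seq; apply: eq_bigr => i si; rewrite -!mulrA.
    apply: (congr1 (fun x : C => fconst * x)).
    have [i1 _ _] := inv_fourier_conv (cf i si) (fK i si)
      (tame_decays (tI i si) (S_ray r0)) zb.
    rewrite [RHS]mulrC -(cintZ _ measurableT (i1 m)); apply: eq_cint => m1 _.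
    by rewrite /wray r0; move: (ker r) (r%:C^-1) => x y; ring.
  have -> : p (r%:C * expi xi) m = wL (r%:C * expi xi) m - wT (r%:C * expi xi) m - \sum_(i <- s) fconst *
      cint setT (fun m1 => f i (m - m1) * wI i (r%:C * expi xi) m1).
    by rewrite (E r m r0)/=; move: (\sum_(i <- s) _) => x; ring.
  by move: (\sum_(i <- s) _) (ker r) (r%:C^-1) => x y v; ring.
pose e m := cexp ((0 +i* 1) * z * m%:C).
have jL := decays_integrable (ray_transform_decays tL) zb.
have jT := decays_integrable (ray_transform_decays tT) zb.
have jI i : i \in s -> cintegrable setT (fun m => fconst * H i m * e m).
  by move=> si; have [_ h _] := fc i si.
have jS := cintegrable_sum measurableT jI.
have -> : \sum_(i <- s) inv_fourier (f i) z * inv_fourier (ray_transform (wI i)) z =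
   fconst * cint setT (fun m => \sum_(i <- s) fconst * H i m * e m).
  rewrite (cint_sum measurableT jI) mulr_sumr big_seq [RHS]big_seq; apply: eq_bigr => i si.
  by have [_ _ <-] := fc i si.
rewrite {3}/inv_fourier Ep.
have -> : (fun m => (ray_transform wL m - ray_transform wT m - \sum_(i <- s) fconst * H i m)
    * cexp ((0 +i* 1) * z * m%:C)) =
   (fun m => ray_transform wL m * cexp ((0 +i* 1) * z * m%:C)
      - ray_transform wT m * cexp ((0 +i* 1) * z * m%:C) - \sum_(i <- s) fconst * H i m * e m).
  by apply/funext => m; rewrite !mulrBl mulr_suml.
rewrite (cintB measurableT (cintegrableB measurableT jL jT) jS) (cintB measurableT jL jT) /inv_fourier.
by move: (cint _ _) (cint _ _) (cint _ _) => x y v; ring.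
Qed.

End RayTransform.

(** * Assembling the terms of the equation *)

Section MainEquation.
Variable R : realType.
Variable P : equation_data R.
Hypothesis hP : equation_hyp P.
Local Notation C := R[i].
Local Notation k1 := P.(k1).
Local Notation k2 := P.(k2).
Local Notation kp := P.(kp).
Local Notation beta := P.(beta).
Local Notation fconst := (((Num.sqrt (2 * pi))^-1)%:C : C).
Implicit Types (w : C -> R -> C).

Lemma norm_E_bound (b mu K : R) (h : R -> C) : 0 <= mu -> (norm_E b mu h <= K%:E)%E ->
  forall m, normc (h m) <= K * expR (- (b * `|m|)).
Proof.
move=> mu0 hK m.
have /le_trans/(_ hK) : (((1 + `|m|) `^ mu * expR (b * `|m|) * normc (h m))%:E <= norm_E b mu h)%E.
  by apply: ereal_sup_ubound; exists m.
rewrite lee_fin => {}hK; rewrite expRN ler_pdivlMr ?expR_gt0//.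
apply: le_trans hK; rewrite [leLHS]mulrC ler_wpM2r ?normc_ge0// -[leLHS]mul1r ler_wpM2r ?expR_ge0//.
by have := @ler_powR R (1 + `|m|) ltac:(by rewrite lerDl) _ _ mu0; rewrite powRr0.
Qed.

Lemma coefC_bound l1 l2 eps : (1 <= l1 < P.(D1))%N -> (1 <= l2 < P.(D2))%N ->
  disc P.(eps0) eps -> exists K : R,
  forall m, normc (P.(Defs.coefC) l1 l2 m eps) <= K * expR (- (beta * `|m|)).
Proof.
move=> h1 h2 de; have [_ [K hK]] := hyp_coefC hP h1 h2; exists K.
apply: norm_E_bound (hK _ de).
by apply: ltW; apply: lt_trans (hyp_mu hP).
Qed.

Lemma psi_bound eps : disc P.(eps0) eps -> exists2 K : R, 0 <= K &
  forall tau m, normc (P.(psi) tau m eps) <=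
    K * normc tau * expR (P.(nu) * normc tau ^+ kp) * expR (- (beta * `|m|)).
Proof.
move=> de; have [Cp Cp0 h] := hyp_psi hP; exists Cp; first exact: ltW.
move=> tau m; apply: (le_trans (h tau m eps de)).
rewrite [leRHS](_ : _ = Cp * 1 * expR (- (beta * `|m|)) * expR (P.(nu) * normc tau ^+ kp) * normc tau); last by ring.
do 3 (apply: ler_wpM2r; first by rewrite ?expR_ge0 ?normc_ge0).
apply: ler_wpM2l; first exact: ltW.
have mu0 : - P.(mu) <= 0 by rewrite oppr_le0; apply: ltW; apply: lt_trans (hyp_mu hP).
by have := @ler_powR R (1 + `|m|) ltac:(by rewrite lerDl) _ _ mu0; rewrite powRr0.
Qed.

(** psi is entire in tau, so a rotation meets no boundary of a sector; it is enough to shift xi by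
    whole turns until both directions refer to the same argument of T2. *)
Lemma borel_laplace_rotate g xi (T1 T2 : C) m eps : disc P.(eps0) eps ->
  good_direction 0 k2 g T2 -> good_direction 0 k2 xi T2 ->
  ray_int g (borel_laplace_integrand P (fun u => P.(psi) u m eps) T1 T2) =
  ray_int xi (borel_laplace_integrand P (fun u => P.(psi) u m eps) T1 T2).
Proof.
move=> de [T20 [c [TE]]]; rewrite addr0 subr0 => g1 g2 [_ [c' [TE']]]; rewrite addr0 subr0 => x1 x2.
have nT : 0 < normc T2 by rewrite normc_gt0.
have [n cn] : exists n : int, c' = c + n%:~R * (2 * pi).
  have E : expi c = expi c' :> C.
    by apply: (mulfI (x := (normc T2)%:C)); rewrite -?TE -?TE'// -normc_gt0 normc_real normr_gt0 gt_eqF.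
  have /expi_eq1[n hn] : expi (c' - c) = 1 :> C by rewrite expiD expiN E mulfV// expi_neq0.
  by exists n; lra.
pose t' := xi - n%:~R * (2 * pi).
have et : expi t' = expi xi :> C by rewrite /t' expiD expiN expi2piz invr1 mulr1.
rewrite -(ray_int_expi _ et).
have [K K0 hK] := psi_bound de.
apply: (@laplace_rotate _ _ hP _ P.(nu) (K * expR (- (beta * `|m|))) g t' c T1 T2 _ _ TE T20).
- exact/ltW/(hyp_nu hP).
- by rewrite mulr_ge0// expR_ge0.
- by rewrite ltr_norml mulrBr; apply/andP; split; lra.
- by rewrite ltr_norml /t'; move: x1 x2; rewrite cn mulrDr !mulrBr => x1 x2; apply/andP; split; lra.
move=> r s r0 _; split; first by apply: (hyp_psi_tau hP m de).
have := hK (r%:C * expi s) m; rewrite normcM normc_expi mulr1 normc_real (gtr0_norm r0) => h.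
by rewrite [leRHS](_ : _ = K * r * expR (P.(nu) * r ^+ kp) * expR (- (beta * `|m|)))//; ring.
Qed.

Variables (a1 a2 : R).
Hypothesis a12 : a2 - a1 <= 2 * pi - pi / k2%:R.
Local Notation S := (@sector R a1 a2).
Local Notation tame := (tame kp beta S).

Variables (D1 D2 : set C) (bz : R) (eps : C) (xi : C -> C -> R).
Hypothesis bz_beta : bz <= beta.
Hypotheses (D1_open : open D1) (D2_open : open D2).
Hypothesis eps_neq0 : eps != 0.
Hypothesis eps_disc : disc P.(eps0) eps.
Hypothesis D1_neq0 : forall t1, D1 t1 -> t1 != 0.
Hypothesis xi_good : forall t1 t2, D1 t1 -> D2 t2 ->
  S (expi (xi t1 t2)) /\ good_direction 0 k2 (xi t1 t2) (eps ^+ P.(lam2) * t2).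
Hypothesis xi_good1 : forall t1 t2, D1 t1 -> D2 t2 ->
  good_direction 0 k1 (xi t1 t2) (eps ^+ P.(lam1) * t1).
Variable gam : C -> C -> R.
Hypothesis gamP : forcing_direction P gam.
Local Notation dsol := (directed_sol P eps xi).
Local Notation rt t1 t2 := (ray_transform P (xi t1 t2)
  (ray_coef1 P eps (expi (xi t1 t2)) t1) (ray_coef2 P eps (expi (xi t1 t2)) t2)).

Lemma directed_sol_ray_transform w t1 t2 z : tame w -> D1 t1 -> D2 t2 -> strip bz z ->
  dsol w t1 t2 z = inv_fourier (rt t1 t2 w) z.
Proof.
move=> tw d1 d2 sz; rewrite /directed_sol inner_sol_laplace.
apply: (lf_ray_transform hP _ _ (ray_coef2_gt0 xi_good d1 d2) tw (strip_beta bz_beta sz)) => r r0.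
by have [Sx _] := xi_good d1 d2; exact: sector_cone.
Qed.

Lemma forcing_ray_transform t1 t2 z : D1 t1 -> D2 t2 ->
  forcing P gam t1 t2 z eps = inv_fourier (rt t1 t2 (fun tau m => P.(psi) tau m eps)) z.
Proof.
move=> d1 d2; apply: (congr1 (fun h => inv_fourier h z)); apply/funext => m.
have [_ g2] := xi_good d1 d2.
have [|_ g] := gamP (T1 := eps ^+ P.(lam1) * t1) (T2 := eps ^+ P.(lam2) * t2).
  by exists (xi t1 t2); split; [exact: xi_good1|].
rewrite /forcingF (borel_laplace_rotate _ _ eps_disc g g2) /ray_int cint_mkcond.
apply: eq_cint => r _.
have := congr1 (fun f => f r) (ray_sol_integrand P (fun tau m => P.(psi) tau m eps) (xi t1 t2) t1 t2 0 eps m).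
rewrite kernel_exponent_at0 => <-.
rewrite !patchE; case: ifP => // _.
rewrite /ray_integrand /sol_ray_integrand /borel_laplace_integrand.
by rewrite [cexp (_ * 0 * _)](_ : _ = 1) ?mulr1// -cexp0; congr cexp; rewrite mulr0 mul0r.
Qed.

Definition irregs_symbol n1 n2 w (tau : C) (m : R) : C :=
  (k1%:R * tau ^+ k1) ^+ n1 * ((k2%:R * tau ^+ k2) ^+ n2 * w tau m).

Lemma irregs_symbolE n1 n2 w tau m : irregs_symbol n1 n2 w tau m =
  k1%:R ^+ n1 * k2%:R ^+ n2 * (tau ^+ (k1 * n1 + k2 * n2) * w tau m).
Proof.
rewrite /irregs_symbol !exprMn exprD 2!exprM.
move: (k1%:R ^+ n1) (k2%:R ^+ n2) ((tau ^+ k1) ^+ n1) ((tau ^+ k2) ^+ n2) (w tau m) => a b c d v.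
ring.
Qed.

Lemma irregs_symbol_tame n1 n2 w : tame w -> tame (irregs_symbol n1 n2 w).
Proof.
move=> tw.
have -> : irregs_symbol n1 n2 w = (fun tau m => k1%:R ^+ n1 * k2%:R ^+ n2 *
   (tau ^+ (k1 * n1 + k2 * n2) * w tau m)).
  by apply/funext => tau; apply/funext => m; rewrite irregs_symbolE.
by apply: tameZ; apply: (tame_tauX (kp_gt1 hP)).
Qed.

(** The prefactor cancels the negative powers of epsilon in the symbols. For the leading term it is
    all of epsilon^Del, by [hyp_Del_top]; for the others the excess is the power of epsilon in
    [mapH]. *)
Lemma iter_irreg_symbols n1 n2 (V : C -> C -> C -> C) (c : C -> C) w : tame w ->
  on_domain D1 D2 bz (fun t1 t2 z => V t1 t2 z = c z * dsol w t1 t2 z) ->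
  on_domain D1 D2 bz (fun t1 t2 z =>
    eps ^+ (P.(lam1) * k1 * n1 + P.(lam2) * k2 * n2) *
      iter n1 (irreg1 k1) (iter n2 (irreg2 k2) V) t1 t2 z =
    c z * dsol (irregs_symbol n1 n2 w) t1 t2 z).
Proof.
move=> tw hV t1 t2 z d1 d2 sz.
rewrite (iter_irreg_directed_sol hP a12 bz_beta D1_open D2_open D1_neq0 xi_good n1 n2 tw hV d1 d2 sz).
rewrite mulrCA; apply: (congr1 (fun x : C => c z * x)).
pose N := (P.(lam1) * k1 * n1 + P.(lam2) * k2 * n2)%N.
rewrite (@eq_directed_sol _ P eps xi _ (fun tau m => eps^-1 ^+ N * irregs_symbol n1 n2 w tau m)); last first.
  by move=> tau m; rewrite /irregs_symbol /N exprD; ring.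
rewrite (directed_solZ hP bz_beta xi_good _ (irregs_symbol_tame n1 n2 tw) d1 d2 sz) mulrA -/N.
by rewrite -exprMn mulfV// expr1n mul1r.
Qed.

(** Multiplying the fixed point identity by P_m(tau) and moving its leading monomial to the right
    gives Q(im) w as a sum of symbols, convolutions and psi. [ray_transform_fixed_point] transports
    this identity to u, and each term is then recognized as one of the equation. *)
Lemma main_equation_directed_sol w : tame w ->
  (forall tau m, S tau -> (Pm P m).[tau] != 0) ->
  (forall tau m, S tau -> mapH P eps w tau m = w tau m) ->
  on_domain D1 D2 bz (main_equation P eps (dsol w) (fun s1 s2 y => forcing P gam s1 s2 y eps)).
Proof.
move=> tw Pm0 fixw t1 t2 z d1 d2 sz.
pose s := [seq (l1, l2) | l1 <- index_iota 1 P.(Defs.D1), l2 <- index_iota 1 P.(Defs.D2)].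
have sP l : l \in s -> (1 <= l.1 < P.(Defs.D1))%N /\ (1 <= l.2 < P.(Defs.D2))%N.
  by case/allpairsP => -[l1 l2] /= []; rewrite !mem_index_iota => h1 h2 ->.
pose p l := P.(Rp) l.1 l.2.
pose x l := (P.(Del) l.1 l.2 - P.(lam1) * k1 * P.(del1) l.1 - P.(lam2) * k2 * P.(del2) l.2)%N.
pose W l tau m := eps ^+ x l * irregs_symbol (P.(del1) l.1) (P.(del2) l.2)
   (fun tau m => (p l).[0 +i* m] * w tau m) tau m.
pose f l m := P.(Defs.coefC) l.1 l.2 m eps.
have tp (q : {poly C}) : tame (fun tau m => q.[0 +i* m] * w tau m) by exact: tame_poly.
have tW l : tame (W l) by apply: tameZ; exact: irregs_symbol_tame.
pose top := P.(Rp) P.(Defs.D1) P.(Defs.D2).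
pose WT := irregs_symbol (P.(del1) P.(Defs.D1)) (P.(del2) P.(Defs.D2)) (fun tau m => top.[0 +i* m] * w tau m).
have tWT : tame WT by exact: irregs_symbol_tame.
have cf l : l \in s -> continuous (f l).
  by move=> /sP[h1 h2]; have [/(_ _ eps_disc)[]] := hyp_coefC hP h1 h2.
(* A bound exists only for indices in the range of the sum; the default 0 makes [Kf] a total
   function. *)
pose Kf l := if pselect (exists K : R, forall m, normc (f l m) <= K * expR (- (beta * `|m|))) is left e
  then projT1 (cid e) else 0.
have fK l : l \in s -> forall m, normc (f l m) <= Kf l * expR (- (beta * `|m|)).
  move=> /sP[h1 h2]; rewrite /Kf; case: pselect => [e|[]]; first exact: (projT2 (cid e)).
  exact: coefC_bound.
have Sr r : 0 < r -> S (r%:C * expi (xi t1 t2)).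
  by move=> r0; have [Sx _] := xi_good d1 d2; exact: sector_cone.
have E r m : 0 < r -> let tau := r%:C * expi (xi t1 t2) in
    P.(Q).[0 +i* m] * w tau m = WT tau m
     + \sum_(l <- s) fconst * cint setT (fun m1 => f l (m - m1) * W l tau m1) + P.(psi) tau m eps.
  move=> r0 tau; have St : S tau := Sr r r0.
  have := congr1 (fun v => (Pm P m).[tau] * v) (fixw tau m St).
  rewrite /mapH (mulVKf (Pm0 tau m St)).
  have -> : (Pm P m).[tau] = P.(Q).[0 +i* m] - (k1%:R ^+ P.(del1) P.(Defs.D1)) * (k2%:R ^+ P.(del2) P.(Defs.D2))
      * top.[0 +i* m] * tau ^+ (k1 * P.(del1) P.(Defs.D1) + k2 * P.(del2) P.(Defs.D2)).
    by rewrite /Pm hornerD hornerN hornerZ hornerC hornerXn.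
  rewrite mulrBl => F.
  have -> : WT tau m = k1%:R ^+ P.(del1) P.(Defs.D1) * k2%:R ^+ P.(del2) P.(Defs.D2)
      * top.[0 +i* m] * tau ^+ (k1 * P.(del1) P.(Defs.D1) + k2 * P.(del2) P.(Defs.D2)) * w tau m.
    rewrite /WT irregs_symbolE; move: (_ ^+ P.(del1) _) (_ ^+ P.(del2) _) (tau ^+ _) (top.[_]) => a b c v.
    by move: (w tau m) => u; ring.
  rewrite -addrA addrC; apply/eqP; rewrite -subr_eq -F; apply/eqP.
  apply: (congr1 (fun v : C => v + _)).
  transitivity (\sum_(l <- s) eps ^+ x l * (k1%:R * tau ^+ k1) ^+ P.(del1) l.1
      * (k2%:R * tau ^+ k2) ^+ P.(del2) l.2 * fconst
      * cint setT (fun m1 => P.(Defs.coefC) l.1 l.2 (m - m1) eps * (p l).[0 +i* m1] * w tau m1)).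
    by rewrite big_allpairs.
  rewrite big_seq [RHS]big_seq; apply: eq_bigr => l ls.
  have [i1 _ _] := inv_fourier_conv (cf l ls) (fK l ls) (tame_decays (tp (p l)) St) (Im0_beta hP).
  rewrite -mulrA mulrCA; apply: (congr1 (fun v : C => fconst * v)).
  have -> : cint setT (fun m1 => P.(Defs.coefC) l.1 l.2 (m - m1) eps * (p l).[0 +i* m1] * w tau m1) =
     cint setT (fun m1 => f l (m - m1) * ((p l).[0 +i* m1] * w tau m1)).
    by apply: eq_cint => m1 _; rewrite mulrA.
  rewrite -(cintZ _ measurableT (i1 m)); apply: eq_cint => m1 _.
  rewrite /W /irregs_symbol; move: (f l (m - m1)) ((p l).[_] * _) (eps ^+ x l) => a b c.
  by move: (_ ^+ P.(del1) _) (_ ^+ P.(del2) _) => d e; ring.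
have b0 := ray_coef2_gt0 xi_good d1 d2.
have M := ray_transform_fixed_point (p := fun tau m => P.(psi) tau m eps) hP (ray_coef1 P eps (expi (xi t1 t2)) t1) Sr b0
  (tp P.(Q)) tWT (fun l _ => tW l) cf fK E (strip_beta bz_beta sz).
rewrite /main_equation (poly_dz_directed_sol hP bz_beta xi_good P.(Q) tw d1 d2 sz).
rewrite (directed_sol_ray_transform (tp P.(Q)) d1 d2 sz) M -(forcing_ray_transform z d1 d2).
apply: (congr1 (fun v : C => v + _)).
have -> : eps ^+ P.(Del) P.(Defs.D1) P.(Defs.D2)
    * iter (P.(del1) P.(Defs.D1)) (irreg1 k1) (iter (P.(del2) P.(Defs.D2)) (irreg2 k2)
          (poly_dz (P.(Rp) P.(Defs.D1) P.(Defs.D2)) (dsol w))) t1 t2 z = inv_fourier (rt t1 t2 WT) z.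
  rewrite (hyp_Del_top hP) -(directed_sol_ray_transform tWT d1 d2 sz).
  have T0 : on_domain D1 D2 bz (fun t1 t2 z => poly_dz top (dsol w) t1 t2 z =
      (fun=> 1) z * dsol (fun tau m => top.[0 +i* m] * w tau m) t1 t2 z).
    by move=> s1 s2 y e1 e2 sy; rewrite mul1r (poly_dz_directed_sol hP bz_beta xi_good top tw e1 e2 sy).
  apply: (etrans (iter_irreg_symbols _ _ (tp top) T0 d1 d2 sz)).
  exact: mul1r.
apply: (congr1 (fun v : C => _ + v)).
transitivity (\sum_(l <- s) eps ^+ P.(Del) l.1 l.2 * iter (P.(del1) l.1) (irreg1 k1)
    (iter (P.(del2) l.2) (irreg2 k2) (fun s1 s2 y =>
       coefc P l.1 l.2 y eps * poly_dz (p l) (dsol w) s1 s2 y)) t1 t2 z); last by rewrite big_allpairs.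
rewrite big_seq [RHS]big_seq; apply: eq_bigr => l ls; have [h1 h2] := sP l ls.
rewrite -(directed_sol_ray_transform (tW l) d1 d2 sz).
rewrite (directed_solZ hP bz_beta xi_good _ (irregs_symbol_tame _ _ (tp (p l))) d1 d2 sz).
(* The truncated subtractions in [x l] are exact by [hyp_Del]. *)
have -> : P.(Del) l.1 l.2 = (x l + (P.(lam1) * k1 * P.(del1) l.1 + P.(lam2) * k2 * P.(del2) l.2))%N.
  by rewrite /x -subnDA subnK// ltnW// (hyp_Del hP).
have T0 : on_domain D1 D2 bz (fun s1 s2 y => coefc P l.1 l.2 y eps * poly_dz (p l) (dsol w) s1 s2 y =
    coefc P l.1 l.2 y eps * dsol (fun tau m => (p l).[0 +i* m] * w tau m) s1 s2 y).
  by move=> s1 s2 y e1 e2 sy; rewrite (poly_dz_directed_sol hP bz_beta xi_good (p l) tw e1 e2 sy).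
have T := iter_irreg_symbols (P.(del1) l.1) (P.(del2) l.2) (tp (p l)) T0 d1 d2 sz.
rewrite exprD -[RHS]mulrA [in RHS]T [LHS]mulrCA.
exact: erefl.
Qed.

End MainEquation.

(** * Fixed points on the common disc *)

Section ExpBall.
Variable R : realType.
Variable P : equation_data R.
Hypothesis hP : equation_hyp P.
Local Notation C := R[i].
Local Notation kp := P.(kp).
Local Notation beta := P.(beta).
Local Notation nu := P.(nu).
Local Notation mu := P.(mu).
Variables (S : set C) (rho varpi : R).
Implicit Types (w : C -> R -> C).

Lemma powR_1D_gt0 (m : R) : 0 < (1 + `|m|) `^ mu.
Proof. by rewrite powR_gt0// ltr_pwDl. Qed.

Lemma exp_norm_point w (K : R) tau m : (exp_norm P S rho w <= K%:E)%E -> (S `|` cdisc rho) tau ->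
  tau != 0 -> (1 + `|m|) `^ mu * expR (beta * `|m|) * normc (w tau m) <=
    K * normc tau * expR (nu * normc tau ^+ kp).
Proof.
move=> hK St t0; have nt : 0 < normc tau by rewrite normc_gt0.
have /le_trans/(_ hK) : (((1 + `|m|) `^ mu * expR (beta * `|m|) * expR (- (nu * normc tau ^+ kp))
   * (normc tau)^-1 * normc (w tau m))%:E <= exp_norm P S rho w)%E.
  by apply: ereal_sup_ubound; exists (tau, m).
rewrite lee_fin expRN => {}hK.
have e0 := expR_gt0 (nu * normc tau ^+ kp).
move: hK; move: (normc tau) (expR (nu * _)) ((1 + `|m|) `^ mu) (expR (beta * _)) (normc (w _ _)) nt e0 => t e a b v t0' e0 h.
have := ler_wpM2r (mulr_ge0 (ltW t0') (ltW e0)) h; rewrite [leRHS]mulrA; apply: le_trans.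
rewrite le_eqVlt; apply/orP; left; apply/eqP; field.
by rewrite !gt_eqF.
Qed.

Lemma exp_norm_le w (K : R) : 0 <= K ->
  (forall tau m, (S `|` cdisc rho) tau -> (1 + `|m|) `^ mu * expR (beta * `|m|) * normc (w tau m) <=
    K * normc tau * expR (nu * normc tau ^+ kp)) ->
  (exp_norm P S rho w <= K%:E)%E.
Proof.
move=> K0 h; apply: ge_ereal_sup => _ [[tau m] /= [St _] <-]; rewrite lee_fin.
have {}h := h tau m St.
have [t0|t0] := eqVneq tau 0; first by rewrite t0 normc0 invr0 mulr0 mul0r.
have nt : 0 < normc tau by rewrite normc_gt0.
have e0 := expR_gt0 (nu * normc tau ^+ kp); rewrite expRN.
move: h nt e0; move: (normc tau) (expR (nu * _)) ((1 + `|m|) `^ mu) (expR (beta * _)) (normc (w _ _)) => t e a b v h t0' e0.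
rewrite (_ : _ * v = a * b * v / (t * e)); last by field; rewrite !gt_eqF.
by rewrite ler_pdivrMr ?mulr_gt0// mulrA.
Qed.

Lemma exp_ball_bound w tau m : exp_ball P S rho varpi w -> (S `|` cdisc rho) tau -> tau != 0 ->
  normc (w tau m) <= varpi * normc tau * expR (nu * normc tau ^+ kp) * expR (- (beta * `|m|)).
Proof.
move=> [_ hw] St t0; have := exp_norm_point m hw St t0.
rewrite expRN ler_pdivlMr ?expR_gt0//; apply: le_trans.
rewrite [leLHS]mulrC ler_wpM2r ?normc_ge0// -[leLHS]mul1r ler_wpM2r ?expR_ge0//.
have mu0 : 0 <= mu by apply: ltW; apply: lt_trans (hyp_mu hP).
by have := @ler_powR R (1 + `|m|) ltac:(by rewrite lerDl) _ _ mu0; rewrite powRr0.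
Qed.

Lemma exp_ball_continuous w tau : exp_ball P S rho varpi w -> (S `|` cdisc rho) tau ->
  continuous (fun m => w tau m).
Proof.
move=> [[cw _ _] _] St m; pose A := (S `|` cdisc rho) `*` [set: R].
have /subspace_continuousP/(_ (tau, m)) := cw; rewrite -/A => h.
have {}h := h (conj St I).
have cg : {for m, continuous (fun m : R => (tau, m))}.
  by apply: (@continuous_pairC R C R (fun=> tau) id m); [exact: cst_continuous|exact: cvg_id].
move=> B /h; rewrite /within/= => hB.
have hm : \forall m' \near m, (A (tau, m') -> B (w tau m')) by exact: (cg _ hB).
have : \forall m' \near m, B (w tau m') by apply: filterS hm => m'; apply.
by [].
Qed.

(** The norm controls w only off tau = 0, hence [~ A 0]; openness of A turns continuity relative to
    the larger set into continuity at each point. *)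
Lemma exp_ball_tame (A : set C) w : 0 <= varpi -> exp_ball P S rho varpi w -> open A ->
  A `<=` S `|` disc rho -> ~ A 0 -> tame kp beta A w.
Proof.
move=> v0 bw oA AS A0; have bw' := bw; have [[cw hw _] _] := bw'.
have AS' : A `<=` S `|` cdisc rho.
  by move=> x /AS[Sx|dx]; [left|right; exact: ltW].
have An0 tau : A tau -> tau != 0 by move=> At; apply/eqP => t0; apply: A0; rewrite -t0.
split.
- move=> tau m At.
  have oB : open (A `*` [set: R]).
    rewrite (_ : _ `*` _ = fst @^-1` A); last by apply/seteqP; split=> [x []|x] //.
    by apply: open_comp => [z _|//]; exact: cvg_fst.
  have /continuous_subspaceW : A `*` [set: R] `<=` (S `|` cdisc rho) `*` [set: R].
    by move=> x [/AS' ? _]; split.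
  move=> /(_ _ _ cw); rewrite (continuous_open_subspace _ oB) => /(_ (tau, m)); apply.
  by rewrite inE.
- by move=> m tau At; apply: hw; exact: AS.
exists nu; first exact/ltW/(hyp_nu hP).
move=> b bb; exists varpi => // tau m At.
apply: (le_trans (exp_ball_bound m bw (AS' _ At) (An0 _ At))).
rewrite ler_wpM2l ?mulr_ge0 ?normc_ge0 ?expR_ge0// ler_expR lerN2 ler_wpM2r//.
exact: ltW.
Qed.

End ExpBall.

Section FixedPointsAgree.
Variable R : realType.
Variable P : equation_data R.
Hypothesis hP : equation_hyp P.
Local Notation C := R[i].
Local Notation k1 := P.(k1).
Local Notation k2 := P.(k2).
Local Notation kp := P.(kp).
Local Notation beta := P.(beta).
Local Notation nu := P.(nu).
Local Notation mu := P.(mu).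
Variable eps : C.
Hypothesis eps_disc : disc P.(eps0) eps.
Implicit Types (w : C -> R -> C) (g : R -> C).

Lemma decays_poly (p : {poly C}) g : continuous g -> decays beta g -> decays beta (fun m => p.[0 +i* m] * g m).
Proof.
(* g is viewed as a symbol constant in tau over the single point 1, so that [tame_poly] applies. *)
move=> cg [_ hg]; have tg : tame kp beta [set 1] (fun (_ : C) m => g m).
  split.
  - move=> tau m _; apply: (continuous_compC (g := snd) (f := g)); [exact: cvg_snd|exact: cg].
  - by move=> m tau _; exact: differentiable_cst.
  exists 0 => // b /hg[K K0 hK]; exists K => // tau m /= ->.
  by rewrite mul0r expR0 !mulr1 normc1 mulr1.
exact: (tame_decays (tame_poly p tg) (erefl _)).
Qed.

(** The linear part of [mapH], as an operator on functions of m alone with tau as a parameter. *)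
Definition conv_part (tau : C) g (m : R) : C := (Pm P m).[tau]^-1 *
  (\sum_(1 <= l1 < P.(D1)) \sum_(1 <= l2 < P.(D2))
      eps ^+ (P.(Del) l1 l2 - P.(lam1) * k1 * P.(del1) l1 - P.(lam2) * k2 * P.(del2) l2)
      * (k1%:R * tau ^+ k1) ^+ P.(del1) l1
      * (k2%:R * tau ^+ k2) ^+ P.(del2) l2
      * ((Num.sqrt (2 * pi))^-1)%:C
      * cint setT (fun m1 => P.(Defs.coefC) l1 l2 (m - m1) eps
                             * (P.(Rp) l1 l2).[0 +i* m1] * g m1)).

Lemma mapH_conv_part w tau m : mapH P eps w tau m =
  conv_part tau (w tau) m + (Pm P m).[tau]^-1 * P.(psi) tau m eps.
Proof. by rewrite /mapH mulrDr. Qed.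

Lemma conv_part_integrable g m l1 l2 : continuous g -> decays beta g ->
  (1 <= l1 < P.(D1))%N -> (1 <= l2 < P.(D2))%N ->
  cintegrable setT (fun m1 => P.(Defs.coefC) l1 l2 (m - m1) eps
                             * (P.(Rp) l1 l2).[0 +i* m1] * g m1).
Proof.
move=> cg dg h1 h2; have [K hK] := coefC_bound hP h1 h2 eps_disc.
have cf : continuous (fun m => P.(Defs.coefC) l1 l2 m eps).
  by have [/(_ _ eps_disc)[]] := hyp_coefC hP h1 h2.
have [h _ _] := inv_fourier_conv cf hK (decays_poly (P.(Rp) l1 l2) cg dg) (Im0_beta hP).
by apply: (eq_cintegrable measurableT _ (h m)) => m1 _; rewrite mulrA.
Qed.

Lemma conv_partB tau g1 g2 m : continuous g1 -> continuous g2 -> decays beta g1 -> decays beta g2 ->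
  conv_part tau (fun m => g1 m - g2 m) m = conv_part tau g1 m - conv_part tau g2 m.
Proof.
move=> c1 c2 d1 d2; rewrite /conv_part -mulrBr; apply: (congr1 (fun x : C => _ * x)).
rewrite -sumrB big_nat [RHS]big_nat; apply: eq_bigr => l1 h1.
rewrite -sumrB big_nat [RHS]big_nat; apply: eq_bigr => l2 h2.
rewrite -mulrBr; apply: (congr1 (fun x : C => _ * x)).
have i1 := conv_part_integrable m c1 d1 h1 h2; have i2 := conv_part_integrable m c2 d2 h1 h2.
by rewrite -(cintB measurableT i1 i2); apply: eq_cint => m1 _; rewrite mulrBr.
Qed.

Lemma conv_partZ tau (c : C) g m : continuous g -> decays beta g ->
  conv_part tau (fun m => c * g m) m = c * conv_part tau g m.
Proof.
move=> c1 d1; rewrite /conv_part mulrCA; apply: (congr1 (fun x : C => _ * x)).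
rewrite mulr_sumr big_nat [RHS]big_nat; apply: eq_bigr => l1 h1.
rewrite mulr_sumr big_nat [RHS]big_nat; apply: eq_bigr => l2 h2.
rewrite mulrCA; apply: (congr1 (fun x : C => _ * x)).
have i1 := conv_part_integrable m c1 d1 h1 h2.
by rewrite -(cintZ _ measurableT i1); apply: eq_cint => m1 _; rewrite mulrCA.
Qed.

Variables (S S' : set C) (rho varpi : R).
Hypothesis varpi_gt0 : 0 < varpi.
Hypothesis contraction : half_contraction P S rho varpi (mapH P eps).
Variables (w w' : C -> R -> C).
Hypothesis w_fixed : fixed_point P S rho varpi (mapH P eps) w.
Hypothesis w'_fixed : fixed_point P S' rho varpi (mapH P eps) w'.

(* The map [mapH] acts in each fibre over tau separately.  Were the difference
   [h] of the two fixed points at tau0 not zero, the product of [h] with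
   tau * chi tau, where chi has modulus at most exp(nu |tau|^k') with equality
   at tau0, would be a function whose norm the contraction does not decrease. *)
Lemma fixed_points_agree tau0 m0 : cdisc rho tau0 -> tau0 != 0 -> w tau0 m0 = w' tau0 m0.
Proof.
move=> rt0 t0; have [bw fw] := w_fixed; have [bw' fw'] := w'_fixed.
have St : (S `|` cdisc rho) tau0 by right.
have St' : (S' `|` cdisc rho) tau0 by right.
have nt : 0 < normc tau0 by rewrite normc_gt0.
pose h (m : R) : C := w tau0 m - w' tau0 m.
have cw := exp_ball_continuous bw St; have cw' := exp_ball_continuous bw' St'.
have ch : continuous h.
  move=> m; apply: (continuous_addC (f := w tau0) (g := fun m => - w' tau0 m)); first exact: cw.
  apply: (continuous_compC (g := w' tau0) (f := fun z : C => - z)); first exact: cw'.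
  exact: opp_continuous.
have dw : decays beta (w tau0).
  apply: (decays_continuous (K := varpi * normc tau0 * expR (nu * normc tau0 ^+ kp)) cw) => m.
  exact: (exp_ball_bound hP m bw St t0).
have dw' : decays beta (w' tau0).
  apply: (decays_continuous (K := varpi * normc tau0 * expR (nu * normc tau0 ^+ kp)) cw') => m.
  exact: (exp_ball_bound hP m bw' St' t0).
have dh : decays beta h.
  pose K := varpi * normc tau0 * expR (nu * normc tau0 ^+ kp).
  apply: (decays_continuous (K := K + K) ch) => m.
  rewrite mulrDl (le_trans (normcB _ _))// lerD//.
    exact: (exp_ball_bound hP m bw St t0).
  exact: (exp_ball_bound hP m bw' St' t0).
(* The terms in psi cancel in the difference, so h is fixed by the linear part in the fibre of
   tau0. *)
have hE m : h m = conv_part tau0 h m.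
  rewrite (conv_partB tau0 m cw cw' dw dw') /h -(fw _ m St) -(fw' _ m St') !mapH_conv_part.
  by move: (conv_part _ _ _) (conv_part _ _ _) (_ * _) => x y v; ring.
pose W (m : R) := (1 + `|m|) `^ mu * expR (beta * `|m|).
have W0 m : 0 < W m by rewrite mulr_gt0 ?expR_gt0// powR_1D_gt0.
pose A := [set W m * normc (h m) | m in [set: R]].
have hA : has_sup A.
  split; first by exists (W 0 * normc (h 0)); exists 0.
  exists (varpi * normc tau0 * expR (nu * normc tau0 ^+ kp) + varpi * normc tau0 * expR (nu * normc tau0 ^+ kp)).
  move=> _ [m _ <-]; rewrite (@le_trans _ _ (W m * normc (w tau0 m) + W m * normc (w' tau0 m)))//.
    by rewrite -mulrDr ler_wpM2l ?normcB// ltW.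
  have [_ nw] := bw; have [_ nw'] := bw'.
  by rewrite lerD// /W; [exact: (exp_norm_point m nw St t0)|exact: (exp_norm_point m nw' St' t0)].
pose N := sup A.
have leN m : W m * normc (h m) <= N by apply: sup_upper_bound => //; exists m.
suff N0 : N <= 0.
  have := le_trans (leN m0) N0; rewrite pmulr_rle0// => h0.
  by apply/eqP; rewrite -subr_eq0 -normc_eq0 eq_le h0 normc_ge0.
rewrite leNgt; apply/negP => N0.
have [a t0E] : exists a, tau0 = (normc tau0)%:C * expi a by exact: polarE.
(* With tau0 = |tau0| e^{i a}, the rotation by - kp a makes the exponent equal to nu |tau0|^kp at
   tau0, where the modulus bound becomes an equality. *)
pose chi (tau : C) : C := cexp (nu%:C * expi (- (kp%:R * a)) * tau ^+ kp).
have chi_le tau : normc (chi tau) <= expR (nu * normc tau ^+ kp).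
  rewrite normc_cexp ler_expR (le_trans (ler_norm _))// (le_trans (normc_ge_absRe _))//.
  by rewrite !normcM normc_real normc_expi mulr1 normcX gtr0_norm// (hyp_nu hP).
have chi0 : normc (chi tau0) = expR (nu * normc tau0 ^+ kp).
  rewrite normc_cexp; congr expR; rewrite {1}t0E exprMn expiX mulrACA -mulrA -expiD addNr expi0 mulr1.
  by rewrite -rmorphXn -rmorphM.
(* This scaling places w1 in the ball: the supremum N of the weighted modulus of h becomes varpi. *)
pose s := varpi / N.
have s0 : 0 < s by rewrite divr_gt0.
pose w1 (tau : C) (m : R) : C := s%:C * (tau * chi tau) * h m.
have w1_point tau m : W m * normc (w1 tau m) <= varpi * normc tau * expR (nu * normc tau ^+ kp).
  rewrite /w1 !normcM normc_real gtr0_norm//.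
  rewrite [leLHS](_ : _ = s * (W m * normc (h m)) * normc tau * normc (chi tau)); last by ring.
  rewrite (_ : varpi = s * N); last by rewrite /s divfK// gt_eqF.
  apply: ler_pM (chi_le tau); last by rewrite ler_wpM2r ?normc_ge0// ler_wpM2l// ltW.
    exact: mulr_ge0 (mulr_ge0 (ltW s0) (mulr_ge0 (ltW (W0 m)) (normc_ge0 _))) (normc_ge0 _).
  exact: normc_ge0.
have w1_norm : (exp_norm P S rho w1 <= varpi%:E)%E.
  by apply: exp_norm_le => [|tau m _]; [exact: ltW|exact: w1_point].
have dchi (tau : C) : differentiable chi tau.
  apply: (differentiable_comp (f := fun u : C => nu%:C * expi (- (kp%:R * a)) * u ^+ kp) (g := @cexp R));
    last exact: differentiable_cexp.
  apply: (differentiableM (f := fun=> nu%:C * expi (- (kp%:R * a))) (g := fun u : C => u ^+ kp)).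
    exact: differentiable_cst.
  exact: differentiable_expn.
have dw1 m (tau : C) : differentiable (fun tau => w1 tau m) tau.
  apply: (differentiableM (f := fun tau : C => s%:C * (tau * chi tau)) (g := fun=> h m));
    last exact: differentiable_cst.
  apply: (differentiableM (f := fun=> s%:C) (g := fun tau : C => tau * chi tau)).
    exact: differentiable_cst.
  by apply: (differentiableM (f := fun tau : C => tau) (g := chi)); [exact: ex_diff|exact: dchi].
have b1 : exp_ball P S rho varpi w1.
  split; last exact: w1_norm.
  split.
  - apply: continuous_subspaceT => -[tau m].
    apply: (continuous_mulC (f := fun p : C * R => s%:C * (p.1 * chi p.1)) (g := fun p => h p.2)).
      apply: (continuous_compC (g := fst) (f := fun tau : C => s%:C * (tau * chi tau))); first exact: cvg_fst.
      apply: continuous_mulC; first exact: cst_continuous.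
      by apply: continuous_mulC; [exact: cvg_id|exact/differentiable_continuous/dchi].
    by apply: (continuous_compC (g := snd) (f := h)); [exact: cvg_snd|exact: ch].
  - by move=> m tau _; exact: dw1.
  exact: le_lt_trans w1_norm (ltry _).
(* Comparing w1 with 0, which is also in the ball, eliminates psi and leaves the linear part applied
   to w1. *)
pose z0 (_ : C) (_ : R) : C := 0.
have n0 : (exp_norm P S rho z0 <= 0%:E)%E.
  by apply: exp_norm_le => // tau m _; rewrite /z0 normc0 mulr0 !mul0r.
have b0 : exp_ball P S rho varpi z0.
  split; last by apply: (le_trans n0); rewrite lee_fin ltW.
  split; first by apply: continuous_subspaceT => p; exact: cst_continuous.
    by move=> m tau _; exact: differentiable_cst.
  exact: le_lt_trans n0 (ltry _).
have := contraction.2 _ _ b1 b0.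
have -> : (fun tau m => w1 tau m - z0 tau m) = w1.
  by apply/funext => tau; apply/funext => m; rewrite /z0 subr0.
move=> hc; have {}hc : (exp_norm P S rho (fun tau m => (mapH P eps w1 tau m - mapH P eps z0 tau m)%R)
    <= (varpi / 2)%:E)%E.
  apply: (le_trans hc); rewrite mulrC EFinM; apply: lee_wpmul2l; last exact: w1_norm.
  by rewrite lee_fin invr_ge0.
(* In the fibre of tau0, w1 is a multiple of h, which the linear part fixes; so nothing shrinks
   there, while the contraction would halve N. *)
have hmap m : mapH P eps w1 tau0 m - mapH P eps z0 tau0 m = w1 tau0 m.
  rewrite !mapH_conv_part /w1 (conv_partZ tau0 _ m ch dh) -hE.
  have -> : conv_part tau0 (z0 tau0) m = 0.
    have d0 : decays beta (z0 tau0).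
      apply: (decays_continuous (K := 0)) => [m'|m']; first exact: cst_continuous.
      by rewrite /z0 normc0 mul0r.
    by have := conv_partB tau0 m ch ch dh dh; rewrite subrr => <-; congr (conv_part _ _ _);
      apply/funext => m1; rewrite subrr.
  by rewrite add0r addrK.
have half m : W m * normc (h m) <= N / 2.
  have := exp_norm_point m hc St t0; rewrite hmap -/(W m) /w1 !normcM chi0 normc_real (gtr0_norm s0).
  have e0 := expR_gt0 (nu * normc tau0 ^+ kp).
  have te0 : 0 < normc tau0 * expR (nu * normc tau0 ^+ kp) by rewrite mulr_gt0.
  rewrite (_ : _ * (_ * _) = s * (W m * normc (h m)) * (normc tau0 * expR (nu * normc tau0 ^+ kp))); last by ring.
  rewrite -[varpi / 2 * _ * _]mulrA ler_pM2r// (_ : varpi / 2 = s * (N / 2)); last first.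
    by rewrite /s mulrA divfK// gt_eqF.
  by rewrite ler_pM2l.
have : N <= N / 2 by apply: ge_sup; [case: hA|move=> _ [m _ <-]].
by rewrite leNgt ltr_pdivrMr// ltr_pMr// ltr1n.
Qed.

End FixedPointsAgree.

(** * Exponentially small differences *)

Section GrowthComparison.
Variable R : realType.

(** A form of Young's inequality without roots. Where the difference is positive, s y^(k-j) < A; if
    A y^j exceeded B, combining the powers k - j and j of these two inequalities would contradict
    the hypothesis on A^k. *)
Lemma young_monomials (A s y B : R) (j k : nat) : 0 <= A -> 0 < s -> 0 <= y -> 0 <= B ->
  (0 < j < k)%N -> A ^+ k <= s ^+ j * B ^+ (k - j) -> A * y ^+ j - s * y ^+ k <= B.
Proof.
move=> A0 s0 y0 B0 /andP[j0 jk] h.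
have [le|lt] := leP (A * y ^+ j) (s * y ^+ k); first lra.
have yp : 0 < y.
  rewrite lt_def y0 andbT; apply: contraTneq lt => ->.
  by rewrite !expr0n !gtn_eqF ?mulr0 ?ltxx// (ltn_trans j0).
have yk : y ^+ k = y ^+ (k - j) * y ^+ j by rewrite -exprD subnK// ltnW.
have sA : s * y ^+ (k - j) < A by move: lt; rewrite yk mulrA ltr_pM2r// exprn_gt0.
have skn : 0 <= s * y ^+ k by rewrite mulr_ge0 ?exprn_ge0// ltW.
suff : A * y ^+ j <= B by lra.
rewrite leNgt; apply/negP => Bl.
have kj : (0 < k - j)%N by rewrite subn_gt0.
have h1 : B ^+ (k - j) < (A * y ^+ j) ^+ (k - j).
  by rewrite ltrXn2r ?nnegrE// ?mulr_ge0 ?exprn_ge0// -?lt0n// gtn_eqF.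
have h2 : (s * y ^+ (k - j)) ^+ j <= A ^+ j.
  by rewrite lerXn2r ?nnegrE ?mulr_ge0 ?exprn_ge0// ?(ltW s0)// ltW.
have h3 : s ^+ j * B ^+ (k - j) < s ^+ j * (A * y ^+ j) ^+ (k - j) by rewrite ltr_pM2l// exprn_gt0.
have h4 : s ^+ j * (A * y ^+ j) ^+ (k - j) = A ^+ (k - j) * (s * y ^+ (k - j)) ^+ j.
  by rewrite !exprMn -!exprM [(j * _)%N]mulnC; ring.
have h5 : A ^+ (k - j) * (s * y ^+ (k - j)) ^+ j <= A ^+ k.
  by rewrite -[in leRHS](subnK (ltnW jk)) exprD ler_wpM2l// exprn_ge0.
by rewrite h4 in h3; have := lt_le_trans h3 h5; rewrite ltNge h.
Qed.

(** Since M < N q, the term (d E^N)^q wins as soon as E >= max(1, K / d^q); L takes care of smaller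
    E. *)
Lemma monomial_power_bound (K d : R) (M N q : nat) : 0 <= K -> 0 < d -> (M < N * q)%N ->
  exists2 L : R, 0 <= L & forall E, 0 <= E -> K * E ^+ M <= (L + d * E ^+ N) ^+ q.
Proof.
move=> K0 d0 MN; have q0 : (0 < q)%N by case: q MN => //; rewrite muln0.
have dq : 0 < d ^+ q by rewrite exprn_gt0.
pose E0 := Num.max 1 (K / d ^+ q).
have E01 : 1 <= E0 by rewrite le_max lexx.
have E0K : K <= d ^+ q * E0 by rewrite mulrC -ler_pdivrMr// le_max lexx orbT.
have E00 : 0 <= E0 by rewrite (le_trans _ E01).
have L1 : 1 <= 1 + K * E0 ^+ M by rewrite lerDl mulr_ge0// exprn_ge0.
exists (1 + K * E0 ^+ M) => [|E Ege0]; first by rewrite (le_trans _ L1).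
have dE : 0 <= d * E ^+ N by rewrite mulr_ge0 ?exprn_ge0// ltW.
move: (1 + _) L1 (lerDr (K * E0 ^+ M) 1) => L L1; rewrite ler01 => KL.
have [EE|EE] := leP E E0.
  apply: (@le_trans _ _ (K * E0 ^+ M)); first by rewrite ler_wpM2l// lerXn2r// nnegrE.
  apply: (le_trans KL); apply: (@le_trans _ _ (L ^+ q)).
    by rewrite -[leLHS]expr1 ler_weXn2l.
  by rewrite lerXn2r ?nnegrE ?lerDl// ?addr_ge0// (le_trans _ L1).
have E1 : 1 <= E by rewrite (le_trans E01)// ltW.
apply: (@le_trans _ _ ((d * E ^+ N) ^+ q)); last first.
  by rewrite lerXn2r ?nnegrE ?lerDr// ?addr_ge0// (le_trans _ L1).
apply: (@le_trans _ _ (d ^+ q * E ^+ M.+1)).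
  rewrite exprS mulrA ler_wpM2r ?exprn_ge0// (le_trans E0K)// ler_wpM2l ?(ltW dq) ?(ltW EE)//.
by rewrite exprMn -exprM ler_wpM2l ?(ltW dq)// ler_weXn2l.
Qed.

End GrowthComparison.

Section RayDifference.
Variable R : realType.
Variable P : equation_data R.
Hypothesis hP : equation_hyp P.
Local Notation C := R[i].
Local Notation mu := (@lebesgue_measure R).
Local Notation k1 := P.(k1).
Local Notation k2 := P.(k2).
Local Notation kp := P.(kp).
Local Notation nu := P.(nu).

(** The condition on mu2 with denominators cleared, using 1/kp - 1/k2 = (k2 - kp) / (kp k2); this
    integer form is what [inner_growth] needs for j = mu2 - lam2. *)
Lemma order_gap (mu2 : nat) : (P.(lam2) < mu2)%N ->
  (mu2%:R - P.(lam2)%:R) * (kp%:R^-1 - k2%:R^-1)^-1 < P.(lam1)%:R * P.(Defs.k1)%:R :> R ->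
  ((mu2 - P.(lam2)) * (kp * k2) < P.(lam1) * k1 * (k2 - kp))%N.
Proof.
move=> lm; have /andP[kp1 kk] := orders_kp2 hP.
have kp0 : (0 < kp)%N by exact: ltnW. have k20 : (0 < k2)%N by exact: ltn_trans kk.
have d0 : 0 < k2%:R - kp%:R :> R by rewrite subr_gt0 ltr_nat.
have p0 : 0 < kp%:R :> R by rewrite ltr0n.
have p2 : 0 < k2%:R :> R by rewrite ltr0n.
have -> : (kp%:R^-1 - k2%:R^-1)^-1 = (kp%:R * k2%:R) / (k2%:R - kp%:R) :> R.
  by field; rewrite !gt_eqF.
rewrite mulrA ltr_pdivrMr// -(natrB _ (ltnW lm)) -(natrB _ (ltnW kk)) -!natrM ltr_nat.
by [].
Qed.

(** E stands for 1/|epsilon| and X for |T2|. The term + r leaves exp(-r) for convergence and is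
    absorbed through r <= 1 + r^kp. In y = r / X the maximum is of order X^(kp k2 / (k2 - kp)), a
    power of E below N by the gap condition. *)
Lemma inner_growth (d s R2 : R) (j N : nat) : 0 < d -> 0 < s -> 0 <= R2 ->
  (j * (kp * k2) < N * (k2 - kp))%N ->
  exists2 L : R, 0 <= L & forall E X r, 0 <= E -> 0 < X -> X <= R2 * E ^+ j -> 0 <= r ->
    nu * r ^+ kp + r - s * (r / X) ^+ k2 <= L + d * E ^+ N.
Proof.
move=> d0 s0 R20 jN; have /andP[kp1 kk] := orders_kp2 hP; have kp0 := ltnW kp1.
have nu1 : 0 <= nu + 1 by have := hyp_nu hP; lra.
(* K is chosen so that ((nu + 1) X^kp)^k2 <= s^kp K E^(j kp k2) for X <= R2 E^j, the hypothesis of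
   [young_monomials] once K E^(j kp k2) is bounded by the power k2 - kp. *)
pose K := (nu + 1) ^+ k2 * R2 ^+ (kp * k2) / s ^+ kp.
have skp : 0 < s ^+ kp by rewrite exprn_gt0.
have K0 : 0 <= K by rewrite /K divr_ge0 ?(ltW skp)// mulr_ge0// exprn_ge0.
have [L L0 hL] := monomial_power_bound K0 d0 jN.
exists (L + 1) => [|E X r E0 X0 XE r0]; first by rewrite addr_ge0.
have B0 : 0 <= L + d * E ^+ N by rewrite addr_ge0// mulr_ge0 ?exprn_ge0// ltW.
have y0 : 0 <= r / X by rewrite divr_ge0// ltW.
have A0 : 0 <= (nu + 1) * X ^+ kp by rewrite mulr_ge0// exprn_ge0// ltW.
have := young_monomials A0 s0 y0 B0 (introT andP (conj kp0 kk)).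
have -> : (nu + 1) * X ^+ kp * (r / X) ^+ kp = (nu + 1) * r ^+ kp.
  by rewrite -mulrA -exprMn mulrCA mulfV ?mulr1// gt_eqF.
move=> h; suff h1 : (nu + 1) * r ^+ kp - s * (r / X) ^+ k2 <= L + d * E ^+ N.
  have := le_1X kp0 r0; move: h1; clear h; move: (s * _) (r ^+ kp) (E ^+ N) => u v e; lra.
apply: h; apply: (@le_trans _ _ (s ^+ kp * (K * E ^+ (j * (kp * k2))))); last first.
  by rewrite ler_pM2l// hL.
rewrite /K mulrA [s ^+ kp * _]mulrC divfK ?gt_eqF// exprMn -mulrA ler_wpM2l ?exprn_ge0//.
by rewrite -exprM [E ^+ _]exprM -exprMn lerXn2r ?nnegrE ?mulr_ge0 ?exprn_ge0// ltW.
Qed.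

(** On the arc and on both tails |u| >= c, so exp(-s (c/|T1|)^k1) factors out, while L absorbs the
    growth and leaves exp(-r). The arc contributes 2 c pi and each tail twice the integral of
    exp(-r/2). *)
Lemma ray_difference (g g' : C -> C) (K L s c t t' c1 c2 : R) (T1 T2 : C) :
  0 <= K -> 0 < s -> 0 < c -> t <= t' -> t' - t <= pi -> T1 = (normc T1)%:C * expi c1 -> T1 != 0 ->
  T2 = (normc T2)%:C * expi c2 -> T2 != 0 ->
  (forall th, t <= th <= t' -> s <= cos (k1%:R * (th - c1)) /\ s <= cos (k2%:R * (th - c2))) ->
  (forall r, 0 <= r -> nu * r ^+ kp + r - s * (r / normc T2) ^+ k2 <= L) ->
  (forall r th, 0 < r -> th = t \/ r <= c /\ t <= th <= t' ->
    normc (g (r%:C * expi th)) <= K * r * expR (nu * r ^+ kp)) ->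
  (forall r, 0 < r -> normc (g' (r%:C * expi t')) <= K * r * expR (nu * r ^+ kp)) ->
  (forall u, 0 < normc u <= c -> g u = g' u /\ differentiable g u) ->
  ray_integrable t (borel_laplace_integrand P g T1 T2) ->
  ray_integrable t' (borel_laplace_integrand P g' T1 T2) ->
  normc (ray_int t' (borel_laplace_integrand P g' T1 T2) - ray_int t (borel_laplace_integrand P g T1 T2))
    <= (2 * (c * pi) + 4 * \int[mu]_(r in `[0, +oo[) expR (- (2^-1 * r)))
       * (K * expR (L - s * (c / normc T1) ^+ k1)).
Proof.
move=> K0 s0 c0 tt' ttpi T1E T10 T2E T20 hcos hL hg hg' gg' ig ig'.
have n1 : 0 < normc T1 by rewrite normc_gt0.
have n2 : 0 < normc T2 by rewrite normc_gt0.
set I0 := \int[mu]_(r in _) _.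
pose G := borel_laplace_integrand P g T1 T2; pose G' := borel_laplace_integrand P g' T1 T2.
pose Z := s * (c / normc T1) ^+ k1.
(* The bound L absorbs the growth of g, leaving the factor exp(-r). *)
have hker (f : C -> C) r th : 0 < r -> t <= th <= t' ->
    normc (f (r%:C * expi th)) <= K * r * expR (nu * r ^+ kp) ->
    normc (borel_laplace_integrand P f T1 T2 (r%:C * expi th)) <=
    K * expR (L - r - s * (r / normc T1) ^+ k1).
  move=> r0 hth hf; have [s1 s2] := hcos th hth.
  have nr : normc (r%:C * expi th) = r by rewrite normcM normc_expi mulr1 normc_real gtr0_norm.
  rewrite /borel_laplace_integrand !normcM normcV nr ler_pdivrMr// normc_cexp.
  apply: (le_trans (ler_wpM2r (expR_ge0 _) hf)).
  have hRe : nu * r ^+ kp + Re (- (r%:C * expi th / T1) ^+ k1 - (r%:C * expi th / T2) ^+ k2) <=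
      L - r - s * (r / normc T1) ^+ k1.
    rewrite cReD !cReN (ReV_polar _ _ _ T1E) (ReV_polar _ _ _ T2E).
    have := hL r (ltW r0).
    have p1 : 0 <= (r / normc T1) ^+ k1 by rewrite exprn_ge0// divr_ge0// ltW.
    have p2 : 0 <= (r / normc T2) ^+ k2 by rewrite exprn_ge0// divr_ge0// ltW.
    move: (ler_wpM2r p1 s1) (ler_wpM2r p2 s2).
    rewrite [cos _ * (r / normc T1) ^+ k1]mulrC [cos _ * (r / normc T2) ^+ k2]mulrC.
    by move: (_ * cos _) (_ * cos _) (s * _) (s * _) (nu * _) => x1 x2 y1 y2 v; lra.
  move: (Re _) hRe => re hRe.
  rewrite [leLHS](_ : _ = K * expR (nu * r ^+ kp + re) * r); last by rewrite expRD; ring.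
  by rewrite ler_wpM2r ?(ltW r0)// ler_wpM2l// ler_expR.
have agree r th : 0 <= r <= c -> G' (r%:C * expi th) = G (r%:C * expi th).
  move=> /andP[]; rewrite le_eqVlt => /orP[/eqP <- _|r0 rc].
    by rewrite /G' /G /borel_laplace_integrand mul0r invr0 !mulr0.
  rewrite /G' /G /borel_laplace_integrand; have [|-> //] := gg' (r%:C * expi th).
  by rewrite normcM normc_expi mulr1 normc_real gtr0_norm// r0.
have bG r th : 0 <= r <= c -> t <= th <= t' -> normc (G (r%:C * expi th)) <= K * expR L.
  move=> /andP[]; rewrite le_eqVlt => /orP[/eqP <- _ _|r0 rc hth].
    by rewrite /G /borel_laplace_integrand mul0r invr0 mulr0 normc0 mulr_ge0// expR_ge0.
  apply: (le_trans (hker g r th r0 hth (hg r th r0 (or_intror (conj rc hth))))).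
  rewrite ler_wpM2l// ler_expR.
  have : 0 <= s * (r / normc T1) ^+ k1 by rewrite mulr_ge0 ?exprn_ge0 ?divr_ge0// ltW.
  by move: (s * _) => v; lra.
have dG r th : 0 < r <= c -> t <= th <= t' -> differentiable G (r%:C * expi th).
  move=> /andP[r0 rc] hth.
  have u0 : r%:C * expi th != 0 :> C.
    by rewrite mulf_neq0 ?expi_neq0// -normc_gt0 normc_real normr_gt0 gt_eqF.
  have [|_ dg] := gg' (r%:C * expi th).
    by rewrite normcM normc_expi mulr1 normc_real gtr0_norm// r0.
  by exact: borel_laplace_differentiable.
(* Up to radius c both rays carry the same integrand G, so their difference there is the arc of
   radius c. *)
have E1 := polar_cauchy0 c0 tt' dG bG.
have arc : normc (cint `[t, t'] (arc_integrand c G)) <= 2 * (c * pi) * (K * expR (L - Z)).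
  apply: (le_trans (normc_cint_itv (M := c * (K * expR (L - Z))) tt' _ _)).
  - apply: cintegrable_itv => th hth; apply: continuous_arc.
    by apply: differentiable_continuous; apply: dG => //; rewrite c0 lexx.
  - move=> th hth; rewrite /arc_integrand normcM [normc ((0 +i* c) * _)]normcM normc_expi mulr1.
    have -> : normc (0 +i* c : C) = c.
      by rewrite (_ : 0 +i* c = (0 +i* 1) * c%:C) ?normcM ?normc_i ?mul1r ?normc_real ?gtr0_norm//;
        apply: complex_ext => /=; ring.
    rewrite mulrC ler_wpM2l ?(ltW c0)//.
    have := hker g c th c0 hth (hg c th c0 (or_intror (conj (lexx c) hth))).
    move=> h; apply: (le_trans h).
    by rewrite ler_wpM2l// ler_expR -/Z; lra.
  rewrite -!mulrA ler_wpM2l// ler_wpM2l ?(ltW c0)// mulrA [leRHS]mulrC ler_wpM2l//.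
  by rewrite mulr_ge0// expR_ge0.
have tail (f : C -> C) th : t <= th <= t' -> ray_integrable th (borel_laplace_integrand P f T1 T2) ->
    (forall r, 0 < r -> normc (f (r%:C * expi th)) <= K * r * expR (nu * r ^+ kp)) ->
    normc (cint `]c, +oo[ (ray_integrand th (borel_laplace_integrand P f T1 T2))) <=
    2 * I0 * (K * expR (L - Z)).
  move=> hth ifi hf.
  have KZ0 : 0 <= K * expR (L - Z) by rewrite mulr_ge0// expR_ge0.
  apply: (le_trans (normc_cint_tail (K := K * expR (L - Z)) (ltW c0) KZ0 ifi _)).
    move=> r cr; have r0 : 0 < r by exact: lt_trans cr.
    rewrite /ray_integrand normcM normc_expi mulr1.
    apply: (le_trans (hker f r th r0 hth (hf r r0))); rewrite -mulrA ler_wpM2l// -expRD ler_expR.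
    have : Z <= s * (r / normc T1) ^+ k1.
      rewrite /Z ler_wpM2l ?(ltW s0)// lerXn2r ?nnegrE ?divr_ge0 ?(ltW r0) ?(ltW c0) ?(ltW n1)//.
      by rewrite ler_wpM2r ?invr_ge0 ?(ltW n1)// ltW.
    by move: (s * _) => v; lra.
  have I00 : 0 <= I0 by apply: Rintegral_ge0 => x _; exact: expR_ge0.
  rewrite -/I0; move: (K * expR (L - Z)) KZ0 => KE KE0.
  rewrite [leLHS](_ : _ = 2 * I0 * KE * expR (- (2^-1 * c))); last by ring.
  rewrite -[leRHS]mulr1 ler_wpM2l//; first by rewrite mulr_ge0// mulr_ge0.
  by rewrite -[leRHS]expR0 ler_expR oppr_le0 mulr_ge0// ltW.
have -> : ray_int t' G' - ray_int t G = cint `[t, t'] (arc_integrand c G)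
    + (cint `]c, +oo[ (ray_integrand t' G') - cint `]c, +oo[ (ray_integrand t G)).
  rewrite /ray_int (cint_ray_split (ltW c0) ig) (cint_ray_split (ltW c0) ig') -E1.
  have -> : cint `[0, c] (ray_integrand t' G') = cint `[0, c] (ray_integrand t' G).
    by apply: eq_cint => r; rewrite /= in_itv/= => hr; rewrite /ray_integrand agree.
  move: (cint _ _) (cint _ _) => x y; move: (cint _ _) (cint _ _) => v v'; ring.
have tail1 := tail g' t' ltac:(by rewrite tt' lexx) ig' hg'.
have tail2 := tail g t ltac:(by rewrite tt' lexx) ig (fun r r0 => hg r t r0 (or_introl erefl)).
rewrite (le_trans (normcD _ _))//.
have := normcB (cint `]c, +oo[ (ray_integrand t' G')) (cint `]c, +oo[ (ray_integrand t G)).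
move: tail1 tail2 arc; rewrite -/G -/G' -/Z; move: (normc (_ - _)) (normc _) (normc _) (normc _) (K * _) => a b c' d e h1 h2 h3 h4.
rewrite mulrDl (_ : 4 * I0 * e = 2 * I0 * e + 2 * I0 * e); last by ring.
by move: (2 * I0 * e) (2 * (c * pi) * e) h1 h2 h3 => u v h1 h2 h3; lra.
Qed.

End RayDifference.

Section Alignment.
Variable R : realType.
Local Notation C := R[i].

(** Each condition comes with its own determination of arg T1 or arg T2. As k1, k2 >= 1, a good
    direction is within pi / 2 of both arguments, so the two shifts n1 and n2 differ by less than 1;
    one rotation of xi' by whole turns then serves T1 and T2. *)
Lemma directions_aligned (delta : R) (k1 k2 : nat) (xi xi' : R) (T1 T2 : C) : (0 < k1)%N -> (0 < k2)%N ->
  0 < delta ->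
  good_direction delta k1 xi T1 -> good_direction delta k2 xi T2 ->
  good_direction delta k1 xi' T1 -> good_direction delta k2 xi' T2 ->
  exists t' c1 c2 : R, [/\ expi t' = expi xi' :> C, T1 = (normc T1)%:C * expi c1,
    T2 = (normc T2)%:C * expi c2, `|t' - xi| <= pi &
    [/\ `|k1%:R * (xi - c1)| <= pi / 2 - delta, `|k2%:R * (xi - c2)| <= pi / 2 - delta,
        `|k1%:R * (t' - c1)| <= pi / 2 - delta & `|k2%:R * (t' - c2)| <= pi / 2 - delta]].
Proof.
move=> k10 k20 d0 [T10 [c1 [E1 a1 b1]]] [T20 [c2 [E2 a2 b2]]] [_ [c1' [E1' a1' b1']]] [_ [c2' [E2' a2' b2']]].
have shift (T : C) x y : T != 0 -> T = (normc T)%:C * expi x -> T = (normc T)%:C * expi y ->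
    exists n : int, y = x + n%:~R * (2 * pi).
  move=> T0 Ex Ey; have nT : 0 < normc T by rewrite normc_gt0.
  have [|_ [n ->]] := polar_inj nT nT (a := y) (b := x); first by rewrite -Ex.
  by exists n.
have [n1 e1] := shift _ _ _ T10 E1 E1'; have [n2 e2] := shift _ _ _ T20 E2 E2'.
have pi0 := pi_gt0 R.
have small k (x : R) : (0 < k)%N -> - (pi / 2) + delta < k%:R * x -> k%:R * x < pi / 2 - delta -> `|x| < pi / 2.
  move=> k0 h1 h2; have k1R : 1 <= k%:R :> R by rewrite ler1n.
  have h : `|k%:R * x| < pi / 2 by rewrite ltr_norml; apply/andP; split; lra.
  apply: le_lt_trans h; rewrite normrM normr_nat -[leLHS]mul1r ler_wpM2r//.
pose t' := xi' - n2%:~R * (2 * pi).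
rewrite -!mulrBr in a1 b1 a2 b2 a1' b1' a2' b2'.
have n12 : n1 = n2.
  have := small k1 _ k10 a1 b1; have := small k2 _ k20 a2 b2.
  have := small k1 _ k10 a1' b1'; have := small k2 _ k20 a2' b2'.
  rewrite !ltr_norml => /andP[h1 h2] /andP[h3 h4] /andP[h5 h6] /andP[h7 h8].
  have hD : (n1 - n2)%:~R * (2 * pi) = (c1' - c1) - (c2' - c2) :> R.
    by rewrite e1 e2 intrB mulrBl [c1 + _]addrC addrK [c2 + _]addrC addrK.
  have p2 : 0 < 2 * pi :> R by rewrite mulr_gt0.
  have h9 : (n1 - n2)%:~R < 1 :> R by rewrite -(ltr_pM2r p2) hD; clear -h1 h2 h3 h4 h5 h6 h7 h8 pi0; lra.
  have h10 : - 1 < (n1 - n2)%:~R :> R by rewrite -(ltr_pM2r p2) hD; clear -h1 h2 h3 h4 h5 h6 h7 h8 pi0; lra.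
  rewrite -[1]/(1%:~R) ltr_int in h9; rewrite -[1]/(1%:~R) -rmorphN ltr_int in h10.
  by clear -h9 h10; lia.
exists t', c1, c2; split => //.
- by rewrite /t' expiD expiN expi2piz invr1 mulr1.
- have := small k2 _ k20 a2 b2; have := small k2 _ k20 a2' b2'.
  rewrite e2 !ltr_norml => /andP[h1 h2] /andP[h3 h4]; rewrite ler_norml /t'; apply/andP; split; lra.
have E3 : t' - c1 = xi' - c1' by rewrite /t' e1 n12; ring.
have E4 : t' - c2 = xi' - c2' by rewrite /t' e2; ring.
rewrite E3 E4 !ler_norml; clear -a1 b1 a2 b2 a1' b1' a2' b2'.
by split; apply/andP; split; lra.
Qed.

End Alignment.

Section InnerDifference.
Variable R : realType.
Variable P : equation_data R.
Hypothesis hP : equation_hyp P.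
Local Notation C := R[i].
Local Notation mu := (@lebesgue_measure R).
Local Notation k1 := P.(k1).
Local Notation k2 := P.(k2).
Local Notation kp := P.(kp).
Local Notation nu := P.(nu).
Local Notation beta := P.(beta).

Lemma exp_ball_sector_tame (rho varpi a b : R) w : 0 < varpi ->
  exp_ball P (sector a b) rho varpi w -> tame kp beta (sector a b) w.
Proof.
move=> v0 bw; apply: (exp_ball_tame hP (ltW v0) bw (@sector_open R a b)) => [x Sx|]; first by left.
move=> [r [t [r0 _ _]]] /eqP; rewrite eq_sym mulf_eq0 (negPf (expi_neq0 t)) orbF.
by rewrite -normc_eq0 normc_real normr_eq0 gt_eqF.
Qed.

Lemma sol_ray_integrandE (w : C -> R -> C) (t1 t2 z eps : C) m :
  sol_ray_integrand P (fun tau m _ => w tau m) t1 t2 z eps m =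
  borel_laplace_integrand P (fun u => w u m * cexp ((0 +i* 1) * z * m%:C))
    (eps ^+ P.(lam1) * t1) (eps ^+ P.(lam2) * t2).
Proof.
apply/funext => u; rewrite /sol_ray_integrand /borel_laplace_integrand.
by move: (cexp _) (cexp _) => x y; ring.
Qed.

(** [ray_difference] for each m, with radius rho / 2 so that the arc lies in the open disc where w
    is holomorphic; the rate beta - beta' survives exp(|Im z| |m|) and makes the bound integrable in
    m. *)
Lemma inner_sol_difference (rho varpi beta' s L c1 c2 t t' a b a' b' : R) (w w' : C -> R -> C)
    (t1 t2 z eps : C) : 0 < rho -> 0 < varpi -> 0 < s ->
  exp_ball P (sector a b) rho varpi w -> exp_ball P (sector a' b') rho varpi w' ->
  (forall u m, cdisc rho u -> u != 0 -> w u m = w' u m) ->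
  sector a b (expi t) -> sector a' b' (expi t') -> t <= t' -> t' - t <= pi ->
  beta' < beta -> strip beta' z ->
  let T1 := eps ^+ P.(lam1) * t1 in let T2 := eps ^+ P.(lam2) * t2 in
  T1 = (normc T1)%:C * expi c1 -> T1 != 0 -> T2 = (normc T2)%:C * expi c2 -> T2 != 0 ->
  good_direction 0 k2 t T2 -> good_direction 0 k2 t' T2 ->
  (forall th, t <= th <= t' -> s <= cos (k1%:R * (th - c1)) /\ s <= cos (k2%:R * (th - c2))) ->
  (forall r, 0 <= r -> nu * r ^+ kp + r - s * (r / normc T2) ^+ k2 <= L) ->
  normc (inner_sol P w' t' t1 t2 z eps - inner_sol P w t t1 t2 z eps) <=
  (Num.sqrt (2 * pi))^-1 * (2 * ((2 * (rho / 2 * pi) + 4 * \int[mu]_(r in `[0, +oo[) expR (- (2^-1 * r)))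
    * varpi * expR (L - s * (rho / 2 / normc T1) ^+ k1)
    * \int[mu]_(m in setT) expR (- ((beta - beta') * `|m|)))).
Proof.
move=> rho0 v0 s0 bw bw' ww' St St' tt' ttpi bb sz T1 T2 T1E T10 T2E T20 g g' hcos hL.
have tw := exp_ball_sector_tame v0 bw; have tw' := exp_ball_sector_tame v0 bw'.
have zb : `|Im z| < beta by apply: lt_trans bb.
have Sr r : 0 < r -> sector a b (r%:C * expi t) by move=> r0; exact: sector_cone.
have Sr' r : 0 < r -> sector a' b' (r%:C * expi t') by move=> r0; exact: sector_cone.
have [i1 j1] := inner_sol_converges hP t1 tw Sr g zb.
have [i2 j2] := inner_sol_converges hP t1 tw' Sr' g' zb.
rewrite /inner_sol /sol -mulrBr normcM normc_real ger0_norm ?invr_ge0 ?sqrtr_ge0//.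
rewrite ler_wpM2l ?invr_ge0 ?sqrtr_ge0// -(cintB measurableT j2 j1).
pose C0 := (2 * (rho / 2 * pi) + 4 * \int[mu]_(r in `[0, +oo[) expR (- (2^-1 * r)))
    * varpi * expR (L - s * (rho / 2 / normc T1) ^+ k1).
have bz : 0 < beta - beta' by lra.
have im := integrable_expN bz.
have rho2 : 0 < rho / 2 by rewrite divr_gt0.
have nr r th : 0 < r -> normc (r%:C * expi th) = r.
  by move=> r0; rewrite normcM normc_expi mulr1 normc_real gtr0_norm.
have n0 r th : 0 < r -> r%:C * expi th != 0 :> C by move=> r0; rewrite -normc_gt0 nr.
have key m : normc (ray_int t' (sol_ray_integrand P (fun tau m _ => w' tau m) t1 t2 z eps m)
    - ray_int t (sol_ray_integrand P (fun tau m _ => w tau m) t1 t2 z eps m)) <=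
    C0 * expR (- ((beta - beta') * `|m|)).
  have := i1 m; have := i2 m; rewrite !sol_ray_integrandE => i2' i1'.
  pose e := cexp ((0 +i* 1) * z * m%:C).
  have he : normc e <= expR (beta' * `|m|).
    by apply: (le_trans (normc_cexpi z m)); rewrite ler_expR ler_wpM2r// ltW.
  pose K := varpi * expR (- ((beta - beta') * `|m|)).
  have K0 : 0 <= K by rewrite mulr_ge0 ?expR_ge0// ltW.
  have bound A (v : C -> R -> C) r th : exp_ball P A rho varpi v -> 0 < r -> (A `|` cdisc rho) (r%:C * expi th) ->
      normc (v (r%:C * expi th) m * e) <= K * r * expR (nu * r ^+ kp).
    move=> bv r0 Ar; have := exp_ball_bound hP m bv Ar (n0 _ _ r0); rewrite nr// => hv.
    rewrite normcM; apply: (le_trans (ler_pM (normc_ge0 _) (normc_ge0 _) hv he)).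
    rewrite /K (_ : - ((beta - beta') * `|m|) = - (beta * `|m|) + beta' * `|m|); last by ring.
    by rewrite expRD le_eqVlt; apply/orP; left; apply/eqP; ring.
  have := @ray_difference R P (fun u => w u m * e) (fun u => w' u m * e) K L s (rho / 2) t t' c1 c2
    T1 T2 K0 s0 rho2 tt' ttpi T1E T10 T2E T20 hcos hL.
  have h1 r th : 0 < r -> th = t \/ r <= rho / 2 /\ t <= th <= t' ->
      normc (w (r%:C * expi th) m * e) <= K * r * expR (nu * r ^+ kp).
    move=> r0 hr; apply: (bound _ _ _ _ bw r0); case: hr => [->|[rr _]]; [left; exact: Sr|right].
    have : normc (r%:C * expi th) <= rho by rewrite nr//; lra.
    by [].
  have h2 r : 0 < r -> normc (w' (r%:C * expi t') m * e) <= K * r * expR (nu * r ^+ kp).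
    by move=> r0; apply: (bound _ _ _ _ bw' r0); left; exact: Sr'.
  have h3 u : 0 < normc u <= rho / 2 -> w u m * e = w' u m * e /\ differentiable (fun u => w u m * e) u.
    move=> /andP[u0 ur]; split.
      by rewrite ww' -?normc_gt0//; suff : normc u <= rho by []; lra.
    apply: (differentiableM (f := fun u : C => w u m) (g := fun=> e)); last exact: differentiable_cst.
    have ur' : normc u < rho by clear -ur rho0; lra.
    by have [[_ hw _] _] := bw; apply: hw; right.
  move=> /(_ h1 h2 h3 i1' i2') H; apply: (le_trans H).
  by rewrite /C0 /K le_eqVlt; apply/orP; left; apply/eqP; ring.
have ig : mu.-integrable setT (EFin \o (fun m => C0 * expR (- ((beta - beta') * `|m|)))).
  exact: (integrableZl measurableT C0 im).
apply: (le_trans (normc_cint_le measurableT (cintegrableB measurableT j2 j1) ig (fun m _ => key m))).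
by rewrite RintegralZl// mulrA.
Qed.

(** The constants precede the sectors, the symbols, epsilon and the variables. |T1| <= r1
    |epsilon|^lam1 turns the gain in k1 into 2 d / |epsilon|^(lam1 k1), of which [inner_growth]
    consumes half. *)
Lemma inner_sol_difference_bound (rho varpi beta' delta r1 R2 : R) (j : nat) :
  0 < rho -> 0 < varpi -> beta' < beta -> 0 < delta -> 0 < r1 -> 0 <= R2 ->
  (j * (kp * k2) < P.(lam1) * k1 * (k2 - kp))%N ->
  exists Ct Dt : R, [/\ 0 < Ct, 0 < Dt &
    forall (a b a' b' : R) (w w' : C -> R -> C) (eps t1 t2 z : C) (xi xi' : R),
    exp_ball P (sector a b) rho varpi w -> exp_ball P (sector a' b') rho varpi w' ->
    (forall u m, cdisc rho u -> u != 0 -> w u m = w' u m) ->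
    let T1 := eps ^+ P.(lam1) * t1 in let T2 := eps ^+ P.(lam2) * t2 in
    eps != 0 -> normc t1 <= r1 -> normc T2 <= R2 * (normc eps)^-1 ^+ j -> strip beta' z ->
    sector a b (expi xi) -> good_direction delta k1 xi T1 -> good_direction delta k2 xi T2 ->
    sector a' b' (expi xi') -> good_direction delta k1 xi' T1 -> good_direction delta k2 xi' T2 ->
    normc (inner_sol P w' xi' t1 t2 z eps - inner_sol P w xi t1 t2 z eps)
      <= Ct * expR (- (Dt / normc eps ^+ (P.(lam1) * k1)))].
Proof.
move=> rho0 v0 bb d0 r10 R20 hj.
have pi0 := pi_gt0 R.
(* Capping delta at pi / 4 keeps s = sin del positive; s is the lower bound of both cosines on the
   arc |k (th - c)| <= pi / 2 - del. *)
pose del := Num.min delta (pi / 4).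
have del0 : 0 < del by rewrite lt_min d0 divr_gt0.
have deld : del <= delta by rewrite ge_min lexx.
have del4 : del <= pi / 4 by rewrite ge_min lexx orbT.
pose s := sin del.
have s0 : 0 < s by rewrite sin_gt0_pi// del0/=; lra.
have sE : s = cos (pi / 2 - del) by rewrite cosB cos_pihalf sin_pihalf mul0r add0r mul1r.
have rho2 : 0 < rho / 2 by rewrite divr_gt0.
pose d := s * (rho / 2 / r1) ^+ k1 / 2.
have dp : 0 < d by rewrite divr_gt0// mulr_gt0// exprn_gt0// divr_gt0.
have [L L0 hL] := inner_growth hP dp s0 R20 hj.
pose I0 := \int[mu]_(r in `[0, +oo[) expR (- (2^-1 * r)).
pose I1 := \int[mu]_(m in setT) expR (- ((beta - beta') * `|m|)).
have I00 : 0 <= I0 by apply: Rintegral_ge0 => x _; exact: expR_ge0.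
have I10 : 0 <= I1 by apply: Rintegral_ge0 => x _; exact: expR_ge0.
pose Ct := (Num.sqrt (2 * pi))^-1 * (2 * ((2 * (rho / 2 * pi) + 4 * I0) * varpi * expR L * I1)).
have Ct0 : 0 <= Ct.
  rewrite /Ct mulr_ge0 ?invr_ge0 ?sqrtr_ge0//.
  rewrite mulr_ge0// mulr_ge0// mulr_ge0 ?expR_ge0// mulr_ge0 ?(ltW v0)//.
  apply: addr_ge0; last by rewrite mulr_ge0.
  exact: mulr_ge0 (ler0n _ _) (mulr_ge0 (ltW rho2) (ltW pi0)).
exists (Ct + 1), d; split => //; first by rewrite ltr_wpDl.
have /andP[k10 k12] := orders_k12 hP.
(* The case of ordered directions t <= t'; the other one follows by exchanging the two solutions. *)
have core a b a' b' (w w' : C -> R -> C) (eps t1 t2 z : C) (t t' c1 c2 : R) :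
    exp_ball P (sector a b) rho varpi w -> exp_ball P (sector a' b') rho varpi w' ->
    (forall u m, cdisc rho u -> u != 0 -> w u m = w' u m) ->
    let T1 := eps ^+ P.(lam1) * t1 in let T2 := eps ^+ P.(lam2) * t2 in
    eps != 0 -> normc t1 <= r1 -> normc T2 <= R2 * (normc eps)^-1 ^+ j -> strip beta' z ->
    sector a b (expi t) -> sector a' b' (expi t') -> t <= t' -> `|t' - t| <= pi ->
    T1 = (normc T1)%:C * expi c1 -> T1 != 0 -> T2 = (normc T2)%:C * expi c2 -> T2 != 0 ->
    `|k1%:R * (t - c1)| <= pi / 2 - delta -> `|k2%:R * (t - c2)| <= pi / 2 - delta ->
    `|k1%:R * (t' - c1)| <= pi / 2 - delta -> `|k2%:R * (t' - c2)| <= pi / 2 - delta ->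
    normc (inner_sol P w' t' t1 t2 z eps - inner_sol P w t t1 t2 z eps)
      <= (Ct + 1) * expR (- (d / normc eps ^+ (P.(lam1) * k1))).
  move=> bw bw' ww' T1 T2 e0 t1r T2R sz St St' tt' ttpi T1E T10 T2E T20 x1 x2 x1' x2'.
  have gd x : `|k2%:R * (x - c2)| <= pi / 2 - delta -> good_direction 0 k2 x T2.
    rewrite ler_norml mulrBr => /andP[h1 h2]; split; first exact: T20.
    by exists c2; split; [exact: T2E|clear -h1 h2 d0; lra..].
  have between (k : nat) c th : `|k%:R * (t - c)| <= pi / 2 - delta -> `|k%:R * (t' - c)| <= pi / 2 - delta ->
      t <= th <= t' -> s <= cos (k%:R * (th - c)).
    move=> h1 h2 /andP[h3 h4]; rewrite sE; apply: cos_lower; last by clear -del0; lra.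
    apply: (@le_trans _ _ (pi / 2 - delta)); last by clear -deld; lra.
    move: h1 h2; rewrite !ler_norml => /andP[h5 h6] /andP[h7 h8]; apply/andP; split.
      by apply: (le_trans h5); rewrite ler_wpM2l// lerB.
    by apply: le_trans h8; rewrite ler_wpM2l// lerB.
  have nT2 : 0 < normc T2 by rewrite normc_gt0.
  have ne : 0 < normc eps by rewrite normc_gt0.
  have nT1 : 0 < normc T1 by rewrite normc_gt0.
  pose E := (normc eps)^-1.
  have E0 : 0 < E by rewrite invr_gt0.
  have hd := inner_sol_difference rho0 v0 s0 bw bw' ww' St St' tt' (le_trans (ler_norm _) ttpi) bb sz
    T1E T10 T2E T20 (gd _ x2) (gd _ x2') (fun th hth => conj (between k1 c1 th x1 x1' hth) (between k2 c2 th x2 x2' hth))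
    (fun r r0 => hL E (normc T2) r (ltW E0) nT2 T2R r0).
  apply: (le_trans hd); rewrite -/I0 -/I1 -/T1.
  have hE : L + d * E ^+ (P.(lam1) * k1) - s * (rho / 2 / normc T1) ^+ k1 <= L - d / normc eps ^+ (P.(lam1) * k1).
    have -> : d / normc eps ^+ (P.(lam1) * k1) = d * E ^+ (P.(lam1) * k1) by rewrite exprVn.
    have : 2 * d * E ^+ (P.(lam1) * k1) <= s * (rho / 2 / normc T1) ^+ k1.
      rewrite /d [2 * _]mulrC divfK// -mulrA ler_pM2l// exprM -exprMn.
      have EX : 0 < E ^+ P.(lam1) by rewrite exprn_gt0.
      have q1 : 0 <= rho / 2 / r1 * E ^+ P.(lam1) := mulr_ge0 (divr_ge0 (ltW rho2) (ltW r10)) (ltW EX).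
      have q2 : 0 <= rho / 2 / normc T1 := divr_ge0 (ltW rho2) (ltW nT1).
      have q3 : normc T1 <= r1 * normc eps ^+ P.(lam1).
        by rewrite /T1 normcM normcX mulrC ler_wpM2r// exprn_ge0// ltW.
      have q4 : 0 < r1 * normc eps ^+ P.(lam1) by rewrite mulr_gt0// exprn_gt0.
      rewrite lerXn2r ?nnegrE// -[leLHS]mulrA ler_pM2l// /E exprVn -invfM.
      by rewrite lef_pV2 ?posrE.
    by rewrite -mulrA; move: (d * _) (s * _) => x y h; clear -h; lra.
  apply: (@le_trans _ _ (Ct * expR (- (d / normc eps ^+ (P.(lam1) * k1))))); last first.
    by rewrite ler_wpM2r ?expR_ge0// lerDl.
  rewrite [leRHS](_ : _ = (Num.sqrt (2 * pi))^-1 * (2 * ((2 * (rho / 2 * pi) + 4 * I0) * varpi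
    * (expR L * expR (- (d / normc eps ^+ (P.(lam1) * k1)))) * I1))); last by rewrite /Ct; ring.
  rewrite ler_wpM2l ?invr_ge0 ?sqrtr_ge0// ler_wpM2l// ler_wpM2r// ler_wpM2l; first by [].
    apply: mulr_ge0 _ (ltW v0); apply: addr_ge0; last exact: mulr_ge0 (ler0n _ _) I00.
    exact: mulr_ge0 (ler0n _ _) (mulr_ge0 (ltW rho2) (ltW pi0)).
  by rewrite -expRD ler_expR.
move=> a b a' b' w w' eps t1 t2 z xi xi' bw bw' ww' T1 T2 e0 t1r T2R sz Sx g1 g2 Sx' g1' g2'.
have T10 : T1 != 0 by case: g1. have T20 : T2 != 0 by case: g2.
have [t' [c1 [c2 [E T1E T2E tpi [x1 x2 x1' x2']]]]] :=
  directions_aligned k10 (ltn_trans k10 k12) d0 g1 g2 g1' g2'.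
have -> : inner_sol P w' xi' t1 t2 z eps = inner_sol P w' t' t1 t2 z eps.
  apply: (congr1 (fun x : C => ((Num.sqrt (2 * pi))^-1)%:C * x)); apply: eq_cint => m _.
  by rewrite (ray_int_expi _ E).
rewrite -E in Sx'.
have [le|lt] := leP xi t'.
  exact: (core a b a' b' w w' eps t1 t2 z xi t' c1 c2).
rewrite normc_distC; apply: (core a' b' a b w' w eps t1 t2 z t' xi c1 c2) => //.
- by move=> u m h1 h2; rewrite ww'.
- exact: ltW.
- by rewrite distrC.
Qed.

End InnerDifference.

(** * Bounds and initial data *)

Section InnerBound.
Variable R : realType.
Variable P : equation_data R.
Hypothesis hP : equation_hyp P.
Local Notation C := R[i].
Local Notation mu := (@lebesgue_measure R).
Local Notation k1 := P.(k1).
Local Notation k2 := P.(k2).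
Local Notation kp := P.(kp).
Local Notation nu := P.(nu).
Local Notation beta := P.(beta).

Lemma Rintegral_expN (c : R) : 0 < c -> \int[mu]_(r in `[0, +oo[) expR (- (c * r)) = c^-1.
Proof.
move=> c0.
have E : \int[mu]_(r in `[0, +oo[) (c * expR (- (c * r))) = 1.
  rewrite Rintegral_mkcond /Rintegral.
  rewrite (_ : (fun x => _) = (fun x => (exponential_pdf c x)%:E)).
    by rewrite integral_exponential_pdf.
  apply/funext => x; congr EFin; rewrite /exponential_pdf !patchE; case: ifP => // _.
  by rewrite mulNr.
have ii : mu.-integrable `[0, +oo[ (EFin \o (fun r : R => expR (- (c * r)))).
  have := integrable_ray_majorant 1 c0.
  by rewrite (_ : (fun r : R => 1 * _) = (fun r : R => expR (- (c * r))))//; apply/funext => r; rewrite mul1r.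
by apply: (mulfI (lt0r_neq0 c0)); rewrite -(RintegralZl _ _ ii)// E mulfV// gt_eqF.
Qed.

Lemma inner_sol_norm (rho varpi beta' s A c c1 c2 xi a b : R) (w : C -> R -> C) (t1 t2 z eps : C) :
  0 < varpi -> 0 < s -> 0 < c -> exp_ball P (sector a b) rho varpi w ->
  sector a b (expi xi) -> beta' < beta -> strip beta' z ->
  let T1 := eps ^+ P.(lam1) * t1 in let T2 := eps ^+ P.(lam2) * t2 in
  T1 = (normc T1)%:C * expi c1 -> T2 = (normc T2)%:C * expi c2 ->
  good_direction 0 k2 xi T2 ->
  s <= cos (k1%:R * (xi - c1)) -> s <= cos (k2%:R * (xi - c2)) ->
  (forall r, 0 <= r -> nu * r ^+ kp - s * (r / normc T1) ^+ k1 - s * (r / normc T2) ^+ k2 <= A - c * r) ->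
  normc (inner_sol P w xi t1 t2 z eps) <=
  (Num.sqrt (2 * pi))^-1 * (2 * (2 * (varpi * expR A * c^-1)
    * \int[mu]_(m in setT) expR (- ((beta - beta') * `|m|)))).
Proof.
move=> v0 s0 c0 bw Sx bb sz T1 T2 T1E T2E g h1 h2 hA.
have tw := exp_ball_sector_tame hP v0 bw.
have zb : `|Im z| < beta by apply: lt_trans bb.
have Sr r : 0 < r -> sector a b (r%:C * expi xi) by move=> r0; exact: sector_cone.
have [i1 j1] := inner_sol_converges hP t1 tw Sr g zb.
rewrite /inner_sol /sol normcM normc_real ger0_norm ?invr_ge0 ?sqrtr_ge0//.
rewrite ler_wpM2l ?invr_ge0 ?sqrtr_ge0//.
have bz : 0 < beta - beta' by lra.
have im := integrable_expN bz.
pose C0 := 2 * (varpi * expR A * c^-1).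
have key m : normc (ray_int xi (sol_ray_integrand P (fun tau m _ => w tau m) t1 t2 z eps m)) <=
    C0 * expR (- ((beta - beta') * `|m|)).
  have := i1 m; rewrite sol_ray_integrandE => i1'.
  pose e := cexp ((0 +i* 1) * z * m%:C).
  have he : normc e <= expR (beta' * `|m|).
    by apply: (le_trans (normc_cexpi z m)); rewrite ler_expR ler_wpM2r// ltW.
  pose K := varpi * expR (- ((beta - beta') * `|m|)).
  have K0 : 0 <= K by rewrite mulr_ge0 ?expR_ge0// ltW.
  have hb r : 0 <= r -> normc (ray_integrand xi (borel_laplace_integrand P (fun u => w u m * e) T1 T2) r)
      <= K * expR A * expR (- (c * r)).
    move=> rge0; rewrite /ray_integrand normcM normc_expi mulr1.
    move: rge0; rewrite le_eqVlt => /orP[/eqP <-|r0].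
      rewrite /borel_laplace_integrand mul0r invr0 mulr0 normc0.
      exact: mulr_ge0 (mulr_ge0 K0 (expR_ge0 _)) (expR_ge0 _).
    have nr : normc (r%:C * expi xi) = r by rewrite normcM normc_expi mulr1 normc_real gtr0_norm.
    have n0 : r%:C * expi xi != 0 :> C by rewrite -normc_gt0 nr.
    have hg : normc (w (r%:C * expi xi) m * e) <= K * r * expR (nu * r ^+ kp).
      have := exp_ball_bound hP m bw (or_introl (Sr r r0)) n0; rewrite nr => hv.
      rewrite normcM; apply: (le_trans (ler_pM (normc_ge0 _) (normc_ge0 _) hv he)).
      rewrite /K (_ : - ((beta - beta') * `|m|) = - (beta * `|m|) + beta' * `|m|); last by ring.
      by rewrite expRD le_eqVlt; apply/orP; left; apply/eqP; ring.
    rewrite /borel_laplace_integrand !normcM normcV nr ler_pdivrMr// -normcM normc_cexp.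
    apply: (le_trans (ler_wpM2r (expR_ge0 _) hg)).
    have hRe : nu * r ^+ kp + Re (- (r%:C * expi xi / T1) ^+ k1 - (r%:C * expi xi / T2) ^+ k2) <= A - c * r.
      rewrite cReD !cReN (ReV_polar _ _ _ T1E) (ReV_polar _ _ _ T2E).
      have rn (T : C) : 0 <= r / normc T by rewrite mulr_ge0 ?invr_ge0 ?normc_ge0// ltW.
      have p1 : 0 <= (r / normc T1) ^+ k1 by rewrite exprn_ge0.
      have p2 : 0 <= (r / normc T2) ^+ k2 by rewrite exprn_ge0.
      have := hA r (ltW r0); move: (ler_wpM2r p1 h1) (ler_wpM2r p2 h2).
      rewrite [cos _ * (r / normc T1) ^+ k1]mulrC [cos _ * (r / normc T2) ^+ k2]mulrC.
      move: (_ * cos _) (_ * cos _) (s * _) (s * _) (nu * _) (c * r) => x1 x2 y1 y2 v cr e1 e2 e3.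
      by clear -e1 e2 e3; lra.
    move: (Re _) hRe => re hRe.
    rewrite [leLHS](_ : _ = K * expR (nu * r ^+ kp + re) * r); last by rewrite expRD; ring.
    rewrite ler_wpM2r ?(ltW r0)// -mulrA ler_wpM2l// -expRD ler_expR.
    exact: hRe.
  have ig := integrable_ray_majorant (K * expR A) c0.
  have hb' r : `[0, +oo[%classic r -> normc (ray_integrand xi (borel_laplace_integrand P (fun u => w u m * e) T1 T2) r)
      <= K * expR A * expR (- (c * r)).
    by rewrite /= in_itv/= andbT; exact: hb.
  apply: (le_trans (normc_cint_le _ i1' ig hb')) => //.
  rewrite RintegralZl//; last first.
    have := integrable_ray_majorant 1 c0.
    by rewrite (_ : (fun r : R => 1 * _) = (fun r : R => expR (- (c * r))))//; apply/funext => r; rewrite mul1r.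
  by rewrite Rintegral_expN// /C0 /K le_eqVlt; apply/orP; left; apply/eqP; ring.
have ig : mu.-integrable setT (EFin \o (fun m => C0 * expR (- ((beta - beta') * `|m|)))).
  exact: (integrableZl measurableT C0 im).
apply: (le_trans (normc_cint_le measurableT j1 ig (fun m _ => key m))).
by rewrite RintegralZl.
Qed.

(** One half of the decay in k2 absorbs the growth of omega. Half of the decay in T1, respectively
    the remaining half in T2, gives an integral proportional to |T1|, respectively |T2|: boundedness
    and both initial conditions follow. *)
Lemma inner_sol_bound (rho varpi beta' delta B : R) :
  0 < varpi -> beta' < beta -> 0 < delta -> 0 <= B ->
  exists2 K : R, 0 <= K &
    forall (a b : R) (w : C -> R -> C) (eps t1 t2 z : C) (xi : R),
    exp_ball P (sector a b) rho varpi w ->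
    let T1 := eps ^+ P.(lam1) * t1 in let T2 := eps ^+ P.(lam2) * t2 in
    normc T2 <= B -> strip beta' z ->
    sector a b (expi xi) -> good_direction delta k1 xi T1 -> good_direction delta k2 xi T2 ->
    normc (inner_sol P w xi t1 t2 z eps) <= K * normc T1 /\
    normc (inner_sol P w xi t1 t2 z eps) <= K * normc T2.
Proof.
move=> v0 bb d0 B0.
have pi0 := pi_gt0 R.
pose del := Num.min delta (pi / 4).
have del0 : 0 < del by rewrite lt_min d0 divr_gt0.
have deld : del <= delta by rewrite ge_min lexx.
have del4 : del <= pi / 4 by rewrite ge_min lexx orbT.
pose s := sin del.
have s0 : 0 < s by rewrite sin_gt0_pi// del0/=; lra.
have sE : s = cos (pi / 2 - del) by rewrite cosB cos_pihalf sin_pihalf mul0r add0r mul1r.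
have s20 : 0 < s / 2 by rewrite divr_gt0.
have /andP[k10 k12] := orders_k12 hP; have /andP[kp1 kk] := orders_kp2 hP.
(* With j = 0 and E = 1 the lemma only expresses that |T2| <= B. *)
have [L L0 hL] := @inner_growth R P hP 1 (s / 2) B 0 1 ltr01 s20 B0 ltac:(by rewrite mul0n mul1n subn_gt0).
pose I1 := \int[mu]_(m in setT) expR (- ((beta - beta') * `|m|)).
have I10 : 0 <= I1 by apply: Rintegral_ge0 => x _; exact: expR_ge0.
pose M := (Num.sqrt (2 * pi))^-1 * (2 * (2 * (varpi * expR (L + 1 + s) * (s / 2)^-1) * I1)).
have M0 : 0 <= M.
  apply: mulr_ge0; first by rewrite invr_ge0 sqrtr_ge0.
  apply: mulr_ge0 => //; apply: mulr_ge0 => //; apply: mulr_ge0 => //.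
  by apply: mulr_ge0; [apply: mulr_ge0; [exact: ltW|exact: expR_ge0]|rewrite invr_ge0 ltW].
exists M => // a b w eps t1 t2 z xi bw T1 T2 T2B sz Sx [T10 [c1 [T1E x1 y1]]] [T20 [c2 [T2E x2 y2]]].
have nT1 : 0 < normc T1 by rewrite normc_gt0.
have nT2 : 0 < normc T2 by rewrite normc_gt0.
have g : good_direction 0 k2 xi T2.
  split; first exact: T20.
  by exists c2; split; [exact: T2E|clear -x2 d0; lra|clear -y2 d0; lra].
have hcos (k : nat) c : - (pi / 2) + delta < k%:R * xi - k%:R * c -> k%:R * xi - k%:R * c < pi / 2 - delta ->
    s <= cos (k%:R * (xi - c)).
  rewrite -mulrBr => h1 h2; rewrite sE; apply: cos_lower; last by clear -del0; lra.
  by rewrite ler_norml; clear -h1 h2 deld; apply/andP; split; lra.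
have growth r : 0 <= r -> nu * r ^+ kp - (s / 2) * (r / normc T2) ^+ k2 <= L + 1 - r.
  move=> r0; have h2 : normc T2 <= B * 1 ^+ 0 by rewrite expr0 mulr1.
  have := hL 1 (normc T2) r ler01 nT2 h2 r0; rewrite expr1n mulr1.
  by move: (nu * _) (s / 2 * _) => x y h; clear -h; lra.
have MX X : 0 < X -> (Num.sqrt (2 * pi))^-1 * (2 * (2 * (varpi * expR (L + 1 + s) * (s / 2 / X)^-1) * I1)) = M * X.
  by move=> X0; rewrite /M invf_div; move: (Num.sqrt _)^-1 => v; field; rewrite gt_eqF.
(* By y <= 1 + y^k, half of the exponent becomes linear decay at rate s / (2 X), whose integral is 2
   X / s. *)
have drop (X : R) k r : 0 < X -> (0 < k)%N -> 0 <= r -> - (s / 2 * (r / X) ^+ k) <= s / 2 - s / 2 / X * r.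
  move=> X0 k0 r0; have y0 : 0 <= r / X by rewrite divr_ge0// ltW.
  have := ler_wpM2l (ltW s20) (le_1X k0 y0).
  rewrite mulrDr mulr1 (_ : s / 2 / X * r = s / 2 * (r / X)); last by rewrite mulrAC mulrA.
  by move: (s / 2 * (r / X)) (s / 2 * _) => x y h; clear -h; lra.
split.
  rewrite -(MX _ nT1).
  apply: (inner_sol_norm (s := s) v0 s0 _ bw Sx bb sz T1E T2E g (hcos _ _ x1 y1) (hcos _ _ x2 y2)).
    by rewrite divr_gt0.
  move=> r r0; have := growth r r0; have := drop _ _ _ nT1 k10 r0.
  have p1 : 0 <= s / 2 * (r / normc T1) ^+ k1.
    by apply: mulr_ge0; [exact: ltW|apply: exprn_ge0; rewrite divr_ge0// ltW].
  have p2 : 0 <= s / 2 * (r / normc T2) ^+ k2.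
    by apply: mulr_ge0; [exact: ltW|apply: exprn_ge0; rewrite divr_ge0// ltW].
  have e1 : s * (r / normc T1) ^+ k1 = 2 * (s / 2 * (r / normc T1) ^+ k1) by field.
  have e2 : s * (r / normc T2) ^+ k2 = 2 * (s / 2 * (r / normc T2) ^+ k2) by field.
  rewrite e1 e2; move: (nu * _) (s / 2 * (r / normc T1) ^+ k1) (s / 2 * (r / normc T2) ^+ k2) (s / 2 / _ * r) p1 p2 => v x y u p1 p2 h3 h4.
  by clear -p1 p2 h3 h4 r0 s0; lra.
rewrite -(MX _ nT2).
apply: (inner_sol_norm (s := s) v0 s0 _ bw Sx bb sz T1E T2E g (hcos _ _ x1 y1) (hcos _ _ x2 y2)).
  by rewrite divr_gt0.
move=> r r0; have := growth r r0; have := drop _ _ _ nT2 (ltn_trans k10 k12) r0.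
have p1 : 0 <= s * (r / normc T1) ^+ k1.
  by apply: mulr_ge0; [exact: ltW|apply: exprn_ge0; rewrite divr_ge0// ltW].
have e2 : s * (r / normc T2) ^+ k2 = 2 * (s / 2 * (r / normc T2) ^+ k2) by field.
rewrite e2; move: (nu * _) (s * (r / normc T1) ^+ k1) (s / 2 * (r / normc T2) ^+ k2) (s / 2 / _ * r) p1 => v x y u p1 h3 h4.
by clear -p1 h3 h4 r0 s0; lra.
Qed.

End InnerBound.

Lemma cvg0_within (R : realType) (A : set R[i]) (f : R[i] -> R[i]) (K r : R) : 0 < r -> 0 <= K ->
  (forall t, A t -> normc t < r -> normc (f t) <= K * normc t) ->
  f t @[t --> within A (nbhs 0)] --> (0 : R[i]).
Proof.
move=> r0 K0 hf; apply/cvgC_normP => e e0; rewrite near_withinE.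
have K1 : 0 < K + 1 by lra.
apply/nbhs_normcP; exists (Num.min r (e / (K + 1))); first by rewrite lt_min r0 divr_gt0.
move=> t; rewrite subr0 lt_min ltr_pdivlMr// => /andP[tr te] At.
rewrite subr0; apply: le_lt_trans (hf t At tr) _; apply: le_lt_trans te.
by rewrite mulrC ler_wpM2l ?normc_ge0//; lra.
Qed.

Theorem theorem1 (R : realType) (P : equation_data R) (hP : equation_hyp P)
  (gam : R[i] -> R[i] -> R) (hgam : forcing_direction P gam)
  (U : set R[i]) (rho : R) (hU : root_domain P U rho)
  (iota2 : nat) (E : 'I_iota2 -> set R[i]) (hE : good_covering P E)
  (d eta : 'I_iota2 -> R)
  (heta : forall h, 0 < eta h /\ eta h <= 2 * pi - pi / P.(k2)%:R)
  (T1 T2 : set R[i]) (delta : R) (xi : 'I_iota2 -> R[i] -> R[i] -> R[i] -> R)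
  (S := fun h => sector (d h - eta h / 2) (d h + eta h / 2))
  (hadm : admissible P U rho T1 T2 E S delta xi)
  (varpi : R) (hvarpi : 0 < varpi)
  (hH : forall h eps, disc P.(eps0) eps ->
     half_contraction P (S h) rho varpi (mapH P eps))
  (omega : 'I_iota2 -> R[i] -> R -> R[i] -> R[i])
  (homega : forall h eps, disc P.(eps0) eps ->
     fixed_point P (S h) rho varpi (mapH P eps)
       (fun tau m => omega h tau m eps))
  (mu2 : nat) (hmu2 : (P.(lam2) < mu2)%N)
  (hmu2' : (mu2%:R - P.(lam2)%:R) * (P.(kp)%:R^-1 - P.(k2)%:R^-1)^-1
             < P.(lam1)%:R * P.(k1)%:R :> R)
  (r2 R2 a2 b2 : R) (hr2 : 0 < r2) (hR2 : r2 < R2) (hab2 : a2 < b2)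
  (chi := annular_sector r2 R2 a2 b2)
  (theta : 'I_iota2 -> R)
  (htheta : forall h eps x2, E h eps -> chi x2 ->
     T2 (inner_point mu2 (theta h) eps x2))
  (u := fun h t1 t2 z eps => sol P (omega h) (xi h t1 t2 eps) t1 t2 z eps)
  (beta' : R) (hbeta' : 0 < beta' /\ beta' < P.(beta)) :
  (forall h eps, E h eps ->
    let T2eps := inner_domain chi mu2 (theta h) eps in
    [/\ (forall t1 t2 z, T1 t1 -> T2eps t2 -> strip beta' z ->
          sol_converges P (omega h) (xi h t1 t2 eps) t1 t2 z eps),
        (exists K : R, forall t1 t2 z, T1 t1 -> T2eps t2 -> strip beta' z ->
          normc (u h t1 t2 z eps) <= K),
        holomorphic_on (T1 `*` T2eps `*` strip beta')
          (fun p : R[i] * R[i] * R[i] => u h p.1.1 p.1.2 p.2 eps),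
        (forall t1 t2 z, T1 t1 -> T2eps t2 -> strip beta' z ->
          main_equation P eps (fun s1 s2 y => u h s1 s2 y eps)
            (fun s1 s2 y => forcing P gam s1 s2 y eps) t1 t2 z) &
        (forall t2 z, T2eps t2 -> strip beta' z ->
          u h t1 t2 z eps @[t1 --> within T1 (nbhs 0)] --> (0 : R[i])) /\
        (forall t1 z, T1 t1 -> strip beta' z ->
          u h t1 t2 z eps @[t2 --> within T2 (nbhs 0)] --> (0 : R[i]))]) /\
  (forall h, exists Ct Dt : R, [/\ 0 < Ct, 0 < Dt &
    forall eps, E h eps -> E (ordS h) eps ->
      forall t1 x2 z, T1 t1 -> chi x2 -> strip beta' z ->
        normc (u (ordS h) t1 (inner_point mu2 (theta h) eps x2) z eps
               - u h t1 (inner_point mu2 (theta h) eps x2) z eps)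
        <= Ct * expR (- (Dt / normc eps ^+ (P.(lam1) * P.(k1))))]).

Proof.
have [vb v1] := hbeta'.
have [_ hEs _ _ _] := hE.
have [bT1 uT2 hsuit d0 hdir] := hadm.
have [p1 [q1 [r1 [_ _ r10 T1E]]]] := bT1.
have [p2 [q2 [_ _ T2E]]] := uT2.
have sector_neq0 a b t : sector a b t -> t != 0 :> R[i].
  move=> [r [s [r0 _ _ ->]]].
  by rewrite mulf_neq0 ?expi_neq0// -normc_gt0 normc_real normr_gt0 gt_eqF.
have T1_open : open T1 by rewrite T1E; apply: openI; [exact: sector_open|exact: disc_open].
have T2_open : open T2 by rewrite T2E; exact: sector_open.
have T1_neq0 t : T1 t -> t != 0 by rewrite T1E => -[/sector_neq0].
have T1_r1 t : T1 t -> normc t < r1 by rewrite T1E => -[].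
have eps_disc h eps : E h eps -> disc P.(eps0) eps by have [_ sub] := hEs h; exact: sub.
have eps_neq0 h eps : E h eps -> eps != 0.
  by have [[a [b [r [_ _ _ ->]]]] _] := hEs h => -[/sector_neq0].
(* The aperture of [S h] is [eta h], so [heta] is exactly the bound under which directions may be
   rotated. *)
have a12 h : (d h + eta h / 2) - (d h - eta h / 2) <= 2 * pi - pi / P.(k2)%:R.
  by rewrite (_ : _ - _ = eta h); [have [_] := heta h|field].
have ball h eps : E h eps -> exp_ball P (S h) rho varpi (fun tau m => omega h tau m eps).
  by move=> /eps_disc de; have [] := homega h eps de.
have [hk1 hk2] := (andP (orders_k12 hP)).
have gp h eps : E h eps -> forall t1 t2, T1 t1 -> T2 t2 ->
   S h (expi (xi h t1 t2 eps)) /\ good_direction 0 P.(k2) (xi h t1 t2 eps) (eps ^+ P.(lam2) * t2).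
  move=> Ee t1 t2 h1 h2; have [g1 g2 g3] := hdir h t1 t2 eps h1 h2 Ee; split => //.
  exact: good_directionW (ltW d0) g3.
have gp1 h eps : E h eps -> forall t1 t2, T1 t1 -> T2 t2 ->
   good_direction 0 P.(k1) (xi h t1 t2 eps) (eps ^+ P.(lam1) * t1).
  move=> Ee t1 t2 h1 h2; have [g1 g2 g3] := hdir h t1 t2 eps h1 h2 Ee.
  exact: good_directionW (ltW d0) g2.
have rho0 : 0 < rho by case: hU.
have uE h t1 t2 z eps : u h t1 t2 z eps =
  inner_sol P (fun tau m => omega h tau m eps) (xi h t1 t2 eps) t1 t2 z eps by [].
(* On the inner domain |t2| is |x2| / |epsilon|^mu2, so |T2| has order |epsilon|^(lam2 - mu2). *)
have inner_norm h eps x2 : E h eps -> chi x2 ->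
    normc (eps ^+ P.(lam2) * inner_point mu2 (theta h) eps x2) <=
    R2 * (normc eps)^-1 ^+ (mu2 - P.(lam2)).
  move=> Ee [s [t [/andP[rs sR] _ ->]]]; rewrite /inner_point.
  have s0 : 0 < s by apply: lt_trans rs.
  have ne : 0 < normc eps by rewrite normc_gt0 (eps_neq0 _ _ Ee).
  rewrite !normcM normcV !normc_expi !mulr1 !normcX normc_real gtr0_norm//.
  rewrite (_ : normc eps ^+ mu2 = normc eps ^+ P.(lam2) * normc eps ^+ (mu2 - P.(lam2))); last first.
    by rewrite -exprD subnKC// ltnW.
  rewrite mulrCA invfM mulVKf ?gt_eqF ?exprn_gt0// exprVn.
  by rewrite ler_wpM2r ?invr_ge0 ?exprn_ge0 ?(ltW ne)// ltW.
split.
  move=> h eps Ee T2eps.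
  have T2epsP t2 : T2eps t2 -> T2 t2 by move=> [x2 cx <-]; exact: htheta.
  have e0 := eps_neq0 _ _ Ee; have de := eps_disc _ _ Ee.
  have bw := ball _ _ Ee; have tw := exp_ball_sector_tame hP hvarpi bw.
  have xg := gp _ _ Ee; have xg1 := gp1 _ _ Ee.
  split.
  - move=> t1 t2 z h1 /T2epsP h2 sz; have [Sx g] := xg t1 t2 h1 h2.
    have zb : `|Im z| < P.(beta) by apply: lt_trans v1.
    have Sr r : 0 < r -> S h (r%:C * expi (xi h t1 t2 eps)) by move=> r0; exact: sector_cone.
    exact: (inner_sol_converges hP t1 tw Sr g zb).
  (* T2 itself is unbounded; boundedness comes from the inner domain, where |T2| <= B for the given
     epsilon. *)
  - pose B := R2 * (normc eps)^-1 ^+ (mu2 - P.(lam2)).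
    have B0 : 0 <= B by rewrite mulr_ge0 ?exprn_ge0 ?invr_ge0 ?normc_ge0// ltW// (lt_trans hr2).
    have [K K0 hK] := inner_sol_bound hP rho hvarpi v1 d0 B0.
    exists (K * B) => t1 t2 z h1 h2 sz; have [Sx g1 g2] := hdir h t1 t2 eps h1 (T2epsP _ h2) Ee.
    have T2B : normc (eps ^+ P.(lam2) * t2) <= B by case: h2 => x2 cx <-; exact: inner_norm.
    have [_ h3] := hK _ _ _ _ _ _ _ _ bw T2B sz Sx g1 g2.
    by rewrite uE; apply: (le_trans h3); rewrite ler_wpM2l.
  (* Holomorphy, like the equation, is established on the open set [T1] times [T2] times the strip,
     and then restricted to the inner domain. *)
  - have hol := directed_sol_holomorphic hP (a12 h) (ltW v1) T1_open T2_open T1_neq0 xg tw.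
    by move=> [[t1 t2] z] [[h1 h2] sz]; apply: hol; split => //; split => //; exact: T2epsP.
  - move=> t1 t2 z h1 /T2epsP h2 sz.
    have fixw tau m : S h tau -> mapH P eps (fun tau m => omega h tau m eps) tau m = omega h tau m eps.
      by move=> St; have [_ fw] := homega h eps de; apply: fw; left.
    (* A zero of P_m in the sector would be a root, hence in [U], which is disjoint from a suitable
       sector. *)
    have Pm0 tau m : S h tau -> (Pm P m).[tau] != 0.
      move=> St; apply/negP => r0; have [_ _ _ hroot] := hU; have [Ut _] := hroot m tau r0.
      by have [SU _] := hsuit h; have : (S h `&` U) tau by []; rewrite SU.
    exact: (main_equation_directed_sol hP (a12 h) (ltW v1) T1_open T2_open e0 de T1_neq0 xg xg1 hgam
      tw Pm0 fixw h1 h2 sz).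
  - split.
      move=> t2 z h2 sz.
      have B0 : 0 <= normc (eps ^+ P.(lam2) * t2) by exact: normc_ge0.
      have [K K0 hK] := inner_sol_bound hP rho hvarpi v1 d0 B0.
      apply: (cvg0_within (r := 1) (K := K * normc (eps ^+ P.(lam1)))) => //.
        by rewrite mulr_ge0// normc_ge0.
      move=> t1 h1 _; have [Sx g1 g2] := hdir h t1 t2 eps h1 (T2epsP _ h2) Ee.
      have [h3 _] := hK _ _ _ _ _ _ _ _ bw (lexx _) sz Sx g1 g2.
      by rewrite uE; apply: (le_trans h3); rewrite normcM mulrA.
    move=> t1 z h1 sz.
    (* Near 0 one may assume |t2| < 1, so |T2| is bounded by |epsilon^lam2|, uniformly in t2. *)
    have B0 : 0 <= normc (eps ^+ P.(lam2)) by exact: normc_ge0.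
    have [K K0 hK] := inner_sol_bound hP rho hvarpi v1 d0 B0.
    apply: (cvg0_within (r := 1) (K := K * normc (eps ^+ P.(lam2)))) => //.
      by rewrite mulr_ge0// normc_ge0.
    move=> t2 h2 t21; have [Sx g1 g2] := hdir h t1 t2 eps h1 h2 Ee.
    have T2B : normc (eps ^+ P.(lam2) * t2) <= normc (eps ^+ P.(lam2)).
      by rewrite normcM -[leRHS]mulr1 ler_wpM2l ?normc_ge0// ltW.
    have [_ h3] := hK _ _ _ _ _ _ _ _ bw T2B sz Sx g1 g2.
    by rewrite uE; apply: (le_trans h3); rewrite normcM mulrA.
move=> h.
have gap := order_gap hP hmu2 hmu2'.
have R20 : 0 <= R2 by rewrite ltW// (lt_trans hr2).
have [Ct [Dt [Ct0 Dt0 hC]]] := inner_sol_difference_bound hP rho0 hvarpi v1 d0 r10 R20 gap.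
exists Ct, Dt; split => // eps Ee Ee' t1 x2 z h1 cx sz.
have e0 := eps_neq0 _ _ Ee; have de := eps_disc _ _ Ee.
have h2 := htheta _ _ _ Ee cx.
have [Sx g1 g2] := hdir h t1 _ eps h1 h2 Ee.
have [Sx' g1' g2'] := hdir (ordS h) t1 _ eps h1 h2 Ee'.
(* The rays avoid the vertex, so agreement off tau = 0 is all that the comparison of the two
   integrals requires. *)
have agree tau m : cdisc rho tau -> tau != 0 -> omega h tau m eps = omega (ordS h) tau m eps.
  exact: (fixed_points_agree hP de hvarpi (hH h eps de) (homega h eps de) (homega (ordS h) eps de)).
rewrite !uE.
exact: (hC _ _ _ _ _ _ _ _ _ _ _ _ (ball _ _ Ee) (ball _ _ Ee') agree e0 (ltW (T1_r1 _ h1))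
  (inner_norm _ _ _ Ee cx) sz Sx g1 g2 Sx' g1' g2').
Qed.
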